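(* Let $G$ be a Kazhdan group with a finite symmetric generating set $S=S^{-1}$, let $\mathcal U$ be a non-principal ultrafilter on $\mathbb N$, and let $\pi:G\to\prod_{\mathcal U}\mathrm{Sym}(X_n)$ be a sofic embedding represented by homomorphisms $\alpha_n:F_S\to\mathrm{Sym}(X_n)$. Then there exist an essentially equivalent sofic embedding $\pi':G\to\prod_{\mathcal U}\mathrm{Sym}(Y_n)$ and subgroups $A_n\le\mathrm{Sym}(Y_n)$ such that $$C_{\prod_{\mathcal U}\mathrm{Sym}(Y_n)}(\pi'(G))=\prod_{\mathcal U}A_n .$$
   Context: A Kazhdan group is a discrete group with Kazhdan's property (T); such a group is finitely generated. For a finite nonempty set $X$, the normalized Hamming distance on $\mathrm{Sym}(X)$ is $d_H(\sigma,\tau)=|\{x\in X:\sigma x\ne\tau x\}|/|X|$. For finite nonempty sets $X_n$, the metric ultraproduct $\prod_{\mathcal U}\mathrm{Sym}(X_n)$ is the quotient of the direct product of the groups $\mathrm{Sym}(X_n)$ by the normal subgroup of sequences with $\lim_{n\to\mathcal U}d_H(\sigma_n,1)=0$, with metric $d([\sigma_n]_{\mathcal U},[\tau_n]_{\mathcal U})=\lim_{n\to\mathcal U}d_H(\sigma_n,\tau_n)$. For subgroups $A_n\le\mathrm{Sym}(X_n)$, $\prod_{\mathcal U}A_n$ is the subgroup of classes $[a_n]_{\mathcal U}$ with $a_n\in A_n$. $C_M(H)$ denotes the centralizer of $H$ in $M$. A sofic embedding $\pi:G\to\prod_{\mathcal U}\mathrm{Sym}(X_n)$ is a homomorphism with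 $d(\pi(g),1)=1$ for every $g\ne e$. Let $F_S$ be the free group on the alphabet $S$, mapping onto $G$. The embedding $\pi$ is represented by homomorphisms $\alpha_n:F_S\to\mathrm{Sym}(X_n)$ if $\pi(\bar w)=[\alpha_n(w)]_{\mathcal U}$ for every $w\in F_S$ with image $\bar w\in G$; equivalently to being a sofic embedding, $\lim_{n\to\mathcal U}d_H(\alpha_n(w),1)$ is $0$ if $w\in\ker(F_S\to G)$ and $1$ otherwise. Two sofic embeddings of $G$ represented by homomorphisms $\alpha_n:F_S\to\mathrm{Sym}(X_n)$ and $\alpha_n':F_S\to\mathrm{Sym}(Y_n)$ are essentially equivalent if there are subsets $U_n\subseteq X_n$ and $U_n'\subseteq Y_n$ with $\lim_{n\to\mathcal U}|X_n\setminus U_n|/|X_n|=0$ and $\lim_{n\to\mathcal U}|Y_n\setminus U'_n|/|Y_n|=0$, and bijections $\varphi_n:U_n\to U_n'$ under which all generator maps agree, i.e. $\varphi_n(\alpha_n(s)x)=\alpha_n'(s)\varphi_n(x)$ for all $s\in S$ and all $x\in U_n$ with $\alpha_n(s)x\in U_n$. *)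

(* Defs.v *)
From HB Require Import structures.
From mathcomp Require Import all_boot all_order all_algebra all_fingroup.
From mathcomp Require Import finmap complex lra.
From mathcomp Require Import all_classical all_reals.
From mathcomp Require Import topology normedtype.

Set Implicit Arguments.
Unset Strict Implicit.
Unset Printing Implicit Defensive.

Import Order.TTheory GRing.Theory Num.Theory.
Import numFieldNormedType.Exports.

Local Open Scope classical_set_scope.
Local Open Scope ring_scope.

(* A unitary representation is a homomorphism into the unitary group of the
   Hilbert space [H], whose inner product [ip] is linear in its first argument.
   The group is discrete, so there is no continuity condition. *)
Definition unitary_representation (R : realType) (G : groupType)
    (H : completeNormedModType R[i]) (ip : {dot H for Num.conj})
    (rho : G -> {linear H -> H}) : Prop :=
  [/\ forall v, rho 1%g v = v,
      forall g h v, rho (g * h)%g v = rho g (rho h v) &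
      forall g u v, ip (rho g u) (rho g v) = ip u v].

(* Compact subsets of the discrete group [G] are the finite ones. *)
Definition property_T (R : realType) (G : groupType) : Prop :=
  exists (K : {fset G}) (eps : R), 0 < eps /\
    forall (H : completeNormedModType R[i]) (ip : {dot H for Num.conj})
           (rho : G -> {linear H -> H}),
      (forall v, ip v v = `|v| ^+ 2) ->
      unitary_representation ip rho ->
      (exists v : H, v != 0 /\
         forall g, g \in K -> `|rho g v - v| < eps%:C%C * `|v|) ->
      exists v : H, v != 0 /\ forall g, rho g v = v.

Definition subgroup_closed (G : groupType) (A : set G) : Prop :=
  [/\ A 1%g, forall x y, A x -> A y -> A (x * y)%g & forall x, A x -> A x^-1%g].

Definition generates (G : groupType) (S : {fset G}) : Prop :=
  smallest (@subgroup_closed G) [set` S] = setT.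

Definition symmetric_fset (G : groupType) (S : {fset G}) : Prop :=
  forall s, s \in S -> s^-1%g \in S.

Definition centralizer (M : groupType) (A : set M) : set M :=
  [set m | forall h, A h -> commute m h].

(* Free group on [S]: reduced words in the letters [(s, false)], standing for
   the generator s, and [(s, true)], standing for its formal inverse. *)
Section FreeGroup.
Variable S : choiceType.
Implicit Types (x y : S * bool) (u v w : seq (S * bool)).

Definition flip x : S * bool := (x.1, ~~ x.2).

Definition reduced w := sorted [rel x y | y != flip x] w.

Definition push x w :=
  if w is y :: w' then if y == flip x then w' else x :: w else [:: x].

Record freegroup := FreeGroup { word :> seq (S * bool); _ : reduced word }.
HB.instance Definition _ := [isSub for word].
HB.instance Definition _ := [Choice of freegroup by <:].

Lemma flipK : involutive flip.
Proof. by case=> s b; rewrite /flip /= negbK. Qed.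

Lemma push_reduced x w : reduced w -> reduced (push x w).
Proof.
case: w => [//|y w] /= Hw; case: eqP => [_|/eqP nyx].
  exact: path_sorted Hw.
by rewrite /reduced /= nyx.
Qed.

Lemma push_flipK x w : reduced w -> push x (push (flip x) w) = w.
Proof.
case: w => [_|y w] /=; first by rewrite eqxx.
rewrite flipK; case: eqP => [->|_ _]; last by rewrite /= eqxx.
by case: w => [//|z w] /= /andP[/negbTE -> _].
Qed.

Lemma pushK x w : reduced w -> push (flip x) (push x w) = w.
Proof. by move=> Hw; rewrite -{2}[x]flipK push_flipK. Qed.

Definition fmulw u v := foldr push v u.

Lemma fmulw_reduced u v : reduced v -> reduced (fmulw u v).
Proof. by move=> Hv; elim: u => [//|x u IH] /=; exact: push_reduced. Qed.

Lemma fmulw_push x u w :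
  reduced w -> fmulw (push x u) w = push x (fmulw u w).
Proof.
move=> Hw; case: u => [//|y u] /=; case: eqP => [->|//].
by rewrite push_flipK //; exact: fmulw_reduced.
Qed.

Lemma fmulwA u v w : reduced w -> fmulw u (fmulw v w) = fmulw (fmulw u v) w.
Proof.
by move=> Hw; elim: u => [//|x u IH] /=; rewrite IH -fmulw_push.
Qed.

Lemma fmulw0 u : reduced u -> fmulw u [::] = u.
Proof.
elim: u => [//|x u IH] /= Hxu; rewrite IH; last exact: path_sorted Hxu.
by case: u Hxu {IH} => [//|y u] /= /andP[/negbTE -> _].
Qed.

Definition finvw u := rev (map flip u).

Lemma finvw_reduced u : reduced u -> reduced (finvw u).
Proof.
rewrite /reduced /finvw rev_sorted sorted_map => H; apply: sub_sorted H.
move=> x y /=; rewrite flipK; apply: contra => /eqP ->; by rewrite ?flipK.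
Qed.

Lemma finvwK : involutive finvw.
Proof.
by move=> u; rewrite /finvw map_rev revK mapK //; exact: flipK.
Qed.

Lemma fmulVw u w : reduced w -> fmulw (finvw u) (fmulw u w) = w.
Proof.
move=> Hw; elim: u => [//|x u IH] /=.
rewrite /finvw /= rev_cons /fmulw foldr_rcons -/(fmulw _ _) -/(fmulw _ _).
by rewrite pushK //; exact: fmulw_reduced.
Qed.

Definition fone : freegroup := @FreeGroup [::] isT.
Definition fmul (u v : freegroup) : freegroup :=
  FreeGroup (fmulw_reduced u (valP v)).
Definition finv (u : freegroup) : freegroup := FreeGroup (finvw_reduced (valP u)).

Lemma fmulA : associative fmul.
Proof. by move=> u v w; apply/val_inj/fmulwA/(valP w). Qed.
Lemma fmul1 : left_id fone fmul.
Proof. by move=> u; apply/val_inj. Qed.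
Lemma fmulr1 : right_id fone fmul.
Proof. by move=> u; apply/val_inj/fmulw0/(valP u). Qed.
Lemma fmulV : left_inverse fone finv fmul.
Proof.
move=> u; apply/val_inj => /=.
by rewrite -{2}(fmulw0 (valP u)) fmulVw.
Qed.
Lemma fmulrV : right_inverse fone finv fmul.
Proof.
move=> u; have {1}-> : u = finv (finv u) by apply/val_inj; rewrite /= finvwK.
exact: fmulV.
Qed.

HB.instance Definition _ :=
  isGroup.Build freegroup fmulA fmul1 fmulr1 fmulV fmulrV.

Definition freegen (s : S) : freegroup := @FreeGroup [:: (s, false)] isT.

Section Eval.
Variables (G : groupType) (f : S -> G).

Definition eval_letter x : G := if x.2 then (f x.1)^-1%g else f x.1.

Definition freegroup_eval (w : freegroup) : G :=
  (\prod_(x <- word w) eval_letter x)%g.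

Lemma eval_flip x : eval_letter (flip x) = (eval_letter x)^-1%g.
Proof. by case: x => s [] //=; rewrite /eval_letter /= invgK. Qed.

Lemma eval_push x w : (\prod_(y <- push x w) eval_letter y
  = eval_letter x * \prod_(y <- w) eval_letter y)%g.
Proof.
case: w => [|y w] /=; first by rewrite big_seq1 big_nil mulg1.
case: eqP => [->|_]; last by rewrite big_cons.
by rewrite big_cons eval_flip mulKVg.
Qed.

Lemma freegroup_evalM : {morph freegroup_eval : u v / (u * v)%g}.
Proof.
move=> u v; rewrite /freegroup_eval /=.
elim: (word u) => [|x w IH] /=; first by rewrite big_nil mul1g.
by rewrite eval_push IH big_cons mulgA.
Qed.

HB.instance Definition _ :=
  isMultiplicative.Build freegroup G freegroup_eval freegroup_evalM.

Lemma freegroup_eval_gen s : freegroup_eval (freegen s) = f s.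
Proof. by rewrite /freegroup_eval big_seq1. Qed.

End Eval.
End FreeGroup.

(* Products of permutations are those of the library: [(s * t) x = t (s x)].
   Replacing every permutation by its inverse exchanges this with the opposite
   convention; it changes neither the Hamming distances, nor subgroups and
   centralizers, nor the relation [essentially_equivalent] below. *)
Section Hamming.
Variables (R : realType) (X : finType).
Implicit Types s t u : {perm X}.

Definition hamming s t : R :=
  #|[set x | s x != t x]%SET|%:R / #|X|%:R.

Lemma hamming_ge0 s t : 0 <= hamming s t.
Proof. by rewrite divr_ge0. Qed.

Lemma hamming_le1 s t : hamming s t <= 1.
Proof.
rewrite /hamming; have [->|X0] := posnP #|X|; first by rewrite invr0 mulr0.
by rewrite ler_pdivrMr ?ltr0n // mul1r ler_nat max_card.
Qed.

Lemma hammingxx s : hamming s s = 0.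
Proof.
by rewrite /hamming eq_card0 ?mul0r // => x; rewrite !inE eqxx.
Qed.

Lemma hammingC s t : hamming s t = hamming t s.
Proof.
by congr (_%:R / _); apply: eq_card => x; rewrite !inE eq_sym.
Qed.

Lemma hamming_triangle t s u : hamming s u <= hamming s t + hamming t u.
Proof.
rewrite /hamming -mulrDl ler_wpM2r ?invr_ge0 // -natrD ler_nat.
apply: leq_trans (leq_card_setU _ _); apply/subset_leq_card/fintype.subsetP => x.
by rewrite !inE -negb_and; apply: contra => /andP[/eqP -> ].
Qed.

Lemma hammingMr u s t : hamming (s * u)%g (t * u)%g = hamming s t.
Proof.
rewrite /hamming; congr (_%:R / _); apply: eq_card => x.
by rewrite !inE !permM (inj_eq perm_inj).
Qed.

Lemma hammingMl u s t : hamming (u * s)%g (u * t)%g = hamming s t.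
Proof.
rewrite /hamming; congr (_%:R / _); rewrite -(card_imset _ (@perm_inj _ u)).
apply: eq_card => x; rewrite !inE; apply/imsetP/idP => [[y] | nx].
  by rewrite inE !permM => nst ->.
by exists (u^-1%g x); rewrite ?permKV // inE !permM permKV.
Qed.

End Hamming.

Section Ultraproduct.
Variables (R : realType) (U : set_system nat) (FU : UltraFilter U).
Variable X : nat -> finType.

Definition symprod := forall n, {perm X n}.
HB.instance Definition _ := Choice.on symprod.

Implicit Types s t u : symprod.

Definition spone : symprod := fun n => 1%g.
Definition spinv s : symprod := fun n => (s n)^-1%g.
Definition spmul s t : symprod := fun n => (s n * t n)%g.

Lemma spmulA : associative spmul.
Proof. by move=> s t u; apply: functional_extensionality_dep => n; exact: mulgA. Qed.
Lemma spmul1 : left_id spone spmul.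
Proof. by move=> s; apply: functional_extensionality_dep => n; exact: mul1g. Qed.
Lemma spmulr1 : right_id spone spmul.
Proof. by move=> s; apply: functional_extensionality_dep => n; exact: mulg1. Qed.
Lemma spmulV : left_inverse spone spinv spmul.
Proof. by move=> s; apply: functional_extensionality_dep => n; exact: mulVg. Qed.
Lemma spmulrV : right_inverse spone spinv spmul.
Proof. by move=> s; apply: functional_extensionality_dep => n; exact: mulgV. Qed.

HB.instance Definition _ :=
  isGroup.Build symprod spmulA spmul1 spmulr1 spmulV spmulrV.

Definition null : set symprod :=
  [set s | (fun n => hamming R (s n) 1%g) @ U --> (0 : R)].

Definition null_rel : rel symprod := fun s t => `[< null (s^-1 * t)%g >].

Lemma null_relE s t :
  null_rel s t = `[< (fun n => hamming R (s n) (t n)) @ U --> (0 : R) >].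
Proof.
rewrite /null_rel /null /=; congr `[< _ >].
suff -> : (fun n => hamming R ((s^-1 * t)%g n) 1%g) =
          (fun n => hamming R (s n) (t n)) by [].
apply/funext => n.
by rewrite -(hammingMl _ (s n)) -[(s^-1 * t)%g n]/((s n)^-1 * t n)%g mulKVg mulg1 hammingC.
Qed.

Lemma null_squeeze (f g : nat -> R) : (forall n, 0 <= f n <= g n) ->
  g @ U --> (0 : R) -> f @ U --> (0 : R).
Proof.
move=> fg g0; apply: (@squeeze_cvgr _ _ _ _ (cst 0) g) => //; last exact: cvg_cst.
by near=> n; exact: fg.
Unshelve. all: by end_near. Qed.

Lemma null_rel_equiv : equiv_class_of null_rel.
Proof.
split=> [s|s t|t s u].
- rewrite null_relE; apply/asboolP.
  by under eq_fun do rewrite hammingxx; exact: cvg_cst.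
- by rewrite !null_relE; under eq_fun do rewrite hammingC.
- rewrite !null_relE => /asboolP st /asboolP tu; apply/asboolP.
  apply: (@null_squeeze _ (fun n => hamming R (s n) (t n) + hamming R (t n) (u n))).
    by move=> n; rewrite hamming_ge0 hamming_triangle.
  by rewrite -[0 : R]addr0; exact: cvgD.
Qed.

Canonical null_rel_equiv_rel := EquivRelPack null_rel_equiv.

Definition uprod := {eq_quot null_rel_equiv_rel}%qT.
HB.instance Definition _ := Choice.on uprod.
HB.instance Definition _ := EqQuotient.on uprod.

Definition uclass s : uprod := (\pi_uprod s)%qT.

Lemma uclassP s t : uclass s = uclass t <->
  (fun n => hamming R (s n) (t n)) @ U --> (0 : R).
Proof.
rewrite /uclass; split=> [/eqmodP|st]; first by rewrite /= null_relE => /asboolP.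
by apply/eqmodP; rewrite /= null_relE; apply/asboolP.
Qed.

Definition rep (x : uprod) : symprod := generic_quotient.repr x.

Lemma uclassK (x : uprod) : uclass (rep x) = x.
Proof. exact: generic_quotient.reprK. Qed.

Lemma repr_uclass s :
  (fun n => hamming R (rep (uclass s) n) (s n)) @ U --> (0 : R).
Proof. by apply/uclassP; rewrite uclassK. Qed.

Definition umul (x y : uprod) : uprod := uclass (rep x * rep y)%g.
Definition uinv (x : uprod) : uprod := uclass (rep x)^-1%g.
Definition uone : uprod := uclass 1%g.

Lemma umulE s t : umul (uclass s) (uclass t) = uclass (s * t)%g.
Proof.
apply/uclassP.
pose d := fun (r : symprod) n => hamming R (rep (uclass r) n) (r n).
apply: (@null_squeeze _ (fun n => d s n + d t n)); last first.
  by rewrite -[0 : R]addr0; apply: cvgD; exact: repr_uclass.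
move=> n; rewrite hamming_ge0 /=.
apply: le_trans (hamming_triangle _ (s n * rep (uclass t) n)%g _ _) _.
by rewrite hammingMr hammingMl.
Qed.

Lemma uinvE s : uinv (uclass s) = uclass s^-1%g.
Proof.
apply/uclassP; set f := (f in f @ U).
suff -> : f = (fun n => hamming R (rep (uclass s) n) (s n)).
  exact: repr_uclass.
apply/funext => n; rewrite /f.
rewrite -(hammingMl _ (s n)) -(hammingMr _ (rep (uclass s) n)).
rewrite -[(rep _)^-1%g n]/((rep _ n)^-1)%g -[s^-1%g n]/((s n)^-1)%g.
by rewrite mulgV mul1g mulgVK hammingC.
Qed.

Lemma umulA : associative umul.
Proof.
move=> x y z; rewrite -(uclassK x) -(uclassK y) -(uclassK z).
by rewrite !umulE mulgA.
Qed.
Lemma umul1 : left_id uone umul.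
Proof. by move=> x; rewrite -(uclassK x) umulE mul1g. Qed.
Lemma umulr1 : right_id uone umul.
Proof. by move=> x; rewrite -(uclassK x) umulE mulg1. Qed.
Lemma umulV : left_inverse uone uinv umul.
Proof. by move=> x; rewrite -(uclassK x) uinvE umulE mulVg. Qed.
Lemma umulrV : right_inverse uone uinv umul.
Proof. by move=> x; rewrite -(uclassK x) uinvE umulE mulgV. Qed.

HB.instance Definition _ :=
  isGroup.Build uprod umulA umul1 umulr1 umulV umulrV.

Lemma uclassM s t : uclass (s * t)%g = (uclass s * uclass t)%g.
Proof. by rewrite -umulE. Qed.

HB.instance Definition _ := isMultiplicative.Build symprod uprod uclass uclassM.

Definition udist (x y : uprod) : R :=
  lim ((fun n => hamming R (rep x n) (rep y n)) @ U).

Lemma cvg_bounded_ultra (f : nat -> R) (a b : R) :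
  (forall n, a <= f n <= b) -> cvg (f @ U).
Proof.
move=> fab.
have fU : (f @ U) [set` `[a, b]].
  rewrite /= (_ : f @^-1` _ = setT); first exact: filterT.
  by rewrite -subTset => n _ /=; rewrite in_itv /=; exact: fab.
have [p [_ pf]] := @segment_compact R a b (f @ U) _ fU.
apply/cvg_ex; exists p => B Bp.
have [//|nB] := in_ultra_setVsetC (f @^-1` B) FU.
by have [r [/= nBr]] := pf (~` B) B nB Bp.
Qed.

Lemma cvg_udist s t :
  (fun n => hamming R (s n) (t n)) @ U --> udist (uclass s) (uclass t).
Proof.
pose d r n := hamming R (rep (uclass r) n) (r n).
pose e n := hamming R (rep (uclass s) n)
                      (rep (uclass t) n).
have ecvg : e @ U --> udist (uclass s) (uclass t).
  by apply: (@cvg_bounded_ultra _ 0 1) => n; rewrite hamming_ge0 hamming_le1.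
rewrite -[udist _ _]addr0.
have -> : (fun n => hamming R (s n) (t n)) =
          (fun n => e n + (hamming R (s n) (t n) - e n)).
  by apply/funext => n; rewrite addrC subrK.
apply: cvgD => //; apply: norm_cvg0.
apply: (@null_squeeze _ (fun n => d s n + d t n)); last first.
  by rewrite -[0 : R]addr0; apply: cvgD; exact: repr_uclass.
move=> n; rewrite normr_ge0 /= ler_norml; apply/andP; split.
  rewrite lerBrDl lerBlDr /e.
  have := hamming_triangle R (s n) (rep (uclass s) n)
            (rep (uclass t) n).
  have := hamming_triangle R (t n) (s n) (rep (uclass t) n).
  rewrite (hammingC _ (t n) (rep _ n)) /d; lra.
rewrite lerBlDr /e.
have := hamming_triangle R (rep (uclass s) n) (s n) (t n).
have := hamming_triangle R (rep (uclass t) n)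
          (rep (uclass s) n) (t n).
rewrite (hammingC _ (s n) (rep _ n)) /d; lra.
Qed.

Definition usub (A : forall n, {group {perm X n}}) : set uprod :=
  [set x | exists2 a : symprod, forall n, a n \in A n & x = uclass a].

Definition sofic_embedding (G : groupType)
    (rho : {multiplicative G -> uprod}) : Prop :=
  forall g : G, g != 1%g -> udist (rho g) 1%g = 1.

Definition represented_by (G : groupType) (S : {fset G})
    (rho : {multiplicative G -> uprod})
    (alpha : forall n, {multiplicative freegroup S -> {perm X n}}) : Prop :=
  forall w : freegroup S,
    rho (freegroup_eval val w) = uclass (fun n => alpha n w).

End Ultraproduct.

(* [phi n] only matters on [V n], where it is a bijection onto [V' n]. *)
Definition essentially_equivalent (R : realType) (U : set_system nat)
    (S : choiceType) (X Y : nat -> finType)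
    (alpha : forall n, {multiplicative freegroup S -> {perm X n}})
    (alpha' : forall n, {multiplicative freegroup S -> {perm Y n}}) : Prop :=
  exists (V : forall n, {set X n}) (V' : forall n, {set Y n})
         (phi : forall n, X n -> Y n),
    [/\ (fun n => #|~: V n|%:R / #|X n|%:R) @ U --> (0 : R),
        (fun n => #|~: V' n|%:R / #|Y n|%:R) @ U --> (0 : R),
        forall n, {in V n &, injective (phi n)},
        forall n, phi n @: V n = V' n &
        forall n (s : S) (x : X n),
          x \in V n -> alpha n (freegen s) x \in V n ->
          phi n (alpha n (freegen s) x) = alpha' n (freegen s) (phi n x)].

(* Main.v *)
From HB Require Import structures.
From mathcomp Require Import all_boot all_order all_algebra all_fingroup zify.
From mathcomp Require Import boolp.
Require Import Defs.

Set Implicit Arguments.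
Unset Strict Implicit.
Unset Printing Implicit Defensive.

(** Property (T) is used through one statement about finite permutation
    actions, [set_rigidity]: if the relators of short length nearly hold on a
    set [A], then [A] is close to a set whose boundary is an arbitrarily small
    fraction of its size, at a distance controlled linearly by the boundary of
    [A]. To see this, form the ultraproduct of the spaces l2(X), normalized by
    the size of [A], along a sequence of counterexamples. The indicator vectors
    of the sets [A] give a vector that the relators fix, and the group acts on
    such vectors; property (T) provides an invariant one nearby, and a level set
    of an almost invariant function has a small boundary.

    Rigidity, together with a greedy cutting argument, splits each [X n] into
    expanders, up to few points ([expander_parts]). A permutation that almost
    commutes with the generators respects most edges. Since the parts expand, it
    carries most parts essentially onto other parts ([card_unmatched]), and on a
    part it is determined, up to few points, by its germ, that is by its values
    on more than half of the part. Rigidity in [X * X], applied to the graph of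
    the permutation, shows that the germ is also represented by a permutation
    with an arbitrarily small defect ([germ_improvement]). Hence germs can be
    composed and inverted: they are the arrows of a finite groupoid, which acts
    on the parts up to very small errors ([germ_action]).

    These errors are removed by changing the set. A point [z], seen through an
    arrow [g], is replaced by the function which maps an arrow [h] with the same
    source to the image of [z] under [g^-1 h]. Translation by arrows acts exactly
    on these functions, and still does so after functions that agree at most
    arrows have been identified. Almost all points of the parts survive, and few
    new ones appear ([emb_dom_large], [card_ypt]). So the groupoid acts
    exactly on a set [Y] that almost coincides with [X], and its bisections form
    a group [A] of permutations of [Y]. The elements of [A] correspond to the
    permutations of [X] that almost commute with the generators; this is the
    finite form of the theorem, [exists_model].

    Along the ultrafilter the precision of these models tends to infinity
    ([model_sequence]). The partial bijections between [X n] and [Y n] identify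
    the two ultraproducts isometrically ([uprod_transfer]), and carry the sofic
    embedding to an essentially equivalent one. A class in the ultraproduct
    commutes with the image of the group exactly when the permutations that
    represent it almost commute with the generators ([negligible_defect]), that
    is exactly when it comes from a sequence in the groups [A n]. *)

(** * Cutting a graph into expanders *)

Section Boundary.
Variables (S X : finType) (f : S -> {perm X}).

Definition bd (B : {set X}) : nat :=
  \sum_(s : S) #|[set x | (x \in B) != (f s x \in B)]|.

End Boundary.

Definition symdiff (X : finType) (A B : {set X}) : {set X} :=
  [set x | (x \in A) != (x \in B)].

Lemma card_le_sub (T : finType) (A B : {set T}) :
  (forall x, x \in A -> x \in B) -> #|A| <= #|B|.
Proof. by move=> h; apply/subset_leq_card/subsetP. Qed.

Lemma card_le_inj (T T' : finType) (A : {set T}) (B : {set T'}) (g : T -> T') :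
  {in A &, injective g} -> (forall x, x \in A -> g x \in B) -> #|A| <= #|B|.
Proof.
move=> gi gB; rewrite -(card_in_imset gi); apply: card_le_sub => y.
by move=> /imsetP[x xA ->]; exact: gB.
Qed.

Section Greedy.
Variables (S X : finType) (f : S -> {perm X}).
Implicit Types (A B P Z : {set X}).

(** Edges that leave [Z] do not count: this is the boundary in the induced
    subgraph. *)
Definition bd_in Z B : nat :=
  \sum_(s : S) #|[set x in Z | (f s x \in Z) && ((x \in B) != (f s x \in B))]|.

Lemma bd_in_le Z B : bd_in Z (B :&: Z) <= bd f B.
Proof.
apply: leq_sum => s _; apply: card_le_sub => x; rewrite !inE.
by case/and3P => xZ sZ; rewrite xZ sZ !andbT.
Qed.

Definition cut_in Z (p : X -> {set X}) : nat :=
  \sum_(s : S) #|[set x in Z | (f s x \in Z) && (p x != p (f s x))]|.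

(** A partition of [Z], encoded by the map that sends a point to its block. *)
Definition partition_map Z (p : X -> {set X}) : Prop :=
  forall x, x \in Z -> [/\ x \in p x, p x \subset Z & forall y, y \in p x -> p y = p x].

(** Minimality makes [P] expand: a smaller set with a small boundary would be a
    better choice. *)
Definition least_nonexpanding (L : nat) P : Prop :=
  exists Z : {set X}, [/\ P \subset Z, P != set0, L * bd_in Z P <= #|P| &
    forall B, B \subset Z -> B != set0 -> #|B| < #|P| -> #|B| < L * bd_in Z B].

(** Cutting off, again and again, a smallest set with small relative boundary
    in what is left costs few edges in total: every edge is paid for by the
    piece that is cut off. *)
Lemma greedy_partition (L : nat) Z :
  exists p, [/\ partition_map Z p, L * cut_in Z p <= #|Z| &
    forall x, x \in Z -> least_nonexpanding L (p x)].
Proof.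
have [n Zn] := ubnP #|Z|; elim: n Z Zn => // n IH Z; rewrite ltnS => Zn.
have [Z0|Z0] := eqVneq Z set0.
  exists (fun=> set0); rewrite Z0; split => [x||x]; rewrite ?inE //.
  by rewrite /cut_in big1 ?muln0 // => s _; apply: eq_card0 => x; rewrite !inE.
pose ok B := [&& B \subset Z, B != set0 & L * bd_in Z B <= #|B|].
have okZ : ok Z.
  rewrite /ok subxx Z0 /= /bd_in big1 ?muln0 // => s _.
  by apply: eq_card0 => x; rewrite !inE; case: (x \in Z); case: (f s x \in Z).
pose A := [arg min_(B < Z | ok B) #|B|].
have [okA Amin] : ok A /\ forall B, ok B -> #|A| <= #|B|.
  by rewrite /A; case: arg_minnP.
have /and3P[AZ A0 bA] := okA.
have cardA : #|A| + #|Z :\: A| = #|Z| by rewrite cardsD (setIidPr AZ) subnKC ?subset_leq_card.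
have [|p [pp pc pm]] := IH (Z :\: A).
  by move: A0; rewrite -card_gt0; move: cardA Zn; lia.
pose q x := if x \in A then A else p x.
exists q; split.
- move=> x xZ; rewrite /q; case: ifPn => xA.
    by split => // y ->.
  have [|xp pZ py] := pp x; first by rewrite inE xA.
  split=> //; first by apply: subset_trans pZ (subsetDl _ _).
  by move=> y yp; have := subsetP pZ _ yp; rewrite inE => /andP[/negbTE -> _]; exact: py.
- apply: leq_trans (_ : L * (bd_in Z A + cut_in (Z :\: A) p) <= _); last first.
    by rewrite mulnDr -cardA leq_add.
  rewrite leq_mul2l -big_split; apply/orP; right; apply: leq_sum => s _ /=.
  apply: leq_trans (leq_card_setU _ _); apply: card_le_sub => x; rewrite !inE /q.
  case: (x \in Z) => //=; case: (f s x \in Z) => //=.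
  by case: (x \in A); case: (f s x \in A); rewrite ?eqxx ?orbT // => _; rewrite orbT.
- move=> x xZ; rewrite /q; case: ifPn => xA; last by apply: pm; rewrite inE xA.
  exists Z; split => // B BZ B0 BA; rewrite ltnNge; apply/negP => h.
  by have := Amin B; rewrite /ok BZ B0 h leqNgt BA; move=> /(_ isT).
Qed.

End Greedy.

Lemma card_sumb (X : finType) (P : pred X) : #|[set x | P x]| = \sum_x (P x : nat).
Proof. by rewrite -sum1_card big_mkcond; apply: eq_bigr => x _; rewrite inE; case: (P x). Qed.

Lemma set_id_sum (X : finType) (A : {set X}) : [set x | x \in A] = A.
Proof. by apply/setP => x; rewrite inE. Qed.

Section PartSums.
Variables (S X : finType) (f : S -> {perm X}) (p : X -> {set X}).
Hypothesis pP : partition_map [set: X] p.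

Lemma mem_part x P : P \in p @: [set: X] -> (x \in P) = (P == p x).
Proof.
move=> /imsetP[y _ ->]; have [yy _ py] := pP (in_setT y).
apply/idP/eqP => [/py //| ->]; by have [] := pP (in_setT x).
Qed.

Lemma sum_part_delta x : \sum_(P in p @: [set: X]) (P == p x) = 1.
Proof.
rewrite (bigD1 (p x)) /=; last exact: imset_f.
by rewrite eqxx big1 // => P /andP[_ /negbTE ->].
Qed.

Lemma card_light_parts (g : {set X} -> nat) :
  #|[set x | #|p x| < g (p x)]| <= \sum_(P in p @: [set: X]) g P.
Proof.
rewrite -sum1_card (partition_big p (mem (p @: [set: X]))) /=; last first.
  by move=> x _; exact: imset_f.
apply: leq_sum => P Pi; rewrite sum1_card.
have [lt|ge] := ltnP #|P| (g P).
  apply: leq_trans (ltnW lt); apply/subset_leq_card/subsetP => x.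
  by rewrite unfold_in => /andP[_ /eqP <-]; case: (pP (in_setT x)).
rewrite eq_card0 // => x; rewrite unfold_in inE.
by apply/negP => /andP[h /eqP e]; move: h; rewrite e ltnNge ge.
Qed.

Lemma sum_bd_parts : \sum_(P in p @: [set: X]) bd f P <= 2 * cut_in f [set: X] p.
Proof.
rewrite /bd exchange_big /cut_in big_distrr; apply: leq_sum => s _ /=.
under eq_bigr do rewrite card_sumb.
rewrite exchange_big card_sumb big_distrr; apply: leq_sum => x _ /=; rewrite !inE /=.
have [e|ne] := eqVneq (p x) (p (f s x)).
  by rewrite big1 // => P Pi; rewrite !mem_part // e eqxx.
rewrite muln1 (_ : 2 = 1 + 1) // -{1}(sum_part_delta x) -(sum_part_delta (f s x)) -big_split /=.
apply: leq_sum => P Pi; rewrite !mem_part //.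
by case: (P == p x); case: (P == p (f s x)).
Qed.

Lemma sum_card_parts (B : {set X}) : \sum_(P in p @: [set: X]) #|P :&: B| <= #|B|.
Proof.
under eq_bigr do rewrite -[_ :&: _]set_id_sum card_sumb.
rewrite exchange_big -[B in leqRHS]set_id_sum card_sumb; apply: leq_sum => x _.
case xB: (x \in B); last by rewrite big1 // => P _; rewrite inE xB andbF.
rewrite /= -(sum_part_delta x); apply: leq_sum => P Pi.
by rewrite inE xB andbT mem_part //; case: (P == _).
Qed.

End PartSums.

Section Rigidity.
Variables (S : finType) (Ker : freegroup S -> Prop).

Definition gens (X : finType) (a : {multiplicative freegroup S -> {perm X}}) :
  S -> {perm X} := fun s => a (freegen s).

(** The points at which [a] can be told apart, by a word of length at most [m],
    from an action of the quotient by [Ker]. *)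
Definition bad_pts (X : finType) (a : {multiplicative freegroup S -> {perm X}})
    (m : nat) : {set X} :=
  [set x | `[< exists w, [/\ Ker w, size (word w) <= m & a w x != x] >]].

Lemma bad_ptsS (X : finType) (a : {multiplicative freegroup S -> {perm X}}) m m' :
  m <= m' -> bad_pts a m \subset bad_pts a m'.
Proof.
move=> mm; apply/subsetP => x; rewrite !inE => /asboolP[w [kw wm ax]].
by apply/asboolP; exists w; split => //; exact: leq_trans mm.
Qed.

(** Property (T) in the form used for finite actions. What matters is that [C]
    does not depend on the precision [k]. *)
Definition rigid (C : nat) : Prop := forall k, exists m,
  forall (X : finType) (a : {multiplicative freegroup S -> {perm X}}) (A : {set X}),
    m * #|A :&: bad_pts a m| <= #|A| ->
    exists A' : {set X}, k * #|symdiff A A'| <= k * C * bd (gens a) A + #|A| /\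
                         k * bd (gens a) A' <= #|A|.

(** Sets of at most half the size of [P] expand, except when they are a
    fraction [1 / K] of [P]: an approximate action does not see such sets. *)
Definition expander_part (X : finType) (f : S -> {perm X}) (C K : nat) (P : {set X}) :=
  [/\ P != set0, K * bd f P <= #|P| &
      forall B : {set X}, B \subset P -> 2 * #|B| <= #|P| -> K * #|B| <= C * K * bd f B + #|P|].

Lemma card_symdiff_le (X : finType) (A B : {set X}) : #|B| <= #|A| + #|symdiff A B|.
Proof.
apply: leq_trans (leq_card_setU _ _); apply: card_le_sub => x; rewrite !inE.
by case: (x \in A) => //= ->.
Qed.

(** If [B] did not expand, rigidity would provide a set [A'] close to [B] with a
    much smaller boundary, and [A' :&: Z] would contradict the minimality of
    [P]. *)
Lemma least_nonexpanding_expands (C k L K m : nat) (X : finType)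
    (a : {multiplicative freegroup S -> {perm X}}) (P : {set X}) :
  2 * L + 4 <= k ->
  (forall A : {set X}, m * #|A :&: bad_pts a m| <= #|A| ->
    exists A' : {set X}, k * #|symdiff A A'| <= k * C * bd (gens a) A + #|A| /\
                         k * bd (gens a) A' <= #|A|) ->
  least_nonexpanding (gens a) L P ->
  K * m * #|P :&: bad_pts a m| <= #|P| ->
  forall B : {set X}, B \subset P -> 2 * #|B| <= #|P| ->
    K * #|B| <= 4 * C * K * bd (gens a) B + #|P|.
Proof.
move=> kL rig [Z [PZ _ _ Pmin]] Pbad B BP B2.
have [small|big] := leqP (K * #|B|) #|P|; first exact: leq_trans small (leq_addl _ _).
have [|big2] := leqP #|B| (4 * C * bd (gens a) B).
  by move=> h; have := leq_mul (leqnn K) h; lia.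
have K0 : 0 < K by case: K big {Pbad}.
have Bbad : m * #|B :&: bad_pts a m| <= #|B|.
  rewrite -(leq_pmul2l K0) mulnA.
  apply: leq_trans (ltnW big); apply: leq_trans Pbad; rewrite leq_mul2l.
  by rewrite subset_leq_card ?orbT // setSI.
have [A' [h1 h2]] := rig B Bbad.
set D := #|symdiff B A'| in h1.
have B0 : 0 < #|B| by case: #|B| big2.
have D2 : 2 * D <= #|B|.
  have k0 : 0 < k by lia.
  rewrite -(leq_pmul2l k0).
  have : 4 * (k * C * bd (gens a) B) <= k * #|B|.
    by rewrite -!mulnA [4 * _]mulnCA leq_mul2l !mulnA (ltnW big2) orbT.
  have : 4 * #|B| <= k * #|B| by rewrite leq_mul2r; apply/orP; right; lia.
  lia.
have A'le : #|A'| <= #|B| + D by exact: card_symdiff_le.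
have BA : #|B| <= #|A' :&: Z| + D.
  apply: leq_trans (leq_card_setU _ _); apply: card_le_sub => x xB; rewrite !inE xB.
  by rewrite (subsetP PZ) ?(subsetP BP) // andbT; case: (x \in A').
have AZ : #|A' :&: Z| <= #|A'| by apply: subset_leq_card; exact: subsetIl.
have := Pmin (A' :&: Z) (subsetIr _ _).
rewrite -card_gt0 => h3; have {}h3 : #|A' :&: Z| < L * bd_in (gens a) Z (A' :&: Z).
  by apply: h3; lia.
have h4 := leq_trans h3 (leq_mul (leqnn L) (bd_in_le (gens a) Z A')).
have : 2 * L * bd (gens a) A' <= #|B|.
  by apply: leq_trans h2; rewrite leq_mul2r; apply/orP; right; lia.
rewrite -mulnA; lia.
Qed.

(** The parts of the greedy partition expand, except for those with relatively
    many boundary edges or bad points. Such parts are rare, because the number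
    of cut edges and the number of bad points are small. *)
Lemma expander_parts (C K m1 : nat) : rigid C -> exists m, m1 <= m /\
  forall (X : finType) (a : {multiplicative freegroup S -> {perm X}}),
  m * #|bad_pts a m| <= #|X| ->
  exists G : {set {set X}}, [/\ trivIset G,
    forall P, P \in G -> expander_part (gens a) (4 * C) K P /\
                         m1 * #|P :&: bad_pts a m1| <= #|P| &
    K * #|~: cover G| <= #|X|].
Proof.
(* One factor [K] bounds the boundary of a typical part, the other the number of
   points in atypical parts. *)
move=> rig; pose L := 4 * K * K; have [m' rigm'] := rig (2 * L + 4).
pose m2 := K * m' + m1; pose m := m' + m1 + 2 * K * m2.
exists m; split => [|X a badX]; first by rewrite /m; lia.
have [p [pp pc pmin]] := greedy_partition (gens a) L [set: X].
rewrite cardsT in pc.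
pose G := [set P in p @: [set: X] | (K * bd (gens a) P <= #|P|) &&
                                    (m2 * #|P :&: bad_pts a m| <= #|P|)].
have Gp P : P \in G -> P \in p @: [set: X] by rewrite inE => /andP[].
exists G; split.
- apply/trivIsetP => P Q /Gp Pi /Gp Qi; apply: contraR; rewrite -setI_eq0.
  case/set0Pn => x; rewrite inE (mem_part pp) // (mem_part pp) //.
  by case/andP => /eqP -> /eqP ->.
- move=> P PG; have Pi := Gp _ PG; move: PG; rewrite inE => /and3P[_ hb hbad].
  have Pmin : least_nonexpanding (gens a) L P.
    by case/imsetP: Pi => x _ ->; apply: pmin.
  have hbad' n : n <= m -> m2 * #|P :&: bad_pts a n| <= #|P|.
    move=> nm; apply: leq_trans hbad; rewrite leq_mul2l subset_leq_card ?orbT //.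
    by rewrite setIS // bad_ptsS.
  split; last first.
    apply: leq_trans (hbad' m1 _); last by rewrite /m; lia.
    by rewrite leq_mul2r /m2 leq_addl orbT.
  split => //; first by case: Pmin => Z [].
  apply: (@least_nonexpanding_expands C (2 * L + 4) L K m' X a P) => //.
    by move=> A hA; exact: rigm' hA.
  apply: leq_trans (hbad' m' _); last by rewrite /m; lia.
  by rewrite leq_mul2r /m2 leq_addr orbT.
- have cov : #|~: cover G| <=
      #|[set x | #|p x| < K * bd (gens a) (p x)]| +
      #|[set x | #|p x| < m2 * #|p x :&: bad_pts a m| ]|.
    apply: leq_trans (leq_card_setU _ _); apply: card_le_sub => x.
    rewrite !inE; apply: contraR; rewrite negb_or -!leqNgt => /andP[h1 h2].
    apply/bigcupP; exists (p x); last by case: (pp x (in_setT x)).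
    by rewrite inE h1 h2 imset_f.
  have c1 := card_light_parts pp (fun P => K * bd (gens a) P).
  have c2 := card_light_parts pp (fun P => m2 * #|P :&: bad_pts a m|).
  have s1 := sum_bd_parts (gens a) pp; have s2 := sum_card_parts pp (bad_pts a m).
  rewrite -!big_distrr /= in c1 c2.
  have {c1}s1 : K * #|[set x | #|p x| < K * bd (gens a) (p x)]| <= K * (K * (2 * cut_in (gens a) [set: X] p)).
    by rewrite leq_mul2l (leq_trans c1) ?orbT // leq_mul2l s1 orbT.
  have {c2}s2 : K * #|[set x | #|p x| < m2 * #|p x :&: bad_pts a m| ]| <= K * (m2 * #|bad_pts a m|).
    by rewrite leq_mul2l (leq_trans c2) ?orbT // leq_mul2l s2 orbT.
  have b2 : 2 * (K * (m2 * #|bad_pts a m|)) <= #|X|.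
    by apply: leq_trans badX; rewrite !mulnA leq_mul2r /m leq_addl orbT.
  have := leq_mul (leqnn K) cov; rewrite mulnDr.
  move: pc; rewrite /L; lia.
Qed.

End Rigidity.

Lemma card_le_U (T : finType) (A B C : {set T}) :
  (forall x, x \in A -> (x \in B) || (x \in C)) -> #|A| <= #|B| + #|C|.
Proof.
move=> h; apply: leq_trans (leq_card_setU _ _); apply: card_le_sub => x /h.
by rewrite inE.
Qed.

(** * Almost equivariant maps between expanders *)

Section NearIsomorphisms.
Variables (S X : finType) (f : S -> {perm X}) (C K : nat).
Implicit Types (P Q B : {set X}) (s t : {perm X}).
Local Notation expander := (expander_part f C K).
Local Notation M := (6 * C + 1).

(** The finite form of commuting with the generators: a sequence of permutations
    represents an element of the centralizer exactly when this count over all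
    points is negligible. *)
Definition defect P s : nat :=
  \sum_(i : S) #|[set x in P | s (f i x) != f i (s x)]|.

Definition into P Q s : {set X} := [set x in P | s x \in Q].

(** Among disjoint sets, [P] and [s] determine [Q], and [Q] and [s] determine
    [P]. *)
Definition half P Q s : bool := (#|P| < 2 * #|into P Q s|) && (#|Q| < 2 * #|into P Q s|).

(** The complement of [B] in [P] is at most half of [P] and has a small
    boundary, so by expansion it is small. *)
Lemma expander_major n P B :
  expander P -> B \subset P -> n * (C + 3) <= K -> #|P| < 2 * #|B| ->
  n * bd f B <= 6 * #|P| -> n * #|P :\: B| <= M * #|P|.
Proof.
move=> [P0 bP eP] BP nK B2 nb.
have cPB : #|B| + #|P :\: B| = #|P| by rewrite cardsD (setIidPr BP) subnKC ?subset_leq_card.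
have bPB : bd f (P :\: B) <= bd f P + bd f B.
  rewrite /bd -big_split; apply: leq_sum => i _; apply: card_le_U => x; rewrite !inE.
  by case: (x \in P); case: (f i x \in P); case: (x \in B); case: (f i x \in B).
have h : K * #|P :\: B| <= C * K * bd f (P :\: B) + #|P|.
  by apply: eP; [exact: subsetDl|lia].
have [K0|K0] := posnP K; first by have -> : n = 0 by lia.
rewrite -(leq_pmul2l K0).
have h1 := leq_mul (leqnn n) h.
have h2 := leq_mul (leqnn (n * C * K)) bPB.
have h3 := leq_mul (leqnn (n * C)) bP.
have h4 := leq_mul (leqnn (C * K)) nb.
have h5 := leq_mul nK (leqnn #|P|).
lia.
Qed.

Lemma bd_into P Q s : bd f (into P Q s) <= bd f P + defect P s + bd f Q.
Proof.
rewrite /bd /defect -!big_split; apply: leq_sum => i _ /=.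
rewrite -(card_preimset [set x | (x \in Q) != (f i x \in Q)] (@perm_inj _ s)).
apply: leq_trans (leq_trans (card_le_U (B := _ :|: _) _)
  (leq_add (leq_card_setU _ _) (leqnn _))) (leqnn _) => x; rewrite !inE.
case xP: (x \in P); case yP: (f i x \in P) => //=.
by have [->|] := eqVneq (s (f i x)) (f i (s x)); rewrite ?orbT.
Qed.

(** An edge can leave [into P Q s] only at the boundary of [P], at the boundary
    of [Q], or where [s] does not respect it. *)
Lemma near_source n P Q s :
  expander P -> expander Q -> n * (C + 3) <= K -> half P Q s ->
  n * defect P s <= #|P| -> n * #|P :\: into P Q s| <= M * #|P|.
Proof.
move=> eP eQ nK; rewrite /half => /andP[hP hQ] nd; apply: expander_major => //.
  by apply/subsetP => x; rewrite inE => /andP[].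
have sP : #|into P Q s| <= #|P| by apply: card_le_sub => x; rewrite inE => /andP[].
have [_ bP _] := eP; have [_ bQ _] := eQ.
have h := leq_mul (leqnn n) (bd_into P Q s).
have h1 := leq_mul nK (leqnn (bd f P)); have h2 := leq_mul nK (leqnn (bd f Q)).
have [z1 z2] : n * 3 * bd f P <= #|P| /\ n * 3 * bd f Q <= #|Q|.
  split; [apply: leq_trans bP|apply: leq_trans bQ]; rewrite leq_mul2r; apply/orP; right; lia.
lia.
Qed.

Definition onto P Q s : {set X} := [set y in Q | s^-1%g y \in P].

Lemma card_onto P Q s : #|onto P Q s| = #|into P Q s|.
Proof.
rewrite -[in RHS](card_imset _ (@perm_inj _ s)); apply: eq_card => y.
rewrite !inE; apply/andP/imsetP => [[yQ yP]|[x]].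
  by exists (s^-1%g y); rewrite ?permKV // inE yP permKV.
by rewrite inE => /andP[xP xQ] ->; rewrite permK.
Qed.

Lemma bd_onto P Q s : bd f (onto P Q s) <= bd f Q + 2 * (bd f P + defect P s).
Proof.
rewrite /bd /defect mulnDr !big_distrr -!big_split; apply: leq_sum => i _ /=.
set BP := [set x | (x \in P) != (f i x \in P)].
set BD := [set x in P | s (f i x) != f i (s x)].
set V := BP :|: BD.
pose g y := (f i)^-1%g (s^-1%g (f i y)).
have g_inj : injective g by move=> y z /perm_inj/perm_inj/perm_inj.
have h1 : #|s^-1%g @^-1: V| = #|V| by rewrite card_preimset //; exact: perm_inj.
have h2 : #|g @^-1: V| = #|V| by rewrite card_preimset.
have hV : #|V| <= #|BP| + #|BD| by exact: leq_card_setU.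
rewrite -mulnDr; apply: leq_trans (_ : _ <= #|[set x | (x \in Q) != (f i x \in Q)]| +
  (#|s^-1%g @^-1: V| + #|g @^-1: V|)) _; last by rewrite h1 h2; lia.
apply: leq_trans (card_le_U (C := _ :|: _) _) (leq_add (leqnn _) (leq_card_setU _ _)) => y.
rewrite !inE /g.
case yQ: (y \in Q); case zQ: (f i y \in Q) => //=.
set x := s^-1%g y; set x' := s^-1%g (f i y); set x'' := (f i)^-1%g x'.
have sx : s x = y by rewrite permKV.
have sx' : s x' = f i y by rewrite permKV.
have fx'' : f i x'' = x' by rewrite permKV.
case xP: (x \in P); case x'P: (x' \in P) => //= _.
  have [e|ne] := eqVneq (s (f i x)) (f i (s x)); last by rewrite orbT.
  have -> : f i x = x' by apply: (@perm_inj _ s); rewrite e sx sx'.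
  by rewrite x'P.
apply/orP; right; rewrite fx'' x'P.
case x''P: (x'' \in P) => //=.
apply/eqP => e; have : x'' = x by apply: (@perm_inj _ s); apply: (@perm_inj _ (f i)); rewrite -e sx sx'.
by move=> e'; rewrite e' xP in x''P.
Qed.

Lemma near_target n P Q s :
  expander P -> expander Q -> n * (C + 3) <= K -> half P Q s ->
  n * defect P s <= #|P| -> n * #|Q :\: onto P Q s| <= M * #|Q|.
Proof.
move=> eP eQ nK; rewrite /half => /andP[hP hQ] nd; apply: expander_major => //.
- by apply/subsetP => x; rewrite inE => /andP[].
- by rewrite card_onto.
have sQ : #|into P Q s| <= #|Q|.
  by rewrite -card_onto; apply: card_le_sub => x; rewrite inE => /andP[].
have [_ bP _] := eP; have [_ bQ _] := eQ.
have h := leq_mul (leqnn n) (bd_onto P Q s).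
have [z1 z2] : n * 3 * bd f P <= #|P| /\ n * 3 * bd f Q <= #|Q|.
  split; [apply: leq_trans bP|apply: leq_trans bQ]; rewrite leq_mul2r; apply/orP; right; lia.
lia.
Qed.

Definition agree P s t : {set X} := [set x in P | s x == t x].

(** On an expander, agreement on more than half of the points forces agreement
    on nearly all of them when both maps have a small defect; this makes the
    relation transitive for such maps. *)
Definition same_germ P s t : bool := #|P| < 2 * #|agree P s t|.

Lemma bd_agree P s t : bd f (agree P s t) <= bd f P + (defect P s + defect P t).
Proof.
rewrite /bd /defect -!big_split; apply: leq_sum => i _ /=.
apply: leq_trans (card_le_U (C := _ :|: _) _) (leq_add (leqnn _) (leq_card_setU _ _)) => x.
rewrite !inE.
case xP: (x \in P); case yP: (f i x \in P) => //=.
have [->|] := eqVneq (s (f i x)) (f i (s x)) => //=; rewrite ?orbT //.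
have [->|] := eqVneq (t (f i x)) (f i (t x)) => //=.
by rewrite (inj_eq perm_inj) eqxx.
Qed.

Lemma agree_most n P s t :
  expander P -> n * (C + 3) <= K -> same_germ P s t ->
  n * defect P s <= #|P| -> n * defect P t <= #|P| ->
  n * #|P :\: agree P s t| <= M * #|P|.
Proof.
move=> eP nK st ds dt; apply: expander_major => //.
  by apply/subsetP => x; rewrite inE => /andP[].
have [_ bP _] := eP.
have h := leq_mul (leqnn n) (bd_agree P s t).
have z1 : n * 3 * bd f P <= #|P|.
  apply: leq_trans bP; rewrite leq_mul2r; apply/orP; right; lia.
lia.
Qed.

Lemma defect_mul P Q s t : defect P (s * t)%g <=
  defect P s + defect Q t + #|S| * #|P :\: into P Q s|.
Proof.
rewrite -sum_nat_const /defect -!big_split; apply: leq_sum => i _ /=.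
rewrite -(card_preimset [set x in Q | t (f i x) != f i (t x)] (@perm_inj _ s)).
apply: leq_trans (leq_trans (card_le_U (B := _ :|: _) _)
  (leq_add (leq_card_setU _ _) (leqnn _))) (leqnn _) => x; rewrite !inE !permM.
case/andP => -> h /=; have [e|] := eqVneq (s (f i x)) (f i (s x)) => //=.
by rewrite e in h; rewrite h andbT; case: (s x \in Q).
Qed.

Lemma defect_inv P Q s : defect Q s^-1%g <= defect P s + #|S| * #|Q :\: onto P Q s|.
Proof.
rewrite -sum_nat_const /defect -!big_split; apply: leq_sum => i _ /=.
rewrite -(card_preimset [set x in P | s (f i x) != f i (s x)] (@perm_inj _ s^-1%g)).
apply: card_le_U => y; rewrite !inE permKV => /andP[-> h] /=; rewrite andbT.
case: (s^-1%g y \in P) => //=; rewrite orbF; apply: contra h => /eqP e.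
by apply/eqP/(@perm_inj _ s); rewrite permKV e.
Qed.

Lemma into_inv P Q s : into Q P s^-1%g = onto P Q s. Proof. by []. Qed.

Lemma half_inv P Q s : half P Q s -> half Q P s^-1%g.
Proof. by rewrite /half into_inv card_onto andbC. Qed.

End NearIsomorphisms.

(** * Partial injections and their graphs *)

(** One point at a time: compose with the transposition of the value reached so
    far and the prescribed one, which lie in the same class. *)
Lemma extend_to_perm (T : finType) (e : rel T) (D : {set T}) (g : T -> T) :
  equivalence_rel e -> {in D &, injective g} -> (forall x, x \in D -> e x (g x)) ->
  exists p : {perm T}, (forall x, x \in D -> p x = g x) /\ forall x, e x (p x).
Proof.
move=> /equivalence_relP[er et].
have es x y : e x y -> e y x by move=> xy; rewrite -(et _ _ xy) er.
have ett x y z : e x y -> e y z -> e x z by move=> /et ->.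
have [n Dn] := ubnP #|D|; elim: n D Dn => // n IH D Dn gi eg.
have [->|[d dD]] := set_0Vmem D.
  by exists 1%g; split => x; rewrite ?inE // perm1.
have [||x|p [pD pe]] := IH (D :\ d).
- by move: Dn; rewrite (cardsD1 d) dD.
- by move=> x y; rewrite !inE => /andP[_ xD] /andP[_ yD]; exact: gi.
- by rewrite inE => /andP[_]; exact: eg.
exists (p * tperm (p d) (g d))%g; split => x; rewrite permM.
  move=> xD; have [->|xd] := eqVneq x d; first by rewrite tpermL.
  have px : p x = g x by apply: pD; rewrite !inE xd.
  rewrite px tpermD //; first by rewrite -px (inj_eq perm_inj) eq_sym.
  by apply: contra xd => /eqP h; apply/eqP; apply: gi.
case: tpermP => [/perm_inj ->|h|_ _]; [exact: eg| |exact: pe].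
have gd : e (p x) d by rewrite h; apply/es/eg.
exact: (ett x d _ (ett x _ d (pe x) gd) (pe d)).
Qed.

Section PairAction.
Variables (S : choiceType) (X : finType).

Definition pair_perm_fun (p : {perm X}) (z : X * X) := (p z.1, p z.2).
Lemma pair_perm_inj p : injective (pair_perm_fun p).
Proof. by move=> [x y] [x' y'] [/perm_inj -> /perm_inj ->]. Qed.
Definition pair_perm p : {perm X * X} := perm (@pair_perm_inj p).

Variable (a : {multiplicative freegroup S -> {perm X}}).
Definition pair_act (w : freegroup S) : {perm X * X} := pair_perm (a w).
Lemma pair_actM : {morph pair_act : u v / (u * v)%g}.
Proof.
by move=> u v; apply/permP => -[x y]; rewrite permM !permE /pair_perm_fun /= gmulfM !permM.
Qed.
HB.instance Definition _ := isMultiplicative.Build _ _ pair_act pair_actM.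

End PairAction.

Section Relations.
Variables (S X : finType) (f : S -> {perm X}) (A : {set X * X}).
Local Notation f2 := (fun i => pair_perm (f i)).

Lemma pair_permE (p : {perm X}) x y : pair_perm p (x, y) = (p x, p y).
Proof. by rewrite permE. Qed.

(** The points over which [A] has a single value; [cols1] is the same for the
    other coordinate. Together they cut out of [A] the graph of a partial
    injection. *)
Definition rows1 : {set X} := [set x | #|[set y | (x, y) \in A]| == 1].
Definition cols1 : {set X} := [set y | #|[set x | (x, y) \in A]| == 1].
Definition matching : {set X * X} :=
  [set z in A | (z.1 \in rows1) && (z.2 \in cols1)].

Lemma matchingE z :
  (z \in matching) = [&& z \in A, z.1 \in rows1 & z.2 \in cols1].
Proof. by rewrite in_set. Qed.

Lemma rows1_eq x y z : x \in rows1 -> (x, y) \in A -> (x, z) \in A -> y = z.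
Proof.
rewrite inE => /cards1P[w e] xy xz.
have : y \in [set w] by rewrite -e inE.
have : z \in [set w] by rewrite -e inE.
by rewrite !inE => /eqP -> /eqP ->.
Qed.

Lemma cols1_eq x y z : z \in cols1 -> (x, z) \in A -> (y, z) \in A -> x = y.
Proof.
rewrite inE => /cards1P[w e] xz yz.
have : x \in [set w] by rewrite -e inE.
have : y \in [set w] by rewrite -e inE.
by rewrite !inE => /eqP -> /eqP ->.
Qed.

Local Notation edges i := [set z | (z \in A) != (f2 i z \in A)].

(** The action maps rows to rows, so a row changes its size along an edge only if
    an edge of the square above it enters or leaves [A]. *)
Lemma rows1_edges i :
  #|[set x | (x \in rows1) != (f i x \in rows1)]| <= #|edges i|.
Proof.
apply: leq_trans (leq_imset_card fst _); apply: card_le_sub => x.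
rewrite inE; apply: contraR => h.
have no y : ((x, y) \in A) = ((f i x, f i y) \in A).
  apply/eqP; apply: contraR h => h; apply/imsetP; exists (x, y) => //.
  by rewrite inE pair_permE.
rewrite !inE ?negbK; apply/eqP; congr (_ == 1).
rewrite -[RHS](card_preimset _ (@perm_inj _ (f i))); apply: eq_card => y.
by rewrite !inE no.
Qed.

Lemma cols1_edges i :
  #|[set y | (y \in cols1) != (f i y \in cols1)]| <= #|edges i|.
Proof.
apply: leq_trans (leq_imset_card snd _); apply: card_le_sub => x.
rewrite inE; apply: contraR => h.
have no y : ((y, x) \in A) = ((f i y, f i x) \in A).
  apply/eqP; apply: contraR h => h; apply/imsetP; exists (y, x) => //.
  by rewrite inE pair_permE.
rewrite !inE ?negbK; apply/eqP; congr (_ == 1).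
rewrite -[RHS](card_preimset _ (@perm_inj _ (f i))); apply: eq_card => y.
by rewrite !inE no.
Qed.

(** An edge leaves the matching because it leaves [A], or because the row or the
    column of its end changes size. *)
Lemma bd_matching : bd f2 matching <= 3 * bd f2 A.
Proof.
rewrite /bd big_distrr; apply: leq_sum => i _ /=.
pose V := [set z | [&& z \in A, f2 i z \in A & (z.1 \in rows1) != (f i z.1 \in rows1)]].
pose W := [set z | [&& z \in A, f2 i z \in A & (z.2 \in cols1) != (f i z.2 \in cols1)]].
have VE z : (z \in V) = [&& z \in A, f2 i z \in A & (z.1 \in rows1) != (f i z.1 \in rows1)] by rewrite in_set.
have WE z : (z \in W) = [&& z \in A, f2 i z \in A & (z.2 \in cols1) != (f i z.2 \in cols1)] by rewrite in_set.
have hV : #|V| <= #|edges i|.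
  apply: leq_trans (rows1_edges i); apply: (@card_le_inj _ _ _ _ fst) => [[x y] [x' z]|[x y]].
    rewrite !VE !pair_permE /= => /and3P[xy fxy hr] /and3P[xz fxz _] e.
    rewrite -e in xz fxz *; congr (_, _).
    case: (boolP (x \in rows1)) hr => h; first by move=> _; exact: rows1_eq h xy xz.
    case: (boolP (f i x \in rows1)) => h' // _.
    by apply: (@perm_inj _ (f i)); exact: rows1_eq h' fxy fxz.
  by rewrite VE => /and3P[_ _ h]; rewrite in_set.
have hW : #|W| <= #|edges i|.
  apply: leq_trans (cols1_edges i); apply: (@card_le_inj _ _ _ _ snd) => [[y x] [z x']|[x y]].
    rewrite !WE !pair_permE /= => /and3P[xy fxy hr] /and3P[xz fxz _] e.
    rewrite -e in xz fxz *; congr (_, _).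
    case: (boolP (x \in cols1)) hr => h; first by move=> _; exact: cols1_eq h xy xz.
    case: (boolP (f i x \in cols1)) => h' // _.
    by apply: (@perm_inj _ (f i)); exact: cols1_eq h' fxy fxz.
  by rewrite WE => /and3P[_ _ h]; rewrite in_set.
apply: leq_trans (_ : #|edges i| + (#|V| + #|W|) <= _); last first.
  by rewrite (_ : 3 = 1 + (1 + 1)) // !mulnDl !mul1n; apply: leq_add => //; exact: leq_add.
apply: leq_trans (card_le_U (C := V :|: W) _) (leq_add (leqnn _) (leq_card_setU _ _)) => -[x y].
rewrite in_set in_setU VE WE in_set !matchingE !pair_permE /=.
case: ((x, y) \in A); case: ((f i x, f i y) \in A) => //=.
by case: (x \in rows1); case: (f i x \in rows1); case: (y \in cols1); case: (f i y \in cols1).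
Qed.

Definition mate x : X := odflt x [pick y | (x, y) \in matching].
Definition matched : {set X} := [set x | (x, mate x) \in matching].

Lemma mateE x y : (x, y) \in matching -> mate x = y.
Proof.
move=> xy; rewrite /mate; case: pickP => [z xz|/(_ y)]; last by rewrite xy.
move: xy xz; rewrite !matchingE => /and3P[xyA xr _] /andP[xzA _].
exact: rows1_eq xr xzA xyA.
Qed.

Lemma matchedE x : (x \in matched) = ((x, mate x) \in matching).
Proof. by rewrite in_set. Qed.

Lemma mate_inj : {in matched &, injective mate}.
Proof.
move=> x y; rewrite !matchedE !matchingE => /andP[/= xA /andP[_ xc]] /andP[/= yA _] e.
by rewrite -e in yA; exact: cols1_eq xc xA yA.
Qed.

Lemma bd_matched : bd f matched <= bd f2 matching.
Proof.
apply: leq_sum => i _; apply: leq_trans (leq_imset_card fst _); apply: card_le_sub => x.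
rewrite inE => h; apply/imsetP.
case: (boolP (x \in matched)) h => [xm h|xm].
  exists (x, mate x) => //; rewrite in_set pair_permE -matchedE xm.
  apply: contraNneq h => h; rewrite matchedE.
  by rewrite (mateE (esym h)) -h.
rewrite eq_sym eqbF_neg negbK => fm.
exists (x, (f i)^-1%g (mate (f i x))) => //; rewrite in_set pair_permE permKV.
rewrite -matchedE fm eqb_id; apply: contra xm => h.
by rewrite matchedE (mateE h).
Qed.

End Relations.

(** * Germs have representatives of small defect *)

Section Improvement.
Variables (S : finType) (Ker : freegroup S -> Prop).

Section Graph.
Variables (X : finType) (f : S -> {perm X}) (P Q : {set X}) (s : {perm X}).
Local Notation f2 := (fun i => pair_perm (f i)).

Definition graph_into : {set X * X} := [set z | (z.1 \in into P Q s) && (s z.1 == z.2)].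

Lemma card_graph_into : #|graph_into| = #|into P Q s|.
Proof.
have gi : {in into P Q s &, injective (fun x => (x, s x))} by move=> x y _ _ [].
rewrite -(card_in_imset gi); apply: eq_card => -[x y].
rewrite in_set /=; apply/andP/imsetP => [[xi /eqP <-]|[x' x'i [-> ->]]].
  by exists x.
by rewrite eqxx.
Qed.

(** An edge of the square leaves the graph only above an edge that [s] does not
    respect, or that leaves [P] or [Q]. *)
Lemma bd_graph_into :
  bd f2 graph_into <= 2 * bd f P + 2 * defect f P s + bd f Q.
Proof.
rewrite /bd /defect !big_distrr -!big_split; apply: leq_sum => i _ /=.
set BP := [set x | (x \in P) != (f i x \in P)].
set BD := [set x in P | s (f i x) != f i (s x)].
set BQ := [set x | (x \in Q) != (f i x \in Q)].
pose E1 := [set (x, s x) | x in BP :|: BD].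
pose E2 := [set (x, (f i)^-1%g (s (f i x))) | x in BP :|: BD].
pose E3 := [set (s^-1%g y, y) | y in BQ].
have h0 : #|BP :|: BD| <= #|BP| + #|BD| by exact: leq_card_setU.
have h1 : #|E1| <= #|BP :|: BD| by exact: leq_imset_card.
have h2 : #|E2| <= #|BP :|: BD| by exact: leq_imset_card.
have h3 : #|E3| <= #|BQ| by exact: leq_imset_card.
apply: leq_trans (_ : #|E1| + #|E2| + #|E3| <= _); last first.
  by rewrite -mulnDr mul2n -addnn !leq_add // (leq_trans _ h0).
apply: leq_trans (card_le_U (B := E1 :|: E2) (C := E3) _)
  (leq_add (leq_card_setU _ _) (leqnn _)) => -[x y].
rewrite in_set !inE pair_permE /= => h.
have inE1 : x \in BP :|: BD -> s x = y -> (x, y) \in E1.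
  by move=> xB <-; apply/imsetP; exists x.
have inE2 : x \in BP :|: BD -> s (f i x) = f i y -> (x, y) \in E2.
  by move=> xB e; apply/imsetP; exists x => //; rewrite e permK.
have inE3 : y \in BQ -> s x = y -> (x, y) \in E3.
  by move=> yB e; apply/imsetP; exists y => //; rewrite -e permK.
have [e|ne] := eqVneq (s x) y; have [e'|ne'] := eqVneq (s (f i x)) (f i y).
- move: h; rewrite e e' !eqxx !andbT.
  case xP: (x \in P); case fxP: (f i x \in P) => //= h.
  + by rewrite inE3 ?orbT // inE.
  + by rewrite inE1 // !inE xP fxP.
  + by rewrite inE1 // !inE xP fxP.
- move: h; rewrite e eqxx (negbTE ne') andbT andbF.
  case xP: (x \in P) => //= h.
  by rewrite inE1 // !inE xP e ne' orbT.
- move: h; rewrite e' eqxx (negbTE ne) andbT andbF eq_sym eqbF_neg negbK => /andP[fxP _].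
  rewrite inE2 ?orbT // !inE fxP e'; case: (x \in P) => //=.
  by apply: contra ne => /eqP/perm_inj ->.
- by move: h; rewrite (negbTE ne) (negbTE ne') !andbF.
Qed.

End Graph.

(** Rigidity in [X * X], applied to the graph of an almost equivariant
    bijection between two expander parts, makes it as equivariant as one likes
    without changing its germ. *)
Lemma germ_improvement (C n : nat) : rigid Ker C -> exists m1 K1,
  forall K (X : finType) (a : {multiplicative freegroup S -> {perm X}})
    (P Q : {set X}) (s : {perm X}),
  K1 <= K -> expander_part (gens a) (4 * C) K P -> expander_part (gens a) (4 * C) K Q ->
  m1 * #|P :&: bad_pts Ker a m1| <= #|P| -> m1 * #|Q :&: bad_pts Ker a m1| <= #|Q| ->
  half P Q s -> (192 * C + 8 * (6 * (4 * C) + 1)) * defect (gens a) P s <= #|P| ->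
  exists s', [/\ half P Q s', same_germ P s s' & n * defect (gens a) P s' <= #|P|].
Proof.
move=> rig; set M := 6 * (4 * C) + 1; set t0 := _ + _.
pose n' := n * (#|S| * M + 1).
(* [48] keeps the change of the graph small compared with [P]; [3 * n'] makes the
   boundary of the new graph, and of the matching in it, as small as needed. *)
pose k := 48 + 3 * n'.
have [m rigm] := rig k.
exists (6 * m), ((t0 + n' + 1) * (4 * C + 3)).
move=> K X a P Q s KK eP eQ badP badQ hs ds.
have K0 : t0 * (4 * C + 3) <= K by apply: leq_trans KK; rewrite leq_mul2r; apply/orP; right; lia.
have Kn' : n' * (4 * C + 3) <= K by apply: leq_trans KK; rewrite leq_mul2r; apply/orP; right; lia.
have [P0 bP _] := eP; have [_ bQ _] := eQ.
have hs' := hs; move: hs'; rewrite /half => /andP[hP hQ].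
set A := graph_into P Q s.
have cA : #|A| = #|into P Q s| by exact: card_graph_into.
have AP : #|A| <= #|P| by rewrite cA; apply: card_le_sub => x; rewrite inE => /andP[].
have t00 : 8 * M <= t0 by rewrite /t0; lia.
have missP : 8 * #|P :\: into P Q s| <= #|P|.
  have := near_source eP eQ K0 hs ds; rewrite -/M => h.
  have := leq_mul t00 (leqnn #|P :\: into P Q s|).
  have M0 : 0 < M by rewrite /M addn1.
  move=> h'; rewrite -(leq_pmul2l M0); lia.
have missQ : 8 * #|Q :\: onto P Q s| <= #|Q|.
  have := near_target eP eQ K0 hs ds; rewrite -/M => h.
  have := leq_mul t00 (leqnn #|Q :\: onto P Q s|).
  have M0 : 0 < M by rewrite /M addn1.
  move=> h'; rewrite -(leq_pmul2l M0); lia.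
have cP : #|into P Q s| + #|P :\: into P Q s| = #|P|.
  rewrite -[P in RHS](setID P (into P Q s)) cardsU (setIidPr _); last first.
    by apply/subsetP => x; rewrite inE => /andP[].
  rewrite (_ : _ :&: _ = set0) ?cards0 ?subn0 //; apply/setP => x; rewrite !inE.
  by case: (x \in P) => //=; case: (s x \in Q).
have cQ : #|into P Q s| + #|Q :\: onto P Q s| = #|Q|.
  rewrite -(card_onto P Q s) -[Q in RHS](setID Q (onto P Q s)) cardsU (setIidPr _); last first.
    by apply/subsetP => x; rewrite inE => /andP[].
  rewrite (_ : _ :&: _ = set0) ?cards0 ?subn0 //; apply/setP => x; rewrite !inE.
  by case: (x \in Q) => //=; case: (s^-1%g x \in P).
pose a2 : {multiplicative freegroup S -> {perm X * X}} := pair_act a.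
(* A word moves a pair only if it moves one of the two coordinates. *)
have badA : m * #|A :&: bad_pts Ker a2 m| <= #|A|.
  have mm : m <= 6 * m by lia.
  have sub : #|A :&: bad_pts Ker a2 m| <=
      #|P :&: bad_pts Ker a (6 * m)| + #|Q :&: bad_pts Ker a (6 * m)|.
    apply: leq_trans (_ : #|[set (x, s x) | x in P :&: bad_pts Ker a (6 * m)] :|:
      [set (s^-1%g y, y) | y in Q :&: bad_pts Ker a (6 * m)]| <= _); last first.
      by apply: leq_trans (leq_card_setU _ _) (leq_add _ _); exact: leq_imset_card.
    apply: card_le_sub => -[x y]; rewrite in_setI in_setU in_set /= inE => /andP[].
    case/andP; rewrite inE => /andP[xP yQ] /eqP e.
    rewrite ?inE => /asboolP[w [kw wm]]; rewrite /a2 /= /pair_act pair_permE => ne.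
    have [e1|ne1] := eqVneq (a w x) x.
      apply/orP; right; apply/imsetP; exists y; last by rewrite -e permK.
      rewrite in_setI -e yQ /= inE; apply/asboolP; exists w; split=> //.
        exact: leq_trans mm.
      by apply: contra ne => /eqP e2; rewrite e1 -e e2.
    apply/orP; left; apply/imsetP; exists x; last by rewrite e.
    rewrite in_setI xP /= inE; apply/asboolP; exists w; split=> //.
    exact: leq_trans mm.
  have := leq_mul (leqnn (6 * m)) sub; lia.
have [A' [h1 h2]] := rigm _ a2 A badA.
have f2E : (fun i => pair_perm (gens a i)) = gens a2 by [].
set D := #|symdiff A A'| in h1.
have bA : t0 * bd (gens a2) A <= 4 * #|P|.
  have := bd_graph_into (gens a) P Q s; rewrite f2E -/A => h.
  have h' := leq_mul (leqnn t0) h.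
  have z1 : t0 * 3 * bd (gens a) P <= #|P|.
    apply: leq_trans bP; rewrite leq_mul2r; apply/orP; right; lia.
  have z2 : t0 * 3 * bd (gens a) Q <= #|Q|.
    apply: leq_trans bQ; rewrite leq_mul2r; apply/orP; right; lia.
  lia.
have D24 : 24 * D <= #|P|.
  have t0p : 0 < k * t0 by rewrite muln_gt0 /k /t0 /M; lia.
  rewrite -(leq_pmul2l t0p).
  have e1 := leq_mul (leqnn t0) h1.
  have e2 := leq_mul (leqnn (k * C)) bA.
  have e3 : t0 * #|A| <= t0 * #|P| by rewrite leq_mul2l AP orbT.
  have e4 : 192 * C * (k * #|P|) <= t0 * (k * #|P|) by rewrite leq_mul2r; apply/orP; right; rewrite /t0; lia.
  have e5 : 48 * (t0 * #|P|) <= k * (t0 * #|P|) by rewrite leq_mul2r; apply/orP; right; rewrite /k; lia.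
  lia.
pose Gam := matching A'.
have bGam : bd (gens a2) Gam <= 3 * bd (gens a2) A' by exact: bd_matching.
have [p [pE _]] := extend_to_perm (e := fun _ _ => true) (fun _ _ _ => conj isT (fun _ => erefl))
  (@mate_inj _ A') (fun _ _ => isT).
pose W := [set x in into P Q s | (x, s x) \in Gam].
have WE x : (x \in W) = (x \in into P Q s) && ((x, s x) \in Gam) by rewrite in_set.
have pW x : x \in W -> p x = s x.
  rewrite inE => /andP[_ h]; have e := mateE h.
  by rewrite pE // matchedE e.
(* Every point whose row and column are the same in [A] and in [A'] stays matched
   to its image under [s]. *)
have WD : #|into P Q s| <= #|W| + 3 * D.
  pose D1 := [set z.1 | z in symdiff A A']; pose D2 := [set s^-1%g z.2 | z in symdiff A A'].
  have d1 : #|D1| <= D by exact: leq_imset_card.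
  have d2 : #|D2| <= D by exact: leq_imset_card.
  apply: leq_trans (_ : #|W| + (#|D1| + #|D2|) <= _); last by lia.
  apply: leq_trans (card_le_U (C := D1 :|: D2) _) (leq_add (leqnn _) (leq_card_setU _ _)) => x xi.
  rewrite -implyNb; apply/implyP => xW; apply: contraR xW.
  rewrite in_setU negb_or => /andP[n1 n2].
  have noD z : z \in symdiff A A' -> z.1 != x /\ s^-1%g z.2 != x.
    move=> zD; split; [apply: contra n1|apply: contra n2] => /eqP e;
      by apply/imsetP; exists z.
  have AE z : z.1 = x \/ s^-1%g z.2 = x -> (z \in A') = (z \in A).
    move=> hz; apply/eqP; rewrite eq_sym; apply: contraT => h.
    have [] := noD z; first by rewrite in_set.
    by case: hz => ->; rewrite eqxx.
  have gA y : ((x, y) \in A) = (y == s x) by rewrite in_set /= xi eq_sym.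
  have gA' y : ((y, s x) \in A) = (y == x).
    rewrite in_set /= (inj_eq perm_inj); case: eqP => [->|_]; last by rewrite andbF.
    by rewrite xi.
  rewrite inE xi matchingE AE; last by left.
  rewrite gA eqxx /= !inE; apply/andP; split.
    apply/cards1P; exists (s x); apply/setP => y; rewrite !inE AE ?gA //; by left.
  apply/cards1P; exists x; apply/setP => y; rewrite !inE AE ?gA' //=; right.
  by rewrite /= permK.
have hp : half P Q p.
  have Wi : #|W| <= #|into P Q p|.
    by apply: card_le_sub => x xW; have := xW; rewrite !inE (pW _ xW) => /andP[].
  by rewrite /half; lia.
have gp : same_germ P s p.
  have Wi : #|W| <= #|agree P s p|.
    apply: card_le_sub => x xW; rewrite inE (pW _ xW) eqxx andbT.
    by have := xW; rewrite !inE => /andP[/andP[]].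
  by rewrite /same_germ; lia.
exists p; split => //.
have nGam : n' * bd (gens a2) Gam <= #|P|.
  have : 3 * n' * bd (gens a2) A' <= #|P|.
    by apply: leq_trans (leq_trans h2 AP); rewrite leq_mul2r /k leq_addl orbT.
  have := leq_mul (leqnn n') bGam; lia.
have missM : n' * #|P :\: (P :&: matched A')| <= M * #|P|.
  apply: expander_major eP _ Kn' _ _; first exact: subsetIl.
    have Wi : #|W| <= #|P :&: matched A'|.
      apply: card_le_sub => x; rewrite WE in_setI matchedE in_set => /andP[/andP[-> _]] h.
      by rewrite (mateE h).
    by lia.
  have b1 : bd (gens a) (P :&: matched A') <= bd (gens a) P + bd (gens a) (matched A').
    rewrite /bd -big_split; apply: leq_sum => i _; apply: card_le_U => x; rewrite !in_set.
    by case: (x \in P); case: (gens a i x \in P); case: (_ \in _); case: (_ \in _).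
  have b2 : bd (gens a) (matched A') <= bd (gens a2) Gam by exact: bd_matched.
  have z1 : n' * 3 * bd (gens a) P <= #|P|.
    apply: leq_trans bP; rewrite leq_mul2r; apply/orP; right; lia.
  have := leq_mul (leqnn n') b1; have := leq_mul (leqnn n') b2; lia.
have dp : defect (gens a) P p <= #|S| * #|P :\: (P :&: matched A')| + bd (gens a2) Gam.
  rewrite -sum_nat_const /defect /bd -big_split; apply: leq_sum => i _ /=.
  rewrite -[leqRHS]addnC.
  apply: leq_trans (_ : #|[set z.1 | z in [set z | (z \in Gam) != (pair_perm (gens a i) z \in Gam)]]| + _ <= _); last first.
    by apply: leq_add; [exact: leq_imset_card|exact: leqnn].
  apply: card_le_U => x; rewrite in_set => /andP[xP h].
  rewrite [X in _ || X]in_setD in_setI xP andbT /=; case: (boolP (x \in matched A')) => xm; rewrite ?orbT //= orbF.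
  apply/imsetP; exists (x, mate A' x) => //; rewrite in_set pair_permE -matchedE xm.
  apply: contra h => /eqP h; have hm := esym h; have e := mateE hm.
  by rewrite (pE _ xm) pE ?e // matchedE e.
have M0 : 0 < #|S| * M + 1 by lia.
rewrite -(leq_pmul2l M0).
have := leq_mul (leqnn n') dp; have := leq_mul (leqnn #|S|) missM.
rewrite -/n' /n'; lia.
Qed.

End Improvement.

(** * Composing and comparing almost equivariant maps *)

Section GermDistance.
Variables (S X : finType) (f : S -> {perm X}) (C K : nat).
Implicit Types (P Q : {set X}) (s t u : {perm X}).
Local Notation expander := (expander_part f C K).
Local Notation M := (6 * C + 1).

Definition diff P s t : nat := #|[set x in P | s x != t x]|.

Lemma diffE P s t : diff P s t = #|P :\: agree P s t|.
Proof. by apply: eq_card => x; rewrite !inE; case: (x \in P); rewrite ?andbT ?andbF. Qed.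

Lemma diffC P s t : diff P s t = diff P t s.
Proof. by apply: eq_card => x; rewrite !inE eq_sym. Qed.

Lemma diff_triangle P t s u : diff P s u <= diff P s t + diff P t u.
Proof.
apply: card_le_U => x; rewrite !inE => /andP[-> h] /=.
by rewrite -negb_and; apply: contra h => /andP[/eqP -> /eqP ->].
Qed.

Lemma same_germE P s t : same_germ P s t = (2 * diff P s t < #|P|).
Proof.
rewrite diffE /same_germ.
have := cardsID (agree P s t) P.
have -> : P :&: agree P s t = agree P s t by apply/setP => x; rewrite !inE; case: (x \in P).
by move=> h; apply/idP/idP; lia.
Qed.

Lemma diff_mulr P s t u : diff P (s * u)%g (t * u)%g = diff P s t.
Proof. by apply: eq_card => x; rewrite !inE !permM (inj_eq perm_inj). Qed.

Lemma diff_mull P Q s t u :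
  diff P (s * t)%g (s * u)%g <= #|P :\: into P Q s| + diff Q t u.
Proof.
rewrite /diff -(card_preimset [set x in Q | t x != u x] (@perm_inj _ s)).
apply: card_le_U => x; rewrite !inE !permM => /andP[-> ->] /=.
by case: (s x \in Q).
Qed.

Definition near j P Q s : bool := half P Q s && (j * defect f P s <= #|P|).

Lemma nearW i j P Q s : i <= j -> near j P Q s -> near i P Q s.
Proof.
move=> ij /andP[h hj]; rewrite /near h; apply: leq_trans hj.
by rewrite leq_mul2r ij orbT.
Qed.

Lemma card_into P Q s : #|into P Q s| + #|P :\: into P Q s| = #|P|.
Proof.
rewrite -(cardsID (into P Q s) P); congr (_ + _); apply: eq_card => x.
by rewrite !inE; case: (x \in P).
Qed.

Lemma card_onto_into P Q s : #|into P Q s| + #|Q :\: onto P Q s| = #|Q|.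
Proof.
rewrite -(cardsID (onto P Q s) Q) -(card_onto P Q s); congr (_ + _).
by apply: eq_card => x; rewrite !inE; case: (x \in Q).
Qed.

Lemma near1 j P : P != set0 -> near j P P 1%g.
Proof.
rewrite -card_gt0 => P0; rewrite /near /half /defect.
have -> : into P P 1%g = P by apply/setP => x; rewrite !inE perm1 andbb.
rewrite big1 ?muln0 ?andbT; first by lia.
by move=> i _; apply: eq_card0 => x; rewrite !inE !perm1 eqxx andbF.
Qed.

(** The bound is linear in the defects, whatever their size; so it can be summed
    over all parts. *)
Lemma diff_linear P s t : expander P -> same_germ P s t ->
  K * diff P s t <= C * K * (defect f P s + defect f P t) + (2 * C + 1) * #|P|.
Proof.
move=> [P0 bP eP] st; rewrite diffE.
set B := agree P s t.
have cB : #|P :&: B| + #|P :\: B| = #|P| := cardsID B P.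
have bPB : bd f (P :\: B) <= bd f P + bd f B.
  rewrite /bd -big_split; apply: leq_sum => i _; apply: card_le_U => x; rewrite !in_set.
  by case: (x \in P); case: (f i x \in P); case: (s x == t x); case: (s (f i x) == t (f i x)).
have h : K * #|P :\: B| <= C * K * bd f (P :\: B) + #|P|.
  apply: eP; first exact: subsetDl.
  by move: st; rewrite same_germE diffE -/B; lia.
have := bd_agree f P s t; rewrite -/B => h2.
have h3 := leq_mul (leqnn (C * K)) (leq_trans bPB (leq_add (leqnn _) h2)).
have h4 := leq_mul (leqnn C) bP.
lia.
Qed.

End GermDistance.

Section Thresholds.
Variables (S X : finType) (f : S -> {perm X}) (C K n t0 E : nat).
Implicit Types (P Q : {set X}) (s t u : {perm X}).
Local Notation expander := (expander_part f C K).
Local Notation near := (near f).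
Local Notation M := (6 * C + 1).
Hypothesis t0_large : 16 * M <= t0.
Hypothesis n_large : (t0 + E * M) * (3 + #|S| * M) <= n.
Hypothesis K_large : n * (C + 3) <= K.

Let n_t0 : t0 <= n.
Proof. by apply: leq_trans n_large; rewrite -[t0 in leqLHS]muln1 leq_mul //; lia. Qed.
Let M_gt0 : 0 < M. Proof. by rewrite addn1. Qed.
Let Kj j : j <= n -> j * (C + 3) <= K.
Proof. by move=> h; apply: leq_trans K_large; rewrite leq_mul2r h orbT. Qed.

Lemma near_into P Q s : expander P -> expander Q -> near t0 P Q s ->
  16 * #|P :\: into P Q s| <= #|P| /\ 16 * #|Q :\: onto P Q s| <= #|Q|.
Proof.
move=> eP eQ /andP[hs ds].
have h1 := near_source eP eQ (Kj n_t0) hs ds.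
have h2 := near_target eP eQ (Kj n_t0) hs ds.
have h3 := leq_mul t0_large (leqnn #|P :\: into P Q s|).
have h4 := leq_mul t0_large (leqnn #|Q :\: onto P Q s|).
split; rewrite -(leq_pmul2l M_gt0); lia.
Qed.

(** Composition and inversion multiply the defect by a bounded factor, so the
    result still has precision [t0 + E * M], though no longer [n]; passing to
    another representative of the germ restores the precision. *)
Lemma near_mul P Q V s t : expander P -> expander Q -> expander V ->
  near n P Q s -> near n Q V t -> near (t0 + E * M) P V (s * t)%g.
Proof.
move=> eP eQ eV ns nt.
have [s1 s2] := near_into eP eQ (nearW n_t0 ns).
have [u1 u2] := near_into eQ eV (nearW n_t0 nt).
have cs1 := card_into P Q s; have cs2 := card_onto_into P Q s.
have ct1 := card_into Q V t; have ct2 := card_onto_into Q V t.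
have [P0 _ _] := eP; have [V0 _ _] := eV.
rewrite -card_gt0 in P0; rewrite -card_gt0 in V0.
have hst : #|into Q V t| <= #|into P V (s * t)%g| + #|Q :\: onto P Q s|.
  rewrite -(card_imset (mem (into P V (s * t)%g)) (@perm_inj _ s)).
  apply: card_le_U => y; rewrite !in_set => /andP[yQ tyV].
  case yP: (s^-1%g y \in P); last by rewrite yQ orbT.
  apply/orP; left; apply/imsetP; exists (s^-1%g y); last by rewrite permKV.
  by rewrite inE yP permM permKV.
apply/andP; split; first by rewrite /half; lia.
move: ns nt => /andP[hs ds] /andP[ht dt].
have h1 := near_source eP eQ (Kj (leqnn n)) hs ds.
have dm := defect_mul f P Q s t.
have p3 : 0 < 3 + #|S| * M by lia.
have nd : n * defect f P (s * t)%g <= (3 + #|S| * M) * #|P|.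
  have := leq_mul (leqnn n) dm; have := leq_mul (leqnn #|S|) h1.
  have : #|Q| <= 2 * #|P| by lia.
  lia.
rewrite -(leq_pmul2l p3); apply: leq_trans nd.
by rewrite mulnA leq_mul2r mulnC n_large orbT.
Qed.

Lemma near_inv P Q s : expander P -> expander Q ->
  near n P Q s -> near (t0 + E * M) Q P s^-1%g.
Proof.
move=> eP eQ ns; have [s1 s2] := near_into eP eQ (nearW n_t0 ns).
have cs1 := card_into P Q s; have cs2 := card_onto_into P Q s.
move: ns => /andP[hs ds]; rewrite /near half_inv //=.
have h1 := near_target eP eQ (Kj (leqnn n)) hs ds.
have dm := defect_inv f P Q s.
have p3 : 0 < 3 + #|S| * M by lia.
have nd : n * defect f Q s^-1%g <= (3 + #|S| * M) * #|Q|.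
  have := leq_mul (leqnn n) dm; have := leq_mul (leqnn #|S|) h1.
  have : #|P| <= 2 * #|Q| by lia.
  lia.
rewrite -(leq_pmul2l p3); apply: leq_trans nd.
by rewrite mulnA leq_mul2r mulnC n_large orbT.
Qed.

Lemma diff_small j P Q V s t : j <= n -> expander P ->
  near j P Q s -> near j P V t -> same_germ P s t -> j * diff P s t <= M * #|P|.
Proof.
move=> jn eP /andP[_ ds] /andP[_ dt] st; rewrite diffE.
exact: agree_most eP (Kj jn) st ds dt.
Qed.

Lemma diff_16 P Q V s t : expander P ->
  near t0 P Q s -> near t0 P V t -> same_germ P s t -> 16 * diff P s t <= #|P|.
Proof.
move=> eP ns nt st; have h := diff_small n_t0 eP ns nt st.
have h' := leq_mul t0_large (leqnn (diff P s t)).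
rewrite -(leq_pmul2l M_gt0); lia.
Qed.

End Thresholds.

(** * The groupoid of germs *)

(** Composition is total for simplicity: [gmul g h], which is [g] followed by
    [h], is constrained only when the target of [g] is the source of [h]. *)
Record groupoid := Groupoid {
  gobj : finType;
  garr : finType;
  gsrc : garr -> gobj;
  gtgt : garr -> gobj;
  gone : gobj -> garr;
  gmul : garr -> garr -> garr;
  ginv : garr -> garr;
  gsrc1 : forall i, gsrc (gone i) = i;
  gtgt1 : forall i, gtgt (gone i) = i;
  gsrcM : forall g h, gtgt g = gsrc h -> gsrc (gmul g h) = gsrc g;
  gtgtM : forall g h, gtgt g = gsrc h -> gtgt (gmul g h) = gtgt h;
  gsrcV : forall g, gsrc (ginv g) = gtgt g;
  gtgtV : forall g, gtgt (ginv g) = gsrc g;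
  gmulA : forall g h k, gtgt g = gsrc h -> gtgt h = gsrc k ->
    gmul g (gmul h k) = gmul (gmul g h) k;
  gmul1 : forall g, gmul (gone (gsrc g)) g = g;
  gmulr1 : forall g, gmul g (gone (gtgt g)) = g;
  gmulV : forall g, gmul (ginv g) g = gone (gtgt g);
  gmulrV : forall g, gmul g (ginv g) = gone (gsrc g) }.

(** The sets [pts i] are acted upon with errors of proportion [1 / E]; the
    permutations [ev g] are constrained only on the source of [g]. *)
Record near_action (X : finType) (E : nat) (Gam : groupoid) := NearAction {
  pts : gobj Gam -> {set X};
  ev : garr Gam -> {perm X};
  pts_disjoint : forall i j x, x \in pts i -> x \in pts j -> i = j;
  pts_neq0 : forall i, pts i != set0;
  evM : forall g h, gtgt g = gsrc h ->
    E * diff (pts (gsrc g)) (ev g * ev h)%g (ev (gmul g h)) <= #|pts (gsrc g)|;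
  ev1 : forall i, E * diff (pts i) (ev (gone i)) 1%g <= #|pts i|;
  ev_into : forall g,
    E * #|pts (gsrc g) :\: into (pts (gsrc g)) (pts (gtgt g)) (ev g)| <= #|pts (gsrc g)| }.

Section GermGroupoid.
Variables (S X : finType) (f : S -> {perm X}) (C K n t0 E : nat) (G : {set {set X}}).
Implicit Types (P Q : {set X}) (s t u : {perm X}).
Local Notation expander := (expander_part f C K).
Local Notation M := (6 * C + 1).
Local Notation near := (near f).
Hypothesis t0_large : 16 * M <= t0.
Hypothesis n_large : (t0 + E * M) * (3 + #|S| * M) <= n.
Hypothesis K_large : n * (C + 3) <= K.
Hypothesis G_triv : trivIset G.
Hypothesis G_exp : forall P, P \in G -> expander P.
Hypothesis G_imp : forall P Q s, P \in G -> Q \in G -> near t0 P Q s ->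
  exists s', near n P Q s' /\ same_germ P s s'.

(** The choice depends on the germ of [s] only, which makes it a canonical
    representative. *)
Definition germ_rep P Q s : {perm X} :=
  odflt 1%g [pick r | near n P Q r && same_germ P s r].

Let n_t0 : t0 <= n.
Proof. by apply: leq_trans n_large; rewrite -[t0 in leqLHS]muln1 leq_mul //; lia. Qed.
Let t1_t0 : t0 <= t0 + E * M. Proof. exact: leq_addr. Qed.
Let t1_n : t0 + E * M <= n.
Proof. by apply: leq_trans n_large; rewrite -[t0 + _ in leqLHS]muln1 leq_mul //; lia. Qed.
Let M_gt0 : 0 < M. Proof. by rewrite addn1. Qed.

Lemma germ_repP P Q s : P \in G -> Q \in G -> near t0 P Q s ->
  near n P Q (germ_rep P Q s) /\ 16 * diff P s (germ_rep P Q s) <= #|P|.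
Proof.
move=> PG QG ns; rewrite /germ_rep; case: pickP => [r /andP[nr sr]|no] /=.
  split=> //; apply: (diff_16 t0_large n_large K_large (G_exp PG) ns _ sr).
  exact: nearW n_t0 nr.
by have [s' [h1 h2]] := G_imp PG QG ns; have := no s'; rewrite h1 h2.
Qed.

(** The candidates for [s] and for [t] are the same, because agreement on more
    than half of [P] is transitive here. *)
Lemma germ_rep_eq P Q s t : P \in G -> Q \in G -> near t0 P Q s -> near t0 P Q t ->
  2 * diff P s t < #|P| -> germ_rep P Q s = germ_rep P Q t.
Proof.
move=> PG QG ns nt; rewrite -same_germE => st; congr odflt; apply: eq_pick => r.
have d_st := diff_16 t0_large n_large K_large (G_exp PG) ns nt st.
have [P0 _ _] := G_exp PG; rewrite -card_gt0 in P0.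
apply: andb_id2l => nr; have {}nr := nearW n_t0 nr.
apply/idP/idP => h.
  have d := diff_16 t0_large n_large K_large (G_exp PG) ns nr h.
  by rewrite same_germE; have := diff_triangle P s t r; rewrite (diffC P t s); lia.
have d := diff_16 t0_large n_large K_large (G_exp PG) nt nr h.
by rewrite same_germE; have := diff_triangle P t s r; lia.
Qed.

Definition germ_obj := {P : {set X} | P \in G}.

(** Arrows are encoded by their representatives, so that maps with the same germ
    give the same arrow. *)
Definition is_germ (z : germ_obj * germ_obj * {perm X}) : bool :=
  near n (val z.1.1) (val z.1.2) z.2 && (germ_rep (val z.1.1) (val z.1.2) z.2 == z.2).
Definition germ := {z | is_germ z}.

Implicit Types (i j : germ_obj) (g h k : germ).
Definition germ_src g : germ_obj := (val g).1.1.
Definition germ_tgt g : germ_obj := (val g).1.2.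
Definition germ_ev g : {perm X} := (val g).2.

Lemma germ_near g : near n (val (germ_src g)) (val (germ_tgt g)) (germ_ev g).
Proof. by case/andP: (valP g). Qed.

Lemma obj_exp i : expander (val i). Proof. exact/G_exp/(valP i). Qed.

Lemma is_germ_rep i j s : near t0 (val i) (val j) s ->
  is_germ (i, j, germ_rep (val i) (val j) s).
Proof.
move=> ns; have [nr dr] := germ_repP (valP i) (valP j) ns.
rewrite /is_germ /= nr; apply/eqP; apply: germ_rep_eq (valP i) (valP j) (nearW n_t0 nr) ns _.
have [P0 _ _] := obj_exp i; rewrite -card_gt0 in P0.
by rewrite diffC; lia.
Qed.

Lemma near_one i : near t0 (val i) (val i) 1%g.
Proof. by apply: near1; case: (obj_exp i). Qed.

Definition germ_one i : germ := exist is_germ _ (is_germ_rep (near_one i)).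

(** For composable arrows the new triple is always an arrow, and the default
    value [g] is not used. *)
Definition germ_mul g h : germ :=
  insubd g (germ_src g, germ_tgt h,
            germ_rep (val (germ_src g)) (val (germ_tgt h)) (germ_ev g * germ_ev h)%g).

Definition germ_inv g : germ :=
  insubd g (germ_tgt g, germ_src g,
            germ_rep (val (germ_tgt g)) (val (germ_src g)) (germ_ev g)^-1%g).

Lemma near_germ_mul g h : germ_tgt g = germ_src h ->
  near (t0 + E * M) (val (germ_src g)) (val (germ_tgt h)) (germ_ev g * germ_ev h)%g.
Proof.
move=> gh; apply: (near_mul t0_large n_large K_large (obj_exp _) (obj_exp (germ_tgt g)) (obj_exp _)).
  exact: germ_near.
by rewrite gh; exact: germ_near.
Qed.

Lemma near_germ_inv g :
  near (t0 + E * M) (val (germ_tgt g)) (val (germ_src g)) (germ_ev g)^-1%g.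
Proof. exact: (near_inv t0_large n_large K_large (obj_exp _) (obj_exp _) (germ_near g)). Qed.

Lemma val_germ_mul g h : germ_tgt g = germ_src h -> val (germ_mul g h) =
  (germ_src g, germ_tgt h,
   germ_rep (val (germ_src g)) (val (germ_tgt h)) (germ_ev g * germ_ev h)%g).
Proof. by move=> gh; rewrite insubdK //; apply/is_germ_rep/(nearW t1_t0)/near_germ_mul. Qed.

Lemma val_germ_inv g : val (germ_inv g) =
  (germ_tgt g, germ_src g,
   germ_rep (val (germ_tgt g)) (val (germ_src g)) (germ_ev g)^-1%g).
Proof. by rewrite insubdK //; apply/is_germ_rep/(nearW t1_t0)/near_germ_inv. Qed.

Lemma diff_germ_mul g h : germ_tgt g = germ_src h ->
  16 * diff (val (germ_src g)) (germ_ev g * germ_ev h)%g (germ_ev (germ_mul g h))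
    <= #|val (germ_src g)|.
Proof.
move=> gh; rewrite /germ_ev (val_germ_mul gh) /=.
have [|_] // := @germ_repP (val (germ_src g)) (val (germ_tgt h)) (germ_ev g * germ_ev h)%g (valP _) (valP _).
exact/(nearW t1_t0)/near_germ_mul.
Qed.

Lemma diff_germ_inv g :
  16 * diff (val (germ_tgt g)) (germ_ev g)^-1%g (germ_ev (germ_inv g)) <= #|val (germ_tgt g)|.
Proof.
rewrite {2}/germ_ev val_germ_inv /=.
have [|_] // := @germ_repP (val (germ_tgt g)) (val (germ_src g)) (germ_ev g)^-1%g (valP _) (valP _).
exact/(nearW t1_t0)/near_germ_inv.
Qed.

Lemma diff_germ_one i : 16 * diff (val i) 1%g (germ_ev (germ_one i)) <= #|val i|.
Proof.
have [|_] // := @germ_repP (val i) (val i) 1%g (valP _) (valP _).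
exact: near_one.
Qed.

(** The form in which the groupoid laws are checked: both sides are compared with
    the same composite of permutations. *)
Lemma germ_eq g h : germ_src g = germ_src h -> germ_tgt g = germ_tgt h ->
  2 * diff (val (germ_src g)) (germ_ev g) (germ_ev h) < #|val (germ_src g)| -> g = h.
Proof.
move=> es et d; have ng := germ_near g; have nh := germ_near h.
have /andP[_ /eqP eg] := valP g; have /andP[_ /eqP eh] := valP h.
apply/val_inj; case: g h es et d ng nh eg eh => [[[i j] s] gs] [[[i' j'] t] gt] /=.
rewrite /germ_src /germ_tgt /germ_ev /= => <- <- d ng nh <- <-; congr (_, _, _).
by apply: germ_rep_eq d; [exact: valP|exact: valP|exact: nearW ng|exact: nearW nh].
Qed.

Lemma germ_into g :
  16 * #|val (germ_src g) :\: into (val (germ_src g)) (val (germ_tgt g)) (germ_ev g)|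
    <= #|val (germ_src g)| /\
  16 * #|val (germ_tgt g) :\: onto (val (germ_src g)) (val (germ_tgt g)) (germ_ev g)|
    <= #|val (germ_tgt g)|.
Proof.
exact: (near_into t0_large n_large K_large (obj_exp _) (obj_exp _) (nearW n_t0 (germ_near g))).
Qed.

Lemma obj_gt0 i : 0 < #|val i|.
Proof. by rewrite card_gt0; case: (obj_exp i). Qed.

Lemma src_mul g h : germ_tgt g = germ_src h -> germ_src (germ_mul g h) = germ_src g.
Proof. by move=> gh; rewrite {1}/germ_src val_germ_mul. Qed.
Lemma tgt_mul g h : germ_tgt g = germ_src h -> germ_tgt (germ_mul g h) = germ_tgt h.
Proof. by move=> gh; rewrite {1}/germ_tgt val_germ_mul. Qed.
Lemma src_inv g : germ_src (germ_inv g) = germ_tgt g.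
Proof. by rewrite {1}/germ_src val_germ_inv. Qed.
Lemma tgt_inv g : germ_tgt (germ_inv g) = germ_src g.
Proof. by rewrite {1}/germ_tgt val_germ_inv. Qed.

Lemma card_tgt g : 15 * #|val (germ_tgt g)| <= 16 * #|val (germ_src g)|.
Proof.
have [h1 h2] := germ_into g.
have := card_into (val (germ_src g)) (val (germ_tgt g)) (germ_ev g).
have := card_onto_into (val (germ_src g)) (val (germ_tgt g)) (germ_ev g).
lia.
Qed.

Lemma germ_mulA g h k : germ_tgt g = germ_src h -> germ_tgt h = germ_src k ->
  germ_mul g (germ_mul h k) = germ_mul (germ_mul g h) k.
Proof.
move=> gh hk.
have ghk : germ_tgt g = germ_src (germ_mul h k) by rewrite src_mul.
have ghk' : germ_tgt (germ_mul g h) = germ_src k by rewrite tgt_mul.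
apply: germ_eq; rewrite ?src_mul ?tgt_mul //.
set P := val _.
have d1 := diff_germ_mul ghk; have d2 := diff_germ_mul ghk'.
rewrite src_mul // in d2; rewrite -/P in d1 d2.
have d3 := diff_germ_mul gh; rewrite -/P in d3.
have d4 := diff_germ_mul hk; rewrite -gh in d4.
have [i1 _] := germ_into g; rewrite -/P in i1.
have m := diff_mull P (val (germ_tgt g)) (germ_ev g) (germ_ev h * germ_ev k)%g (germ_ev (germ_mul h k)).
have r := diff_mulr P (germ_ev g * germ_ev h)%g (germ_ev (germ_mul g h)) (germ_ev k).
have t1 := diff_triangle P (germ_ev g * germ_ev (germ_mul h k))%g (germ_ev (germ_mul g (germ_mul h k))) (germ_ev (germ_mul (germ_mul g h) k)).
have t2 := diff_triangle P (germ_ev g * (germ_ev h * germ_ev k))%g (germ_ev g * germ_ev (germ_mul h k))%g (germ_ev (germ_mul (germ_mul g h) k)).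
have t3 := diff_triangle P (germ_ev (germ_mul g h) * germ_ev k)%g (germ_ev g * (germ_ev h * germ_ev k))%g (germ_ev (germ_mul (germ_mul g h) k)).
rewrite [in X in _ <= X + _]mulgA r in t3.
have c1 := diffC P (germ_ev (germ_mul g (germ_mul h k))) (germ_ev g * germ_ev (germ_mul h k))%g.
have c2 := diffC P (germ_ev g * germ_ev (germ_mul h k))%g (germ_ev g * (germ_ev h * germ_ev k))%g.
have := card_tgt g; rewrite -/P; have := obj_gt0 (germ_src g); rewrite -/P.
lia.
Qed.

Lemma germ_mul1 g : germ_mul (germ_one (germ_src g)) g = g.
Proof.
have c : germ_tgt (germ_one (germ_src g)) = germ_src g by [].
apply: germ_eq; rewrite ?src_mul ?tgt_mul //.
set P := val _.
have d1 := diff_germ_mul c; rewrite -/P in d1.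
have d2 := diff_germ_one (germ_src g); rewrite -/P in d2.
have r := diff_mulr P 1%g (germ_ev (germ_one (germ_src g))) (germ_ev g).
rewrite mul1g in r.
have t1 := diff_triangle P (germ_ev (germ_one (germ_src g)) * germ_ev g)%g
  (germ_ev (germ_mul (germ_one (germ_src g)) g)) (germ_ev g).
have c1 := diffC P (germ_ev (germ_one (germ_src g)) * germ_ev g)%g
  (germ_ev (germ_mul (germ_one (germ_src g)) g)).
have c2 := diffC P (germ_ev (germ_one (germ_src g)) * germ_ev g)%g (germ_ev g).
have := obj_gt0 (germ_src g); rewrite -/P; lia.
Qed.

Lemma germ_mulr1 g : germ_mul g (germ_one (germ_tgt g)) = g.
Proof.
have c : germ_tgt g = germ_src (germ_one (germ_tgt g)) by [].
apply: germ_eq; rewrite ?src_mul ?tgt_mul //.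
set P := val _.
have d1 := diff_germ_mul c; rewrite -/P in d1.
have d2 := diff_germ_one (germ_tgt g).
have [i1 _] := germ_into g; rewrite -/P in i1.
have m := diff_mull P (val (germ_tgt g)) (germ_ev g) 1%g (germ_ev (germ_one (germ_tgt g))).
rewrite mulg1 in m.
have t1 := diff_triangle P (germ_ev g * germ_ev (germ_one (germ_tgt g)))%g
  (germ_ev (germ_mul g (germ_one (germ_tgt g)))) (germ_ev g).
have c1 := diffC P (germ_ev g * germ_ev (germ_one (germ_tgt g)))%g
  (germ_ev (germ_mul g (germ_one (germ_tgt g)))).
have c2 := diffC P (germ_ev g * germ_ev (germ_one (germ_tgt g)))%g (germ_ev g).
have := card_tgt g; rewrite -/P; have := obj_gt0 (germ_src g); rewrite -/P; lia.
Qed.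

Lemma germ_mulV g : germ_mul (germ_inv g) g = germ_one (germ_tgt g).
Proof.
have c := tgt_inv g.
apply: germ_eq; rewrite ?src_mul ?tgt_mul ?src_inv //.
set P := val _.
have d1 := diff_germ_mul c; rewrite src_inv -/P in d1.
have d2 := diff_germ_one (germ_tgt g); rewrite -/P in d2.
have d3 := diff_germ_inv g; rewrite -/P in d3.
have r : diff P 1%g (germ_ev (germ_inv g) * germ_ev g)%g =
    diff P (germ_ev g)^-1%g (germ_ev (germ_inv g)).
  by rewrite -(mulVg (germ_ev g)) diff_mulr.
have t1 := diff_triangle P (germ_ev (germ_inv g) * germ_ev g)%g
  (germ_ev (germ_mul (germ_inv g) g)) (germ_ev (germ_one (germ_tgt g))).
have t2 := diff_triangle P 1%g (germ_ev (germ_inv g) * germ_ev g)%g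
  (germ_ev (germ_one (germ_tgt g))).
have c1 := diffC P (germ_ev (germ_inv g) * germ_ev g)%g (germ_ev (germ_mul (germ_inv g) g)).
have c2 := diffC P (germ_ev (germ_inv g) * germ_ev g)%g 1%g.
have := obj_gt0 (germ_tgt g); rewrite -/P; lia.
Qed.

Lemma germ_mulrV g : germ_mul g (germ_inv g) = germ_one (germ_src g).
Proof.
have c := esym (src_inv g).
apply: germ_eq; rewrite ?src_mul ?tgt_mul ?tgt_inv //.
set P := val _.
have d1 := diff_germ_mul c; rewrite -/P in d1.
have d2 := diff_germ_one (germ_src g); rewrite -/P in d2.
have d3 := diff_germ_inv g.
have [i1 _] := germ_into g; rewrite -/P in i1.
have m : diff P 1%g (germ_ev g * germ_ev (germ_inv g))%g <=
    #|P :\: into P (val (germ_tgt g)) (germ_ev g)| +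
    diff (val (germ_tgt g)) (germ_ev g)^-1%g (germ_ev (germ_inv g)).
  by rewrite -(mulgV (germ_ev g)); exact: diff_mull.
have t1 := diff_triangle P (germ_ev g * germ_ev (germ_inv g))%g
  (germ_ev (germ_mul g (germ_inv g))) (germ_ev (germ_one (germ_src g))).
have t2 := diff_triangle P 1%g (germ_ev g * germ_ev (germ_inv g))%g
  (germ_ev (germ_one (germ_src g))).
have c1 := diffC P (germ_ev g * germ_ev (germ_inv g))%g (germ_ev (germ_mul g (germ_inv g))).
have c2 := diffC P (germ_ev g * germ_ev (germ_inv g))%g 1%g.
have := card_tgt g; rewrite -/P; have := obj_gt0 (germ_src g); rewrite -/P; lia.
Qed.

Definition germ_groupoid : groupoid :=
  @Groupoid germ_obj germ germ_src germ_tgt germ_one germ_mul germ_inv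
    (fun _ => erefl) (fun _ => erefl) src_mul tgt_mul src_inv tgt_inv
    germ_mulA germ_mul1 germ_mulr1 germ_mulV germ_mulrV.

Lemma small_of_M a P : (t0 + E * M) * a <= M * #|P| -> E * a <= #|P|.
Proof. by move=> h; rewrite -(leq_pmul2l M_gt0); lia. Qed.

Lemma germ_evM g h : germ_tgt g = germ_src h ->
  E * diff (val (germ_src g)) (germ_ev g * germ_ev h)%g (germ_ev (germ_mul g h))
    <= #|val (germ_src g)|.
Proof.
move=> gh; apply: small_of_M.
have d := diff_germ_mul gh; have p0 := obj_gt0 (germ_src g).
apply: (diff_small K_large t1_n (obj_exp _) (near_germ_mul gh)).
  by have nm := germ_near (germ_mul g h); rewrite src_mul // in nm; exact: nearW t1_n nm.
by rewrite same_germE; lia.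
Qed.

Lemma germ_ev1 i : E * diff (val i) (germ_ev (germ_one i)) 1%g <= #|val i|.
Proof.
apply: small_of_M.
have d := diff_germ_one i; have p0 := obj_gt0 i.
apply: (diff_small K_large t1_n (obj_exp _) _
  (near1 _ _ (_ : val i != set0))).
- by apply: nearW t1_n _; exact: (germ_near (germ_one i)).
- by rewrite -card_gt0.
- by rewrite same_germE diffC; lia.
Qed.

Lemma germ_ev_into g :
  E * #|val (germ_src g) :\: into (val (germ_src g)) (val (germ_tgt g)) (germ_ev g)|
    <= #|val (germ_src g)|.
Proof.
apply: small_of_M; have /andP[hs ds] := nearW t1_n (germ_near g).
apply: near_source (obj_exp _) (obj_exp _) _ hs ds.
by apply: leq_trans K_large; rewrite leq_mul2r t1_n orbT.
Qed.

Lemma obj_disjoint i j x : x \in val i -> x \in val j -> i = j.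
Proof.
move=> xi xj; apply/val_inj/eqP; apply: contraT => ij.
have /trivIsetP h := G_triv; have := h _ _ (valP i) (valP j) ij.
by rewrite -setI_eq0 => /eqP/setP/(_ x); rewrite !inE xi xj.
Qed.

Lemma obj_neq0 i : val i != set0. Proof. by rewrite -card_gt0 obj_gt0. Qed.

Definition germ_action : near_action X E germ_groupoid :=
  @NearAction X E germ_groupoid (fun i : germ_obj => val i) germ_ev
    obj_disjoint obj_neq0 germ_evM germ_ev1 germ_ev_into.

End GermGroupoid.

(** * From an approximate action of a groupoid to an exact one *)

Section GroupoidTheory.
Variable (Gam : groupoid).
Implicit Types (g h k : garr Gam) (i j : gobj Gam).
Local Notation src := (@gsrc Gam).
Local Notation tgt := (@gtgt Gam).

Lemma gmulKV g h : src g = src h -> gmul g (gmul (ginv g) h) = h.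
Proof.
move=> gh; rewrite gmulA ?gtgtV ?gsrcV // gmulrV gh; exact: gmul1.
Qed.

Lemma gmulVK g h : tgt g = src h -> gmul (ginv g) (gmul g h) = h.
Proof. by move=> gh; rewrite gmulA ?gtgtV // gmulV gh gmul1. Qed.

Lemma gmul_inj g h k : tgt g = src h -> tgt g = src k -> gmul g h = gmul g k -> h = k.
Proof. by move=> gh gk e; rewrite -(gmulVK gh) e gmulVK. Qed.

Lemma ginv1 i : ginv (gone i) = gone i.
Proof.
have h := gmulrV (gone i); rewrite gsrc1 in h.
have e := gmul1 (ginv (gone i)); rewrite gsrcV gtgt1 in e.
by rewrite -e h.
Qed.

Lemma gdiv_mul g h k : tgt g = src h -> src h = src k ->
  gmul (ginv (gmul g h)) (gmul g k) = gmul (ginv h) k.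
Proof.
move=> gh hk.
have s : src (gmul g h) = src (gmul g k) by rewrite !gsrcM // gh.
have gk : tgt g = src k by rewrite gh.
have c1 : tgt (ginv (gmul g h)) = src (gmul g k) by rewrite gtgtV.
have c2 : tgt (gmul g h) = src (gmul (ginv h) k) by rewrite gtgtM // gsrcM ?gtgtV // gsrcV.
apply: (@gmul_inj (gmul g h)) => //; first by rewrite gsrcM // gsrcV.
rewrite gmulKV // -gmulA ?gmulKV // gsrcM ?gtgtV //.
by rewrite gsrcV.
Qed.

Definition star i : {set garr Gam} := [set g | src g == i].

Lemma star_mul (F : pred (garr Gam)) g :
  #|[set h in star (src g) | F h]| = #|[set h in star (tgt g) | F (gmul g h)]|.
Proof.
have inj : {in [set h in star (tgt g) | F (gmul g h)] &, injective (gmul g)}.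
  move=> h k; rewrite !inE => /andP[/eqP hs _] /andP[/eqP ks _].
  by apply: gmul_inj.
rewrite -(card_in_imset inj); apply: eq_card => h; rewrite !inE.
apply/andP/imsetP => [[/eqP hs Fh]|[k]].
  exists (gmul (ginv g) h); last by rewrite gmulKV.
  by rewrite !inE gsrcM ?gtgtV // gsrcV eqxx gmulKV.
rewrite !inE => /andP[/eqP ks Fk] ->.
by rewrite gsrcM ?ks // eqxx.
Qed.

Lemma star_eq g : #|star (src g)| = #|star (tgt g)|.
Proof.
have := star_mul xpredT g.
have e i : #|[set h in star i | xpredT h]| = #|star i|.
  by apply: eq_card => h; rewrite !inE andbT.
by rewrite !e.
Qed.

End GroupoidTheory.

Section Stabilization.
Variables (X : finType) (E D : nat) (Gam : groupoid) (act : near_action X E Gam).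
Implicit Types (g h k : garr Gam) (i j : gobj Gam) (p q : garr Gam * X).
Local Notation src := (@gsrc Gam).
Local Notation tgt := (@gtgt Gam).
Local Notation one := (@gone Gam).
Local Notation pts := (@pts _ _ _ act).
Local Notation ev := (@ev _ _ _ act).

(** The pair [(g, z)] stands for the preimage of the point [z] under [g], which
    the approximate action does not quite define. *)
Definition over p : gobj Gam := src p.1.

(** What the pair says about the image of its point under [h]. Translating the
    pair by an arrow translates this function exactly, whatever the errors of
    [ev]. *)
Definition fv p h : X := ev (gmul (ginv p.1) h) p.2.
Definition dist p q : nat := #|[set h in star (over p) | fv p h != fv q h]|.
Definition rk p : nat := #|star (over p)|.

(** The value at [h] is a legitimate point, and starting from it one recovers
    most of the other values. *)
Definition consistent p h : bool :=
  (fv p h \in pts (tgt h)) && (D * dist p (h, fv p h) <= rk p).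
Definition good p : bool :=
  D * #|[set h in star (over p) | ~~ consistent p h]| <= rk p.
Definition sim p q : bool := (over p == over q) && (2 * dist p q < rk p).

Hypothesis D_ge9 : 9 <= D.

Lemma rk_gt0 p : 0 < rk p.
Proof. by rewrite /rk card_gt0; apply/set0Pn; exists p.1; rewrite inE. Qed.

Lemma distC p q : over p = over q -> dist p q = dist q p.
Proof.
move=> e; rewrite /dist e; apply: eq_card => h; rewrite !inE.
by congr (_ && ~~ _); exact: eq_sym.
Qed.

Lemma distxx p : dist p p = 0.
Proof. by apply: eq_card0 => h; rewrite !inE eqxx andbF. Qed.

Lemma dist_triangle q p p' : over p = over q -> dist p p' <= dist p q + dist q p'.
Proof.
move=> e; rewrite /dist -e; apply: card_le_U => h; rewrite !inE => /andP[-> hh] /=.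
by rewrite -negb_and; apply: contra hh => /andP[/eqP -> /eqP ->].
Qed.

(** Both pairs are close to the pair formed by [h] and the common value. *)
Lemma consistent_close p q h : over p = over q -> src h = over p ->
  consistent p h -> consistent q h -> fv p h = fv q h -> D * dist p q <= 2 * rk p.
Proof.
move=> e hs /andP[_ c1] /andP[_ c2] ef.
have oh : over (h, fv q h) = over q by rewrite /over /= hs e.
rewrite ef in c1.
have t := @dist_triangle (h, fv q h) p q; rewrite oh in t; have {}t := t e.
rewrite (distC oh) in t.
have rpq : rk q = rk p by rewrite /rk e.
by have := leq_mul (leqnn D) t; lia.
Qed.

(** Similar good pairs agree at an arrow that is consistent for both. *)
Lemma good_close p q : good p -> good q -> sim p q -> D * dist p q <= 2 * rk p.
Proof.
move=> gp gq /andP[/eqP e d].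
have rpq : rk q = rk p by rewrite /rk e.
have [h hs] : exists h, [&& h \in star (over p), consistent p h, consistent q h & fv p h == fv q h].
  apply/existsP; apply: contraT; rewrite negb_exists => /forallP no.
  have : rk p <= dist p q + (#|[set h in star (over p) | ~~ consistent p h]| +
                             #|[set h in star (over q) | ~~ consistent q h]|).
    apply: leq_trans (card_le_U (C := _ :|: _) _) (leq_add (leqnn _) (leq_card_setU _ _)) => h hs.
    have := no h; rewrite hs /= 2!negb_and => hh.
    move: hs; rewrite !in_set -e => -> /=.
    by move: hh; case: (consistent p h); case: (consistent q h); rewrite ?orbT //= orbF.
  move: gp gq; rewrite /good rpq.
  set a := #|_|; set b := #|_| => ha hb hc.
  have := leq_mul D_ge9 (leqnn a); have := leq_mul D_ge9 (leqnn b); lia.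
case/and4P: hs; rewrite inE => /eqP hs c1 c2 /eqP ef.
exact: consistent_close hs c1 c2 ef.
Qed.

Lemma close_sim p q : over p = over q -> D * dist p q <= 4 * rk p -> sim p q.
Proof.
move=> e h; rewrite /sim e eqxx /=.
have := leq_mul D_ge9 (leqnn (dist p q)); have := rk_gt0 p; lia.
Qed.

Lemma sim_refl p : sim p p.
Proof. by apply: close_sim => //; rewrite distxx muln0. Qed.

Lemma sim_sym p q : sim p q = sim q p.
Proof.
rewrite /sim eq_sym; have [e|//] := eqVneq (over q) (over p).
by rewrite (distC (esym e)) /rk e.
Qed.

Lemma sim_trans p q p' : good p -> good q -> good p' ->
  sim p q -> sim q p' -> sim p p'.
Proof.
move=> gp gq gp' s1 s2.
have c1 := good_close gp gq s1; have c2 := good_close gq gp' s2.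
move: s1 s2 => /andP[/eqP e1 _] /andP[/eqP e2 _].
apply: close_sim; first by rewrite e1.
have rpq : rk q = rk p by rewrite /rk e1.
have := leq_mul (leqnn D) (dist_triangle p' e1); lia.
Qed.

(** The chosen representative of a class of similar good pairs. *)
Definition key p : garr Gam * X := odflt p [pick q | good q && sim p q].
Definition ypt := {p | good p && (key p == p)}.
Implicit Types (y : ypt).

Lemma key_good p : good p -> good (key p) /\ sim p (key p).
Proof.
move=> gp; rewrite /key; case: pickP => [q /andP[]//|/(_ p)].
by rewrite gp sim_refl.
Qed.

Lemma key_eq p q : good p -> good q -> sim p q -> key p = key q.
Proof.
move=> gp gq s; rewrite /key.
have e : (fun r => good r && sim p r) =1 (fun r => good r && sim q r).
  move=> r; apply: andb_id2l => gr; apply/idP/idP => h.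
    by apply: sim_trans gq gp gr _ h; rewrite sim_sym.
  exact: sim_trans gp gq gr s h.
rewrite (eq_pick e); case: pickP => // /(_ q).
by rewrite gq sim_refl.
Qed.

Lemma key_sim p q : good p -> good q -> key p = key q -> sim p q.
Proof.
move=> gp gq e; have [g1 s1] := key_good gp; have [g2 s2] := key_good gq.
by apply: sim_trans gp g1 gq s1 _; rewrite e sim_sym.
Qed.

Lemma mk_subproof p : good p -> good (key p) && (key (key p) == key p).
Proof.
move=> gp; have [g1 s1] := key_good gp; rewrite g1 /=; apply/eqP.
by rewrite -(key_eq gp g1 s1).
Qed.

Definition mk p (gp : good p) : ypt :=
  exist (fun p => good p && (key p == p)) _ (mk_subproof gp).

Lemma ypt_good y : good (val y). Proof. by case/andP: (valP y). Qed.

Lemma mk_eq p q (gp : good p) (gq : good q) : sim p q -> mk gp = mk gq.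
Proof. by move=> s; apply/val_inj/key_eq. Qed.

Lemma mk_sim p q (gp : good p) (gq : good q) : mk gp = mk gq -> sim p q.
Proof. by move=> /(congr1 val) /= e; exact: key_sim. Qed.

Lemma over_mk p (gp : good p) : over (val (mk gp)) = over p.
Proof. by have [_ /andP[/eqP <- _]] := key_good gp. Qed.

Definition transl g p : garr Gam * X := (gmul g p.1, p.2).

Lemma over_transl g p : tgt g = over p -> over (transl g p) = src g.
Proof. by move=> gp; rewrite /over /= gsrcM. Qed.

Lemma fv_transl g p h : tgt g = over p -> src h = over p ->
  fv (transl g p) (gmul g h) = fv p h.
Proof. by move=> gp hp; rewrite /fv /= gdiv_mul // -hp. Qed.

Lemma rk_transl g p : tgt g = over p -> rk (transl g p) = rk p.
Proof. by move=> gp; rewrite /rk over_transl // star_eq gp. Qed.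

Lemma dist_transl g p q : tgt g = over p -> over p = over q ->
  dist (transl g p) (transl g q) = dist p q.
Proof.
move=> gp pq; rewrite /dist over_transl //.
rewrite (star_mul (fun h => fv (transl g p) h != fv (transl g q) h)) gp.
apply: eq_card => h; rewrite !inE; have [hs|//] := eqVneq (src h) (over p).
by rewrite !fv_transl // ?gp // -pq.
Qed.

Lemma consistent_transl g p h : tgt g = over p -> src h = over p ->
  consistent (transl g p) (gmul g h) = consistent p h.
Proof.
move=> gp hp; rewrite /consistent fv_transl // gtgtM ?gp // rk_transl //.
have -> : (gmul g h, fv p h) = transl g (h, fv p h) by [].
by rewrite dist_transl // /over /= hp.
Qed.

Lemma good_transl g p : tgt g = over p -> good (transl g p) = good p.
Proof.
move=> gp; rewrite /good rk_transl // over_transl //.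
rewrite (star_mul (fun h => ~~ consistent (transl g p) h)) gp.
congr (_ * _ <= _); apply: eq_card => h; rewrite !inE.
have [hs|//] := eqVneq (src h) (over p).
by rewrite consistent_transl.
Qed.

Lemma sim_transl g p q : tgt g = over p -> tgt g = over q -> sim p q ->
  sim (transl g p) (transl g q).
Proof.
move=> gp gq /andP[/eqP e d]; rewrite /sim !over_transl // eqxx /=.
by rewrite dist_transl // rk_transl.
Qed.

Definition tr g y : ypt := insubd y (key (transl g (val y))).

Lemma trE g y (gy : good (transl g (val y))) : tr g y = mk gy.
Proof. by apply/val_inj; rewrite insubdK //; exact: mk_subproof. Qed.

Lemma tr_mk g p (gp : good p) (gt : good (transl g p)) : tgt g = over p ->
  tr g (mk gp) = mk gt.
Proof.
move=> hp; have g1 : good (transl g (val (mk gp))).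
  by rewrite good_transl ?over_mk // ypt_good.
rewrite (trE g1); apply: mk_eq; apply: sim_transl; rewrite ?over_mk //.
by rewrite sim_sym; case: (key_good gp).
Qed.

Lemma over_tr g y : tgt g = over (val y) -> over (val (tr g y)) = src g.
Proof.
move=> gy; have g1 : good (transl g (val y)) by rewrite good_transl ?ypt_good.
by rewrite (trE g1) over_mk over_transl.
Qed.

Lemma tr_mul g h y : tgt g = src h -> tgt h = over (val y) ->
  tr g (tr h y) = tr (gmul g h) y.
Proof.
move=> gh hy; have g1 : good (transl h (val y)) by rewrite good_transl ?ypt_good.
have e : transl g (transl h (val y)) = transl (gmul g h) (val y).
  by rewrite /transl /= gmulA.
have g2 : good (transl g (transl h (val y))) by rewrite good_transl // over_transl.
have g3 : good (transl (gmul g h) (val y)) by rewrite -e.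
rewrite (trE g1) (@tr_mk _ _ _ g2); last by rewrite over_transl.
by rewrite (trE g3); apply/val_inj => /=; rewrite e.
Qed.

Lemma tr_one y : tr (one (over (val y))) y = y.
Proof.
have e : transl (one (over (val y))) (val y) = val y.
  by rewrite /transl /over gmul1 -surjective_pairing.
have g1 : good (transl (one (over (val y))) (val y)) by rewrite e ypt_good.
by rewrite (trE g1); apply/val_inj => /=; rewrite e; case/andP: (valP y) => _ /eqP.
Qed.

Lemma trVK g y : tgt g = over (val y) -> tr (ginv g) (tr g y) = y.
Proof. by move=> gy; rewrite tr_mul ?gtgtV // gmulV gy tr_one. Qed.

Lemma trKV g y : src g = over (val y) -> tr g (tr (ginv g) y) = y.
Proof. by move=> gy; rewrite tr_mul ?gsrcV ?gtgtV // gmulrV gy tr_one. Qed.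

(** The translation [tr g] leads from the points over the target of [g] back to
    those over its source; [a] acts as [g] when it inverts this map. *)
Definition acts_as (a : {perm ypt}) g : Prop :=
  forall y, over (val y) = tgt g -> a (tr g y) = y.

Definition bisections : {set {perm ypt}} :=
  [set a | `[< forall i, exists2 g, src g = i & acts_as a g >]].

Lemma bisections_group : group_set bisections.
Proof.
apply/group_setP; split.
  rewrite inE; apply/asboolP => i; exists (one i); first by rewrite gsrc1.
  by move=> y; rewrite gtgt1 => <-; rewrite perm1 tr_one.
move=> a b; rewrite !inE => /asboolP ha /asboolP hb; apply/asboolP => i.
have [g gs ag] := ha i; have [h hs bh] := hb (tgt g).
exists (gmul g h); first by rewrite gsrcM.
move=> y; rewrite gtgtM // => yt.
by rewrite permM -tr_mul ?hs // ag ?bh // over_tr.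
Qed.

Definition bisection_group : {group {perm ypt}} := Group bisections_group.

(** Translations by the inverses of the chosen arrows fit together to an
    injection, because the arrows have different targets. *)
Lemma bisection_exists (c : gobj Gam -> garr Gam) :
  (forall i, src (c i) = i) -> injective (fun i => tgt (c i)) ->
  exists2 a, a \in bisection_group & forall i, acts_as a (c i).
Proof.
move=> cs ci.
pose b y := tr (ginv (c (over (val y)))) y.
have ob y : over (val (b y)) = tgt (c (over (val y))).
  by rewrite over_tr ?gsrcV // gtgtV cs.
have b_inj : injective b.
  move=> y y' e; have ey : over (val y) = over (val y').
    by apply: ci; rewrite -!ob e.
  rewrite -(@trKV (c (over (val y))) y) ?cs // -[RHS](@trKV (c (over (val y))) y') ?cs //.
  by move: e; rewrite /b ey => ->.
have ac i : acts_as (perm b_inj) (c i).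
  move=> y yt; rewrite permE /b over_tr // cs trVK //.
exists (perm b_inj) => //.
by rewrite inE; apply/asboolP => i; exists (c i).
Qed.

End Stabilization.

(** * The exact action stays close to the approximate one *)

Lemma exchange_card (T T' : finType) (A : {set T}) (B : {set T'}) (F : T -> T' -> bool) :
  \sum_(x in A) #|[set h in B | F x h]| = \sum_(h in B) #|[set x in A | F x h]|.
Proof.
under eq_bigr do rewrite -sum1_card.
under [RHS]eq_bigr do rewrite -sum1_card.
rewrite (exchange_big_dep (mem B)) /=; last by move=> x h _; rewrite inE => /andP[].
apply: eq_bigr => h hB; apply: eq_bigl => x; rewrite !inE hB.
by case: (x \in A).
Qed.

Lemma card_markov (T : finType) (A : {set T}) (F : T -> nat) D r :
  #|[set x in A | r < D * F x]| * r <= D * \sum_(x in A) F x.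
Proof.
rewrite big_distrr -sum_nat_const /=.
apply: leq_trans (_ : \sum_(x in [set x in A | r < D * F x]) D * F x <= _).
  by apply: leq_sum => x; rewrite inE => /andP[_ /ltnW].
rewrite [leqRHS](bigID (fun x => r < D * F x)) /=.
apply: leq_trans (leq_addr _ _); rewrite leq_eqVlt; apply/orP; left; apply/eqP.
by apply: eq_bigl => x; rewrite inE.
Qed.

Section StabilizationCount.
Variables (X : finType) (E D : nat) (Gam : groupoid) (act : near_action X E Gam).
Implicit Types (g h k : garr Gam) (i j : gobj Gam) (x : X).
Local Notation src := (@gsrc Gam).
Local Notation tgt := (@gtgt Gam).
Local Notation one := (@gone Gam).
Local Notation pts := (@pts _ _ _ act).
Local Notation ev := (@ev _ _ _ act).
Local Notation fv := (fv act).
Local Notation dist := (dist act).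
Local Notation good := (good D act).
Local Notation consistent := (consistent D act).
Local Notation ypt := (ypt D act).
Hypothesis D_ge9 : 9 <= D.
Hypothesis E_large : 8 * (D * D * D) <= E.

Lemma fv_one i x h : src h = i -> fv (one i, x) h = ev h x.
Proof. by move=> hs; rewrite /fv /= ginv1 -hs gmul1. Qed.

Lemma dist_one i x h : src h = i -> dist (one i, x) (h, ev h x) =
  #|[set k in star i | ev (gmul (ginv h) k) (ev h x) != ev k x]|.
Proof.
move=> hs; rewrite /dist /over /= gsrc1; apply: eq_card => k; rewrite !inE.
have [ks|//] := eqVneq (src k) i.
by rewrite fv_one // eq_sym.
Qed.

Lemma star_gt0 i : 0 < #|star i|.
Proof. by rewrite card_gt0; apply/set0Pn; exists (one i); rewrite inE gsrc1. Qed.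

(** The discrepancies at [h] add up, over the arrows [k] with source [i], to the
    errors of [ev h] followed by [ev (h^-1 k)] in place of [ev k]; each error
    has proportion [1 / E], and Markov's inequality applies. *)
Lemma few_inconsistent i h : src h = i ->
  E * #|[set x in pts i | #|star i| < D * dist (one i, x) (h, ev h x)]| <= D * #|pts i|.
Proof.
move=> hs; have r0 := star_gt0 i; rewrite -(leq_pmul2r r0) -mulnA.
have m := card_markov (pts i) (fun x => dist (one i, x) (h, ev h x)) D #|star i|.
apply: leq_trans (leq_mul (leqnn E) m) _.
under eq_bigr do rewrite dist_one //.
rewrite exchange_card mulnCA -mulnA leq_mul2l big_distrr -[leqRHS]mulnC -sum_nat_const /=.
apply/orP; right; apply: leq_sum => k; rewrite inE => /eqP ks.
have c : tgt h = src (gmul (ginv h) k) by rewrite gsrcM ?gsrcV // gtgtV ks.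
have := evM act c; rewrite gmulKV ?hs ?ks // => /(leq_trans _); apply.
rewrite leq_mul2l /diff; apply/orP; right; apply: eq_leq; apply: eq_card => x.
by rewrite !inE permM.
Qed.

Definition nongood i : {set X} := [set x in pts i | ~~ good (one i, x)].

(** If [(1, x)] is not good, then many arrows out of [i] misplace [x] or are
    inconsistent at it. Exchanging the two counts, this happens for few [x]. *)
Lemma card_nongood i : 2 * D * #|nongood i| <= #|pts i|.
Proof.
have r0 := star_gt0 i.
pose b1 x := #|[set h in star i | ev h x \notin pts (tgt h)]|.
pose b2 x := #|[set h in star i | #|star i| < D * dist (one i, x) (h, ev h x)]|.
pose N1 := [set x in pts i | #|star i| < 2 * D * b1 x].
pose N2 := [set x in pts i | #|star i| < 2 * D * b2 x].
have sub : #|nongood i| <= #|N1| + #|N2|.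
  apply: card_le_U => x; rewrite !in_set => /andP[xi]; rewrite xi /=.
  rewrite /good /rk /over /= gsrc1 -ltnNge => hh.
  have : #|[set h in star i | ~~ consistent (one i, x) h]| <= b1 x + b2 x.
    apply: card_le_U => h; rewrite !in_set => /andP[hs]; rewrite hs /=.
    rewrite /consistent /rk /over /= gsrc1 fv_one ?(eqP hs) // negb_and -ltnNge //.
  move=> hb; have := leq_trans hh (leq_mul (leqnn D) hb).
  case: ltnP => //= h1; case: ltnP => //= h2; lia.
have s1 : E * \sum_(x in pts i) b1 x <= #|star i| * #|pts i|.
  rewrite exchange_card big_distrr -sum_nat_const /=; apply: leq_sum => h.
  rewrite inE => /eqP hs; have := ev_into act h; rewrite hs; apply: leq_trans.
  rewrite leq_mul2l; apply/orP; right; apply: card_le_sub => x; rewrite !inE.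
  by move=> /andP[-> ->].
have s2 : E * \sum_(x in pts i) b2 x <= #|star i| * (D * #|pts i|).
  rewrite exchange_card big_distrr -sum_nat_const /=; apply: leq_sum => h.
  by rewrite inE => /eqP hs; exact: few_inconsistent.
have m1 := card_markov (pts i) b1 (2 * D) #|star i|.
have m2 := card_markov (pts i) b2 (2 * D) #|star i|.
rewrite -/N1 -/N2 in m1 m2.
have n1 : E * #|N1| <= 2 * D * #|pts i|.
  rewrite -(leq_pmul2r r0) -mulnA; apply: leq_trans (leq_mul (leqnn E) m1) _.
  by have := leq_mul (leqnn (2 * D)) s1; lia.
have n2 : E * #|N2| <= 2 * D * (D * #|pts i|).
  rewrite -(leq_pmul2r r0) -mulnA; apply: leq_trans (leq_mul (leqnn E) m2) _.
  by have := leq_mul (leqnn (2 * D)) s2; lia.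
have e1 : 8 * (D * D * D) * #|nongood i| <= 4 * (D * D) * #|pts i|.
  apply: leq_trans (leq_mul E_large sub) _; rewrite mulnDr.
  have : D * #|pts i| <= D * (D * #|pts i|) by rewrite leq_pmull //; lia.
  lia.
have D20 : 0 < 4 * (D * D) by rewrite !muln_gt0; lia.
rewrite -(leq_pmul2l D20); lia.
Qed.

Lemma card_pts_tgt g : (E - 1) * #|pts (tgt g)| <= E * #|pts (src g)|.
Proof.
have h := ev_into act (ginv g); rewrite gsrcV gtgtV in h.
have c : #|pts (tgt g)| <= #|pts (src g)| +
    #|pts (tgt g) :\: into (pts (tgt g)) (pts (src g)) (ev (ginv g))|.
  rewrite -[X in X <= _](cardsID (into (pts (tgt g)) (pts (src g)) (ev (ginv g)))).
  rewrite leq_add2r; apply: (@card_le_inj _ _ _ _ (ev (ginv g))) => [x x' _ _|x].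
    exact: perm_inj.
  by rewrite !inE => /and3P[].
have := leq_mul (leqnn E) c; rewrite mulnBl mul1n; lia.
Qed.

Definition ypts_over i : {set ypt} := [set y | over (val y) == i].

(** A class is determined by an arrow that is consistent for it, together with
    the value there; and nearly every arrow out of [i] is consistent. So there
    are hardly more classes over [i] than points in [pts i]. *)
Lemma card_ypts_over i :
  (D - 1) * (E - 1) * #|ypts_over i| <= D * E * #|pts i|.
Proof.
have r0 := star_gt0 i.
(* Consistent arrows of classes over [i], counted against possible values. *)
pose Z := [set yh : ypt * garr Gam | [&& over (val yh.1) == i, src yh.2 == i &
                                         consistent (val yh.1) yh.2]].
pose T := [set hz : garr Gam * X | (src hz.1 == i) && (hz.2 \in pts (tgt hz.1))].
have ZT : #|Z| <= #|T|.
  apply: (@card_le_inj _ _ _ _ (fun yh => (yh.2, fv (val yh.1) yh.2))) => [[y h] [y' h']|[y h]].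
    rewrite !inE /= => /and3P[/eqP o1 /eqP h1 c1] /and3P[/eqP o2 _ c2] [eh ef].
    subst h'.
    congr (_, _); apply/val_inj.
    have /andP[gy /eqP ky] := valP y; have /andP[gy' /eqP ky'] := valP y'.
    rewrite -ky -ky'; apply: (key_eq D_ge9) => //; apply: (close_sim D_ge9) => //; first by rewrite o1.
    apply: leq_trans (consistent_close D_ge9 (etrans o1 (esym o2)) (etrans h1 (esym o1)) c1 c2 ef) _.
    by rewrite leq_mul2r orbT.
  by rewrite !inE /= => /and3P[_ -> /andP[-> _]].
have cT : (E - 1) * #|T| <= #|star i| * (E * #|pts i|).
  have -> : #|T| = \sum_(h in star i) #|pts (tgt h)|.
    rewrite -sum1_card (partition_big (fun hz => hz.1) (mem (star i))) /=; last first.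
      by move=> [h z]; rewrite !inE => /andP[].
    apply: eq_bigr => h hs; rewrite sum1_card.
    have inj : {in pts (tgt h) &, injective (fun z => (h, z))} by move=> z z' _ _ [].
    rewrite -(card_in_imset inj); apply: eq_card => -[h' z]; rewrite unfold_in /= inE /=.
    apply/idP/imsetP => [/andP[/andP[_ zt] /eqP e]|[z' zt [-> ->]]].
      by exists z; rewrite -e.
    by move: hs; rewrite inE => ->; rewrite zt eqxx.
  rewrite big_distrr -sum_nat_const /=; apply: leq_sum => h; rewrite inE => /eqP hs.
  by have := card_pts_tgt h; rewrite hs.
have cZ : (D - 1) * #|star i| * #|ypts_over i| <= D * #|Z|.
  have -> : #|Z| = \sum_(y in ypts_over i) #|[set h in star i | consistent (val y) h]|.
    rewrite -sum1_card (partition_big (fun yh => yh.1) (mem (ypts_over i))) /=; last first.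
      by move=> [y h]; rewrite !inE => /andP[].
    apply: eq_bigr => y yo; rewrite sum1_card.
    have inj : {in [set h in star i | consistent (val y) h] &, injective (fun h => (y, h))}.
      by move=> h h' _ _ [].
    rewrite -(card_in_imset inj); apply: eq_card => -[y' h]; rewrite unfold_in /= inE /=.
    apply/idP/imsetP => [/andP[/and3P[_ h1 h2] /eqP e]|[h' h1 [-> ->]]].
      by exists h; rewrite ?e // !inE h1 -e.
    by move: yo h1; rewrite !inE => -> /andP[-> ->] /=.
  rewrite big_distrr mulnC -sum_nat_const /=; apply: leq_sum => y; rewrite inE => /eqP yo.
  have gy := ypt_good y; move: gy; rewrite /good /rk yo => gy.
  have := cardsID [set h | consistent (val y) h] (star i).
  have -> : star i :&: [set h | consistent (val y) h] = [set h in star i | consistent (val y) h].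
    by apply/setP => h; rewrite !inE.
  have -> : star i :\: [set h | consistent (val y) h] = [set h in star i | ~~ consistent (val y) h].
    by apply/setP => h; rewrite !inE andbC.
  move=> cs; have h := congr1 (muln D) cs; rewrite mulnDr in h.
  rewrite mulnBl mul1n -h leq_subLR [leqRHS]addnC; exact: leq_add (leqnn _) gy.
rewrite -(leq_pmul2l r0).
have a1 := leq_mul (leqnn (E - 1)) cZ.
have a2 := leq_mul (leqnn (D * (E - 1))) ZT.
have a3 := leq_mul (leqnn D) cT.
apply: leq_trans (_ : (E - 1) * ((D - 1) * #|star i| * #|ypts_over i|) <= _); first by rewrite -!mulnA; lia.
apply: leq_trans a1 _; apply: leq_trans (_ : D * (E - 1) * #|Z| <= _); first by rewrite mulnCA mulnA.
by apply: leq_trans a2 _; rewrite -mulnA; apply: leq_trans a3 _; rewrite -!mulnA; lia.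
Qed.

Lemma card_ypt : D * #|{: ypt}| <= (D + 2) * \sum_i #|pts i|.
Proof.
have s : #|{: ypt}| = \sum_i #|ypts_over i|.
  rewrite -sum1_card (partition_big (fun y => over (val y)) xpredT) //=.
  by apply: eq_bigr => i _; rewrite sum1_card; apply: eq_card => y; rewrite !inE.
have h : (D - 1) * (E - 1) * #|{: ypt}| <= D * E * \sum_i #|pts i|.
  rewrite s !big_distrr /=; apply: leq_sum => i _; exact: card_ypts_over.
have DE : D * (D * E) <= (D + 2) * ((D - 1) * (E - 1)).
  have ED : 8 * (D * D) <= E.
    apply: leq_trans E_large; rewrite leq_mul2l /= leq_pmulr //; lia.
  case: (D) D_ge9 ED => // d d8 ED; case: (E) ED => [|e]; first by lia.
  rewrite !subn1 /= => ED; nia.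
have p0 : 0 < (D - 1) * (E - 1).
  have : 8 * 9 <= E by apply: leq_trans E_large; rewrite leq_mul2l /=; nia.
  by move=> ?; rewrite muln_gt0; lia.
rewrite -(leq_pmul2l p0).
have h1 := leq_mul (leqnn D) h.
have h2 := leq_mul DE (leqnn (\sum_i #|pts i|)).
move: h1 h2; set U := (D - 1) * (E - 1); set V := \sum_i _; set W := #|_|.
by move=> h1 h2; lia.
Qed.

Section Embedding.
Variable (y0 : ypt).

Definition emb x : ypt :=
  if [pick i | x \in pts i] is Some i then insubd y0 (key D act (one i, x)) else y0.

Definition emb_dom : {set X} := [set x | [exists i, (x \in pts i) && good (one i, x)]].

Lemma embE i x (gx : good (one i, x)) : x \in pts i -> emb x = mk D_ge9 gx.
Proof.
move=> xi; rewrite /emb; case: pickP => [j xj|/(_ i)]; last by rewrite xi.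
have e := pts_disjoint xi xj; subst j.
by apply/val_inj; rewrite insubdK //; exact: mk_subproof.
Qed.

Lemma emb_domP i x : x \in pts i -> (x \in emb_dom) = good (one i, x).
Proof.
move=> xi; rewrite inE; apply/existsP/idP => [[j /andP[xj gx]]|gx].
  by rewrite (pts_disjoint xi xj).
by exists i; rewrite xi.
Qed.

(** Similar pairs agree at some arrow [h], and [ev h] is injective. *)
Lemma emb_inj : {in emb_dom &, injective emb}.
Proof.
move=> x x'; rewrite !inE => /existsP[i /andP[xi gx]] /existsP[j /andP[xj gx']].
rewrite (embE gx xi) (embE gx' xj) => /mk_sim /andP[/eqP]; rewrite /over /= !gsrc1 => ij.
subst j => d.
have [h] : exists h, (h \in star i) && (fv (one i, x) h == fv (one i, x') h).
  apply/existsP; apply: contraT; rewrite negb_exists => /forallP no.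
  move: d; rewrite /dist /rk /over /= gsrc1.
  suff -> : [set h in star i | fv (one i, x) h != fv (one i, x') h] = star i by lia.
  by apply/setP => h; have := no h; rewrite !inE; case: (src h == i).
rewrite inE => /andP[/eqP hs]; rewrite !fv_one // => /eqP; exact: perm_inj.
Qed.

Lemma emb_dom_large i : D * #|pts i :\: emb_dom| <= #|pts i|.
Proof.
apply: leq_trans (card_nongood i); rewrite -mulnA.
apply: leq_trans (_ : D * #|nongood i| <= _); last by lia.
rewrite leq_mul2l; apply/orP; right; apply: card_le_sub => x.
by rewrite in_setD => /andP[nx xi]; rewrite in_set xi -(emb_domP xi).
Qed.

Definition mismatch (a : {perm ypt}) i g : {set X} :=
  [set x in pts i | ~~ [&& x \in emb_dom, ev g x \in pts (tgt g), ev g x \in emb_dom &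
                           a (emb x) == emb (ev g x)]].

(** If the four exceptional sets below are avoided, then [(1, x)] and
    [(g, ev g x)] are good and similar, so that [a] maps the class of the first
    to the class of [(1, ev g x)]. *)
Lemma card_mismatch a g : acts_as a g ->
  D * #|mismatch a (src g) g| <= 2 * #|pts (src g)|.
Proof.
move=> ag; set i := src g; set j := tgt g.
pose B2 := [set x in pts i | ev g x \notin pts j].
pose B3 := ev g @^-1: nongood j.
pose B4 := [set x in pts i | #|star i| < D * dist (one i, x) (g, ev g x)].
have sub : #|mismatch a i g| <= (#|nongood i| + #|B2|) + (#|B3| + #|B4|).
  apply: leq_trans (card_le_U (B := nongood i :|: B2) (C := B3 :|: B4) _)
    (leq_add (leq_card_setU _ _) (leq_card_setU _ _)) => x.
  rewrite in_set => /andP[xi]; rewrite (emb_domP xi) !in_setU [x \in nongood i]in_set xi /=.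
  case gx: (good (one i, x)) => //=.
  rewrite [x \in B2]in_set xi /= -/j; case yj: (ev g x \in pts j) => //=.
  rewrite (emb_domP yj) [x \in B3]in_set [_ \in nongood j]in_set yj /=.
  case gy: (good (one j, ev g x)) => //= neq.
  rewrite in_set xi /= ltnNge; apply: contra neq => d.
  have gt : tgt g = over (one j, ev g x) by rewrite /over /= gsrc1.
  have gt' : good (transl g (one j, ev g x)) by rewrite good_transl.
  have ey : emb (ev g x) = mk D_ge9 gy by exact: embE.
  rewrite ey (embE gx xi).
  have e : tr g (mk D_ge9 gy) = mk D_ge9 gx.
    rewrite (tr_mk D_ge9 gy gt' gt); apply: mk_eq.
    have eg : transl g (one j, ev g x) = (g, ev g x) by rewrite /transl /= gmulr1.
    rewrite eg sim_sym; apply: (close_sim D_ge9) => //; first by rewrite /over /= gsrc1.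
    by rewrite /rk /over /= gsrc1; apply: leq_trans d _; lia.
  rewrite -e; apply/eqP; apply: ag.
  by rewrite over_mk /over /= gsrc1.
have c1 := card_nongood i; have c3 := card_nongood j.
have e3 : #|B3| = #|nongood j| by rewrite card_preimset //; exact: perm_inj.
have c2 : E * #|B2| <= #|pts i|.
  apply: leq_trans (ev_into act g); rewrite leq_mul2l; apply/orP; right.
  by apply: card_le_sub => x; rewrite !inE => /andP[-> ->].
have c4 : E * #|B4| <= D * #|pts i| by exact: few_inconsistent.
have cj := card_pts_tgt g; rewrite -/i -/j in cj.
have ED : 8 * 9 * D <= E.
  apply: leq_trans E_large; rewrite -mulnA leq_mul2l /= leq_mul2r; apply/orP; right; nia.
have D0 : 0 < D by lia.
have b2 : 4 * (D * #|B2|) <= #|pts i|.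
  have := leq_mul ED (leqnn #|B2|); lia.
have b4 : 4 * (D * #|B4|) <= #|pts i|.
  have ED2 : 4 * (D * D) <= E.
    by apply: leq_trans E_large; have := leq_pmulr (D * D) D0; lia.
  have h4 := leq_mul ED2 (leqnn #|B4|); rewrite -(leq_pmul2l D0); lia.
have bj : 2 * #|pts j| <= 3 * #|pts i|.
  have E1 : 0 < E by lia.
  have : 3 <= E by lia.
  move: cj; rewrite mulnBl mul1n => cj E3.
  rewrite -(leq_pmul2l E1); have := leq_mul E3 (leqnn #|pts j|); lia.
have := leq_mul (leqnn D) sub; rewrite e3.
by move: c1 c3; rewrite -!mulnA; lia.
Qed.

End Embedding.

End StabilizationCount.

(** * Almost commuting permutations match most parts *)

Section Excess.
Variables (S X : finType) (f : S -> {perm X}) (C K : nat) (G : {set {set X}}).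
Implicit Types (P Q : {set X}) (s : {perm X}) (J : {set {set X}}).
Hypothesis G_triv : trivIset G.
Hypothesis G_exp : forall P, P \in G -> expander_part f C K P.

Local Notation rest := (~: cover G).

Lemma sum_card_G (B : {set X}) : \sum_(P in G) #|P :&: B| <= #|B|.
Proof.
apply: leq_trans (_ : #|cover G :&: B| <= _); last by apply: subset_leq_card; exact: subsetIr.
rewrite -sum1_card (partition_big (pblock G) (mem G)) /=; last first.
  by move=> x; rewrite inE => /andP[xc _]; exact: pblock_mem.
apply: leq_sum => P PG; rewrite sum1_card; apply/subset_leq_card/subsetP => x.
rewrite inE => /andP[xP xB]; rewrite unfold_in /= inE xB andbT (def_pblock G_triv PG xP) eqxx andbT.
by apply/bigcupP; exists P.
Qed.

Lemma sum_card_G_le : \sum_(P in G) #|P| <= #|X|.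
Proof.
rewrite -(cardsT X); apply: leq_trans (sum_card_G [set: X]); apply: leq_sum => P _.
by rewrite setIT.
Qed.

Lemma sum_bd_G : K * \sum_(P in G) bd f P <= #|X|.
Proof.
apply: leq_trans sum_card_G_le; rewrite big_distrr; apply: leq_sum => P PG /=.
by have [] := G_exp PG.
Qed.

(** The edges at which a union of preimages of parts can acquire a boundary: [s]
    does not respect them, or they join two parts. *)
Definition broken s (i : S) : {set X} :=
  [set x | (s (f i x) != f i (s x)) ||
           [exists P in G, (x \in P) != (f i x \in P)]].

Definition frag s Q : nat :=
  bd f Q + \sum_i #|Q :&: s^-1%g @^-1: broken s i|.

(** An edge inside [Q] that comes, under [s], from an edge inside a part does
    not separate the points coming from [J] from the others. *)
Lemma bd_pieces s Q J : J \subset G ->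
  bd f [set y in Q | s^-1%g y \in cover J] <= frag s Q.
Proof.
move=> JG; rewrite /frag /bd -big_split; apply: leq_sum => i _ /=.
apply: card_le_U => y; rewrite !in_set.
case yQ: (y \in Q); case zQ: (f i y \in Q) => //= h.
have [e|ne] := eqVneq (s (f i (s^-1%g y))) (f i (s (s^-1%g y))) => //=.
have e' : s^-1%g (f i y) = f i (s^-1%g y).
  by apply: (@perm_inj _ s); rewrite permKV e permKV.
apply/existsP; move: h; rewrite e'; set x := s^-1%g y.
case xJ: (x \in cover J).
  rewrite eq_sym eqb_id => nJ; move/bigcupP: xJ => [P PJ xP]; exists P.
  rewrite (subsetP JG _ PJ) xP eq_sym eqb_id; apply: contra nJ => fP.
  by apply/bigcupP; exists P.
rewrite eq_sym eqbF_neg negbK => /bigcupP[P PJ fP]; exists P.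
rewrite (subsetP JG _ PJ) fP eqb_id; apply/negP => xP.
by move/negP: xJ; apply; apply/bigcupP; exists P.
Qed.

Lemma sum_frag s : \sum_(Q in G) frag s Q <=
  2 * \sum_(P in G) bd f P + defect f [set: X] s.
Proof.
rewrite big_split /= mul2n -addnn -addnA leq_add2l exchange_big /=.
apply: leq_trans (_ : \sum_i #|broken s i| <= _).
  apply: leq_sum => i _; apply: leq_trans (sum_card_G _) _.
  by rewrite card_preimset //; exact: perm_inj.
rewrite /bd [X in _ <= X + _]exchange_big /defect -big_split; apply: leq_sum => i _ /=.
rewrite addnC; apply: leq_trans (_ : _ <= #|[set x in [set: X] | s (f i x) != f i (s x)]| +
  #|\bigcup_(P in G) [set x | (x \in P) != (f i x \in P)]|) _.
  apply: card_le_U => x; rewrite !in_set /= => /orP[->//|/existsP[P /andP[PG h]]].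
  by apply/orP; right; apply/bigcupP; exists P; rewrite ?in_set.
rewrite leq_add2l; elim/big_rec2: _ => [|P n A _ IH]; first by rewrite cards0.
by apply: leq_trans (leq_card_setU _ _) _; rewrite leq_add2l.
Qed.

(** The empty set is a default value; it leaves all of [Q] in excess. *)
Definition best s Q : {set X} := [arg min_(P < set0 in G :|: [set set0]) #|Q :\: onto P Q s|].
Definition excess s Q : nat := #|Q :\: onto (best s Q) Q s|.

Lemma best_min s Q P : P \in G -> excess s Q <= #|Q :\: onto P Q s|.
Proof.
move=> PG; rewrite /excess /best; case: arg_minnP; first by rewrite !inE eqxx orbT.
by move=> A _; apply; rewrite inE PG.
Qed.

Lemma excess_le s Q : excess s Q <= #|Q|.
Proof. by apply: subset_leq_card; exact: subsetDl. Qed.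

Lemma pieces_card s Q J : J \subset G ->
  #|[set y in Q | s^-1%g y \in cover J]| = \sum_(P in J) #|onto P Q s|.
Proof.
move=> JG; have tJ : trivIset J by exact: trivIsetS JG G_triv.
rewrite -sum1_card (partition_big (fun y => pblock J (s^-1%g y)) (mem J)) /=; last first.
  by move=> x; rewrite inE => /andP[_ xc]; exact: pblock_mem.
apply: eq_bigr => P PJ; rewrite sum1_card; apply: eq_card => y.
rewrite unfold_in /= !inE; apply/idP/idP.
  by case/andP => /andP[-> yc] /eqP <-; rewrite mem_pblock.
case/andP => -> yP; rewrite (def_pblock tJ PJ yP) eqxx andbT.
by apply/bigcupP; exists P.
Qed.

(** If no single part covers most of [Q], then suitable parts together cover a
    definite fraction, but at most half, of [Q], and [Q] expands. *)
Lemma excess_bound s Q : Q \in G ->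
  K * excess s Q <= 8 * C * K * frag s Q + 8 * #|Q| + 4 * K * #|Q :&: s @: rest|.
Proof.
move=> QG; have [Q0 bQ eQ] := G_exp QG.
have [/existsP[P /andP[PG big]]|nobig] := boolP [exists P in G, #|Q| < 2 * #|onto P Q s|].
  have ex := best_min s Q PG.
  have P1 : [set P] \subset G by rewrite sub1set.
  have b := bd_pieces s Q P1.
  have eB : [set y in Q | s^-1%g y \in cover [set P]] = onto P Q s.
    by apply/setP => y; rewrite !inE /cover big_set1.
  rewrite eB in b.
  have oQ : onto P Q s \subset Q by apply/subsetP => y; rewrite inE => /andP[].
  have cD : #|onto P Q s| + #|Q :\: onto P Q s| = #|Q|.
    by rewrite cardsD (setIidPr oQ) subnKC ?subset_leq_card.
  have bD : bd f (Q :\: onto P Q s) <= bd f Q + bd f (onto P Q s).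
    rewrite /bd -big_split; apply: leq_sum => i _; apply: card_le_U => x; rewrite !in_set.
    by case: (x \in Q); case: (f i x \in Q); case: (_ \in P); case: (_ \in P).
  have h : K * #|Q :\: onto P Q s| <= C * K * bd f (Q :\: onto P Q s) + #|Q|.
    by apply: eQ; [exact: subsetDl|lia].
  have bq : bd f Q <= frag s Q by exact: leq_addr.
  have := leq_mul (leqnn K) ex.
  have := leq_mul (leqnn (C * K)) (leq_trans bD (leq_add bq b)).
  lia.
have [small|large] := leqP #|Q| (4 * #|Q :&: s @: rest|).
  have := leq_mul (leqnn K) (leq_trans (excess_le s Q) small); lia.
pose w J := \sum_(P in J) #|onto P Q s|.
pose ok J := (J \subset G) && (2 * w J <= #|Q|).
have ok0 : ok set0 by rewrite /ok sub0set /w big_set0 muln0.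
(* A largest union of pieces that covers at most half of [Q]; no piece covers
   more than half, so an eighth is reached. *)
pose J := [arg max_(J > set0 | ok J) w J].
have [/andP[JG wJ] Jmax] : ok J /\ forall J', ok J' -> w J' <= w J.
  by rewrite /J; case: arg_maxnP.
set B := [set y in Q | s^-1%g y \in cover J].
have cB : #|B| = w J by exact: pieces_card.
have BQ : B \subset Q by apply/subsetP => y; rewrite inE => /andP[].
have B8 : #|Q| <= 8 * #|B|.
  rewrite cB leqNgt; apply/negP => lt.
  have out P : P \in G -> P \notin J -> #|onto P Q s| = 0.
    move=> PG PJ; apply/eqP; rewrite -leqn0 leqNgt; apply/negP => pos.
    have s1 : 2 * #|onto P Q s| <= #|Q|.
      have := nobig; rewrite negb_exists => /forallP/(_ P); rewrite PG /= -leqNgt; exact.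
    have o1 : ok [set P] by rewrite /ok sub1set PG /w big_set1.
    have m1 := Jmax _ o1; rewrite /w big_set1 -/(w J) in m1.
    have wU : w (P |: J) = #|onto P Q s| + w J by rewrite /w big_setU1.
    have o2 : ok (P |: J) by rewrite /ok subUset sub1set PG JG wU /=; lia.
    by have := Jmax _ o2; rewrite wU; lia.
  have tot : #|Q| <= w G + #|Q :&: s @: rest|.
    rewrite /w -pieces_card //; apply: card_le_U => y yQ; rewrite !inE yQ /=.
    case yc: (s^-1%g y \in cover G) => //=.
    by apply/imsetP; exists (s^-1%g y); rewrite ?permKV // inE yc.
  have wG : w G = w J.
    rewrite /w (big_setID J) /= (setIidPr JG) [X in _ + X]big1 ?addn0 // => P.
    by rewrite inE => /andP[PJ PG]; exact: out.
  by rewrite wG in tot; lia.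
have h : K * #|B| <= C * K * bd f B + #|Q|.
  by apply: eQ => //; rewrite cB.
have b := bd_pieces s Q JG; rewrite -/B in b.
have := leq_mul (leqnn K) (excess_le s Q).
have := leq_mul (leqnn K) B8.
have := leq_mul (leqnn (C * K)) b.
lia.
Qed.

Lemma defect_invT s : defect f [set: X] s^-1%g = defect f [set: X] s.
Proof.
apply: eq_bigr => i _; rewrite -(card_preimset _ (@perm_inj _ s)); apply: eq_card => x.
rewrite !inE permK; congr (~~ _); apply/eqP/eqP => h.
  by rewrite -h permKV.
by rewrite -h permK.
Qed.

Definition unmatched s : {set {set X}} :=
  [set P in G | ~~ [exists Q in G, half P Q s]].

(** If the excess of [s^-1] at [P] is less than half of [P], most of [P] lands in
    one part [Q]; as [s] does not match [P] with [Q], at least half of [Q]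
    comes from elsewhere, and [P] is charged to the excess of [s] at [Q]. For each [Q], the
    best part is charged at most twice the excess, and so are all the others
    together. *)
Lemma card_unmatched s : \sum_(P in unmatched s) #|P| <=
  2 * \sum_(P in G) excess s^-1%g P + 4 * \sum_(Q in G) excess s Q.
Proof.
pose U1 := [set P in G | #|P| <= 2 * excess s^-1%g P].
pose U2 Q := [set P in G | (#|P| < 2 * #|into P Q s|) && (P \in unmatched s)].
have sub : unmatched s \subset U1 :|: \bigcup_(Q in G) U2 Q.
  apply/subsetP => P Pu; have := Pu; rewrite inE => /andP[PG _].
  rewrite inE [P \in U1]inE PG /=; case: leqP => //= lt.
  set Q := best s^-1%g P.
  have QG : Q \in G.
    have : Q \in G :|: [set set0].
      by rewrite /Q /best; case: arg_minnP; rewrite // !inE eqxx orbT.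
    rewrite inE => /orP[//|]; rewrite inE => /eqP Qe.
    move: lt; rewrite /excess -/Q Qe.
    have -> : onto set0 P s^-1%g = set0 by apply/setP => x; rewrite !inE andbF.
    by rewrite setD0; lia.
  apply/bigcupP; exists Q => //; rewrite inE PG Pu andbT /=.
  move: lt; rewrite /excess -/Q.
  have -> : onto Q P s^-1%g = into P Q s by apply/setP => x; rewrite !inE invgK.
  have := cardsID (into P Q s) P.
  have -> : P :&: into P Q s = into P Q s by apply/setP => x; rewrite !inE; case: (x \in P).
  lia.
have s1 : \sum_(P in U1) #|P| <= 2 * \sum_(P in G) excess s^-1%g P.
  rewrite big_distrr /=; apply: leq_trans (_ : \sum_(P in U1) 2 * excess s^-1%g P <= _).
    by apply: leq_sum => P; rewrite inE => /andP[].
  rewrite [leqRHS](big_setID U1) /=; apply: leq_trans (leq_addr _ _).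
  by rewrite (setIidPr _) //; apply/subsetP => P; rewrite inE => /andP[].
have s2 Q : Q \in G -> \sum_(P in U2 Q) #|P| <= 4 * excess s Q.
  move=> QG; set Pb := best s Q.
  rewrite (bigID (pred1 Pb)) /=.
  have -> : 4 * excess s Q = 2 * excess s Q + 2 * excess s Q by lia.
  apply: leq_add.
    have [PbU|PbU] := boolP (Pb \in U2 Q); last first.
      rewrite big1 // => P /andP[PU /eqP e]; by rewrite -e PU in PbU.
    rewrite (eq_bigl (pred1 Pb)) ?big_pred1_eq; last first.
      by move=> P /=; case: eqP => [->|]; rewrite ?PbU ?andbF.
    move: PbU; rewrite inE => /and3P[PG h1]; rewrite inE PG /= => /existsPn/(_ Q).
    rewrite QG /= /half h1 /= -leqNgt => h2.
    rewrite /excess -/Pb.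
    have := cardsID (onto Pb Q s) Q; rewrite -(card_onto Pb Q s) in h1 h2.
    have -> : Q :&: onto Pb Q s = onto Pb Q s by apply/setP => x; rewrite !inE; case: (x \in Q).
    lia.
  apply: leq_trans (_ : \sum_(P in U2 Q :\ Pb) 2 * #|onto P Q s| <= _).
    rewrite (eq_bigl (fun P => P \in U2 Q :\ Pb)); last by move=> P; rewrite !inE andbC.
    apply: leq_sum => P; rewrite in_setD1 in_set => /andP[_ /and3P[_ h _]].
    by rewrite card_onto; exact: ltnW.
  rewrite -big_distrr leq_mul2l /= -pieces_card; last first.
    by apply/subsetP => P; rewrite in_setD1 in_set => /andP[_ /andP[]].
  apply: subset_leq_card; apply/subsetP => y; rewrite !in_set.
  case/andP => yQ /bigcupP[P]; rewrite in_setD1 in_set => /andP[PPb /andP[PG _]] yP.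
  rewrite yQ andbT /=; apply/negP; rewrite -/Pb => yPb.
  have : Pb \in G :|: [set set0].
    by rewrite /Pb /best; case: arg_minnP; rewrite // !inE eqxx orbT.
  rewrite inE => /orP[PbG|]; last by rewrite inE => /eqP e; rewrite e inE in yPb.
  have /trivIsetP/(_ _ _ PG PbG PPb) := G_triv.
  by rewrite -setI_eq0 => /eqP/setP/(_ (s^-1%g y)); rewrite !inE yP yPb.
apply: leq_trans (_ : \sum_(P in U1) #|P| + \sum_(Q in G) \sum_(P in U2 Q) #|P| <= _).
  apply: leq_trans (_ : \sum_(P in U1 :|: \bigcup_(Q in G) U2 Q) #|P| <= _).
    rewrite [leqRHS](big_setID (unmatched s)) /= (setIidPr sub); exact: leq_addr.
  have addU (A B : {set {set X}}) : \sum_(P in A :|: B) #|P| <= \sum_(P in A) #|P| + \sum_(P in B) #|P|.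
    rewrite big_mkcond [X in _ <= X + _]big_mkcond [X in _ <= _ + X]big_mkcond -big_split /=.
    by apply: leq_sum => P _; rewrite inE; case: (P \in A); case: (P \in B) => //=; lia.
  apply: leq_trans (addU _ _) _; rewrite leq_add2l.
  apply: (@big_rec2 _ _ (fun (A : {set {set X}}) n => \sum_(P in A) #|P| <= n)).
    by rewrite big_set0.
  by move=> Q n A _ IH; apply: leq_trans (addU _ _) _; rewrite leq_add2l.
by rewrite leq_add // big_distrr; apply: leq_sum => Q QG; exact: s2.
Qed.

Hypothesis rest_small : K * #|rest| <= #|X|.

Lemma sum_excess s : K * \sum_(Q in G) excess s Q <=
  8 * C * K * defect f [set: X] s + (16 * C + 12) * #|X|.
Proof.
have h : K * \sum_(Q in G) excess s Q <=
    \sum_(Q in G) (8 * C * K * frag s Q + 8 * #|Q| + 4 * K * #|Q :&: s @: rest|).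
  by rewrite big_distrr; apply: leq_sum => Q QG; exact: excess_bound.
rewrite big_split /= big_split /= -!big_distrr /= in h.
have h1 := leq_mul (leqnn (8 * C * K)) (sum_frag s).
have h2 := leq_mul (leqnn (4 * K)) (sum_card_G (s @: rest)).
rewrite card_imset in h2; last exact: perm_inj.
have h3 := sum_card_G_le.
have h4 := leq_mul (leqnn (16 * C)) sum_bd_G.
have arith ex fr q r b e N t : K * ex <= 8 * C * K * fr + 8 * q + 4 * K * r ->
    8 * C * K * fr <= 8 * C * K * (2 * b + e) -> 4 * K * r <= 4 * K * t ->
    q <= N -> 16 * C * (K * b) <= 16 * C * N -> K * t <= N ->
    K * ex <= 8 * C * K * e + (16 * C + 12) * N by lia.
exact: (arith _ _ _ _ _ _ _ _ h h1 h2 h3 h4 rest_small).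
Qed.

End Excess.

(** * Finite models of the almost centralizer *)

Section Models.
Variables (S X Y : finType) (f : S -> {perm X}).
Implicit Types (V : {set X}) (phi : X -> Y) (s : {perm X}) (a : {perm Y}).

Definition missing V phi a s : {set X} :=
  [set x | ~~ [&& x \in V, s x \in V & a (phi x) == phi (s x)]].

(** [A] is, up to an error of order [1 / k], the group of the permutations that
    almost commute with the maps [f i]. *)
Definition centralizer_model (c k : nat) V phi (A : {group {perm Y}}) : Prop :=
  [/\ {in V &, injective phi}, k * #|~: V| <= #|X|, k * #|~: phi @: V| <= #|X|,
      forall a, a \in A -> exists s,
        k * defect f [set: X] s <= #|X| /\ k * #|missing V phi a s| <= #|X| &
      forall s, exists2 a, a \in A &
        k * #|missing V phi a s| <= c * k * defect f [set: X] s + #|X|].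

End Models.

(** At precision [0] nothing is asked of [A]; this provides a model for every
    index of a sequence. *)
Lemma trivial_model (S X : finType) (f : S -> {perm X}) c :
  centralizer_model f c 0 [set: X] id [group of 1%g].
Proof.
split=> // [a _|s]; first by exists 1%g.
by exists 1%g; rewrite ?group1.
Qed.

Section FiniteModel.
Variables (S X : finType) (f : S -> {perm X}) (C K n t0 E D k : nat) (G : {set {set X}}).
Implicit Types (P Q : {set X}) (s t u : {perm X}).
Local Notation expander := (expander_part f C K).
Local Notation M := (6 * C + 1).
Local Notation near := (near f).
Local Notation d := #|S|.
Hypothesis t0_large : 16 * M <= t0.
Hypothesis n_large : (t0 + E * M) * (3 + d * M) <= n.
Hypothesis K_large : n * (C + 3) <= K.
Hypothesis G_triv : trivIset G.
Hypothesis G_exp : forall P, P \in G -> expander P.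
Hypothesis G_imp : forall P Q s, P \in G -> Q \in G -> near t0 P Q s ->
  exists s', near n P Q s' /\ same_germ P s s'.
Hypothesis rest_small : K * #|~: cover G| <= #|X|.
Hypothesis D_ge9 : 9 <= D.
Hypothesis E_large : 8 * (D * D * D) <= E.
Hypothesis D_k : 16 * (k * (d + 1)) <= D.
Hypothesis n_k : 4 * (k * (C + 1)) <= n.
Hypothesis K_k : 4 * (k * (98 * C + 74 + 2 * d)) <= K.

Local Notation obj := (germ_obj G).
Local Notation act :=
  (germ_action t0_large n_large K_large G_triv G_exp G_imp).
Local Notation Gam := (germ_groupoid t0_large n_large K_large G_triv G_exp G_imp).
Local Notation ypt := (ypt D act).
Local Notation dom := (emb_dom D act).
Local Notation group := (bisection_group act D_ge9).
Local Notation rest := (~: cover G).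
Implicit Types (i j : obj) (g : garr Gam) (y : ypt).

Lemma sum_obj (F : {set X} -> nat) : \sum_(i : obj) F (val i) = \sum_(P in G) F P.
Proof.
rewrite [RHS](reindex_omap (val : obj -> {set X}) insub) => [|P PG]; last by rewrite insubT.
by apply: eq_bigl => i; rewrite valK eqxx andbT (valP i).
Qed.

Lemma card_by_objects (A : {set X}) (F : obj -> {set X}) :
  (forall i x, x \in val i -> x \in A -> x \in F i) ->
  #|A| <= #|rest| + \sum_i #|F i|.
Proof.
move=> h; apply: leq_trans (_ : #|rest :|: \bigcup_i F i| <= _).
  apply: card_le_sub => x xA; rewrite in_setU in_setC.
  case xc: (x \in cover G) => //=; move/bigcupP: xc => [P PG xP].
  by apply/bigcupP; exists (exist _ P PG) => //; exact: h.
apply: leq_trans (leq_card_setU _ _) _; rewrite leq_add2l.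
elim/big_rec2: _ => [|i m A' _ IH]; first by rewrite cards0.
by apply: leq_trans (leq_card_setU _ _) _; rewrite leq_add2l.
Qed.

Lemma sum_objects_le (c : nat) (F : obj -> nat) m :
  (forall i, c * F i <= m * #|val i|) -> c * \sum_i F i <= m * #|X|.
Proof.
move=> h; apply: leq_trans (_ : m * \sum_(i : obj) #|val i| <= _).
  by rewrite !big_distrr; apply: leq_sum => i _; exact: h.
by rewrite leq_mul2l (sum_obj (fun P => #|P|)) (sum_card_G_le G_triv) orbT.
Qed.

Lemma exists_ypt : 0 < k -> 0 < #|X| -> exists y : ypt, True.
Proof.
move=> k0 X0.
have [P PG] : exists P, P \in G.
  apply/set0Pn; apply: contraTneq rest_small => ->.
  rewrite /cover big_set0 setC0 cardsT -ltnNge -{1}[#|X|]mul1n ltn_pmul2r //.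
  by apply: leq_trans K_k; have := leq_pmull 74 k0; lia.
pose i : obj := exist _ P PG.
have c := card_nongood act D_ge9 E_large i.
have p0 := pts_neq0 act i; rewrite -card_gt0 in p0.
have [x] : exists x, (x \in pts act i) && (x \notin nongood D act i).
  apply/existsP; apply: contraT; rewrite negb_exists => /forallP no.
  have : #|pts act i| <= #|nongood D act i|.
    by apply: card_le_sub => x xi; have := no x; rewrite xi negbK.
  by move=> le; have := leq_mul D_ge9 le; lia.
rewrite in_set => /andP[xi]; rewrite xi negbK => gx.
by exists (mk D_ge9 gx).
Qed.

Lemma card_not_dom : D * #|~: dom| <= D * #|rest| + #|X|.
Proof.
have h := @card_by_objects (~: dom) (fun i => val i :\: dom).
have {}h : #|~: dom| <= #|rest| + \sum_(i : obj) #|val i :\: dom|.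
  by apply: h => i x xi; rewrite in_setC in_setD xi andbT.
have e : D * \sum_(i : obj) #|val i :\: dom| <= 1 * #|X|.
  by apply: sum_objects_le => i; rewrite mul1n; exact: (emb_dom_large act D_ge9 E_large i).
have := leq_mul (leqnn D) h; rewrite mulnDr => /leq_trans; apply.
by rewrite leq_add2l -[leqRHS]mul1n.
Qed.

Let rest_k : 8 * (k * (d + 1)) * #|rest| <= #|X|.
Proof. by apply: leq_trans rest_small; rewrite leq_mul2r; apply/orP; right; lia. Qed.

Lemma dom_large : 4 * k * #|~: dom| <= #|X|.
Proof.
have D0 : 0 < D by lia.
rewrite -(leq_pmul2l D0).
have h := leq_mul (leqnn (4 * k)) card_not_dom.
have h1 := leq_mul (leqnn D) rest_k.
have h2 : 16 * k * #|X| <= D * #|X| by rewrite leq_mul2r; apply/orP; right; lia.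
lia.
Qed.

Lemma img_large (y0 : ypt) : 2 * k * #|~: emb y0 @: dom| <= #|X|.
Proof.
have D0 : 0 < D by lia.
have h := card_ypt act D_ge9 E_large.
have hs : \sum_(i : gobj Gam) #|pts act i| <= #|X|.
  by rewrite (sum_obj (fun P => #|P|)) (sum_card_G_le G_triv).
have {}h := leq_trans h (leq_mul (leqnn (D + 2)) hs).
have inj : {in dom &, injective (emb y0)} by exact: emb_inj D_ge9 E_large _.
have c1 := cardsC (emb y0 @: dom); rewrite (card_in_imset inj) in c1.
have c2 := cardsC dom.
have h3 := dom_large.
have {}h : D * #|~: emb y0 @: dom| <= 2 * #|X| + D * #|~: dom|.
  have arith m N p q r : D * m <= (D + 2) * N -> p + q = m -> p + r = N ->
    D * q <= 2 * N + D * r by move=> hy e1 e2; rewrite -e1 -e2 in hy *; lia.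
  exact: arith h c1 c2.
rewrite -(leq_pmul2l D0).
have h4 := leq_mul (leqnn (2 * k)) h.
have h2 : 16 * k * #|X| <= D * #|X| by rewrite leq_mul2r; apply/orP; right; lia.
have h5 := leq_mul (leqnn D) h3.
lia.
Qed.

Lemma defect_pieces (W : {set X}) (r : obj -> {perm X}) s : W \subset cover G ->
  (forall i x, x \in val i -> x \in W -> s x = r i x) ->
  defect f [set: X] s <= 2 * (d * #|~: W|) + \sum_(P in G) bd f P +
    \sum_(i : obj) defect f (val i) (r i).
Proof.
move=> WG sr; rewrite -sum_nat_const big_distrr /bd /defect exchange_big.
rewrite [X in _ <= _ + X]exchange_big -!big_split; apply: leq_sum => j _ /=.
have union (T I : finType) (J : pred I) (F : I -> {set T}) :
    #|\bigcup_(i | J i) F i| <= \sum_(i | J i) #|F i|.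
  elim/big_rec2: _ => [|i m A _ IH]; first by rewrite cards0.
  by apply: leq_trans (leq_card_setU _ _) _; rewrite leq_add2l.
rewrite mul2n -addnn -{2}(card_preimset (~: W) (@perm_inj _ (f j))).
apply: leq_trans (_ : #|(~: W :|: f j @^-1: ~: W) :|:
     \bigcup_(P in G) [set x | (x \in P) != (f j x \in P)] :|:
     \bigcup_(i : obj) [set x in val i | r i (f j x) != f j (r i x)]| <= _); last first.
  apply: leq_trans (leq_card_setU _ _) (leq_add _ (union _ _ _ _)).
  apply: leq_trans (leq_card_setU _ _) (leq_add _ (union _ _ _ _)).
  exact: leq_card_setU.
apply: card_le_sub => x; rewrite in_set => /andP[_ ne].
rewrite !in_setU [x \in f j @^-1: _]in_set !in_setC.
case xW: (x \in W) => //=; case fW: (f j x \in W) => //=.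
have /bigcupP[P PG xP] := subsetP WG _ xW.
case fP: (f j x \in P); last first.
  by apply/orP; left; apply/bigcupP; exists P; rewrite ?in_set ?xP ?fP.
pose i : obj := exist _ P PG.
apply/orP; right; apply/bigcupP; exists i => //; rewrite in_set.
by rewrite -!(sr i) //= xP.
Qed.

(** On each part [a] acts like an arrow, and the representatives of these arrows,
    whose defects are small, are glued to a permutation. Edges between
    different parts are few. *)
Lemma model_to_perm (y0 : ypt) (a : {perm ypt}) : a \in group ->
  exists s, k * defect f [set: X] s <= #|X| /\ k * #|missing dom (emb y0) a s| <= #|X|.
Proof.
rewrite inE => /asboolP hc.
have {hc}/choice[c hc] : forall i : obj, exists g : garr Gam, gsrc g = i /\ acts_as a g.
  by move=> i; have [g gs ag] := hc i; exists g.
have cs i : gsrc (c i) = i by have [] := hc i.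
pose bad i := mismatch y0 a i (c i).
have cbad i : D * #|bad i| <= 2 * #|val i|.
  have [_ ai] := hc i; have := card_mismatch D_ge9 E_large y0 ai.
  by rewrite cs.
(* Where [a] acts like the representative of the arrow, the representative
   inherits injectivity from [a], even across different parts. *)
pose fits x := [pick i : obj | x \in val i :\: bad i].
pose W := [set x | fits x].
pose h x := if fits x is Some i then germ_ev (c i) x else x.
have fitsE i x : x \in val i :\: bad i -> fits x = Some i.
  move=> xi; rewrite /fits; case: pickP => [j xj|/(_ i)]; last by rewrite xi.
  case/setDP: xi => xi _; case/setDP: xj => xj _.
  by rewrite (obj_disjoint G_triv xi xj).
have WE x : x \in W -> exists2 i : obj, fits x = Some i & x \in val i :\: bad i.
  rewrite in_set /fits; case: pickP => [i xi _|//]; by exists i.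
have good_h x : x \in W -> [&& x \in dom, h x \in dom & a (emb y0 x) == emb y0 (h x)].
  move=> /WE[i fx] /setDP[xi nb]; rewrite /h fx.
  by move: nb; rewrite in_set xi /= negbK => /and4P[-> _ -> ->].
have inj : {in dom &, injective (emb y0)} by exact: emb_inj D_ge9 E_large _.
have h_inj : {in W &, injective h}.
  move=> x x' /good_h/and3P[xd hd /eqP e] /good_h/and3P[xd' _ /eqP e'] ee.
  apply: inj xd xd' _; apply: (@perm_inj _ a).
  exact: etrans e (etrans (congr1 (emb y0) ee) (esym e')).
have [|s [sE _]] := @extend_to_perm X (fun _ _ => true) W h _ h_inj (fun _ _ => isT).
  exact/equivalence_relP.
exists s.
have cW : k * (8 * ((d + 1) * #|~: W|)) <= 2 * #|X|.
  have h1 : #|~: W| <= #|rest| + \sum_i #|bad i|.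
    apply: card_by_objects => i x xi; rewrite in_setC; apply: contraR => nb.
    by rewrite in_set (@fitsE i x) //; apply/setDP.
  have h2 : D * \sum_i #|bad i| <= 2 * #|X| by exact: sum_objects_le cbad.
  have h3 := leq_mul D_k (leqnn (\sum_i #|bad i|)).
  have h4 := leq_mul (leqnn (8 * (k * (d + 1)))) h1.
  have h5 := rest_k; lia.
split; last first.
  apply: leq_trans (_ : k * #|~: W| <= _).
    rewrite leq_mul2l; apply/orP; right; apply: card_le_sub => x; rewrite in_set in_setC.
    by apply: contra => xW; rewrite sE //; exact: good_h.
  by have := leq_addr (d * #|~: W|) #|~: W|; move: cW; rewrite !mulnDl mul1n; lia.
have hd : defect f [set: X] s <= 2 * (d * #|~: W|) + \sum_(P in G) bd f P +
    \sum_(i : obj) defect f (val i) (germ_ev (c i)).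
  apply: defect_pieces => [|i x xi xW].
    apply/subsetP => x /WE[i _] /setDP[xi _].
    by apply/bigcupP; exists (val i) => //; exact: valP i.
  have [j fj /setDP[xj _]] := WE x xW.
  by rewrite sE // /h fj (obj_disjoint G_triv xj xi).
have b1 : 4 * k * \sum_(P in G) bd f P <= #|X|.
  apply: leq_trans (sum_bd_G G_triv G_exp); rewrite leq_mul2r; apply/orP; right.
  by apply: leq_trans K_k; rewrite leq_mul2l /= leq_pmulr //; lia.
have b2 : n * \sum_(i : obj) defect f (val i) (germ_ev (c i)) <= 1 * #|X|.
  apply: sum_objects_le => i; have /andP[_] := germ_near (c i).
  by rewrite (cs i : germ_src (c i) = i) mul1n.
have b3 := leq_mul n_k (leqnn (\sum_(i : obj) defect f (val i) (germ_ev (c i)))).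
have := leq_mul (leqnn k) hd; lia.
Qed.

(** A nearly commuting permutation carries most parts to parts; replacing it on
    each of them by the representative of its germ gives a bisection. *)
Lemma perm_to_model (y0 : ypt) s : exists2 a, a \in group &
  k * #|missing dom (emb y0) a s| <= (49 * C + t0) * k * defect f [set: X] s + #|X|.
Proof.
(* The parts that [s] carries to a part with a small defect. *)
pose N : {set obj} := [set i : obj | [exists j : obj, near t0 (val i) (val j) s]].
pose to i : obj := odflt i [pick j : obj | near t0 (val i) (val j) s].
have toP i : i \in N -> near t0 (val i) (val (to i)) s.
  rewrite inE => /existsP[j nj]; rewrite /to; case: pickP => [j' //|/(_ j)].
  by rewrite nj.
have to_inj : {in N &, injective to}.
  move=> i i' /toP/andP[/andP[_ h1] _] /toP/andP[/andP[_ h2] _] e; rewrite -e in h2.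
  set Q := val (to i) in h1 h2; rewrite -(card_onto (val i) Q s) in h1.
  rewrite -(card_onto (val i') Q s) in h2.
  have [x] : exists x, (x \in onto (val i) Q s) && (x \in onto (val i') Q s).
    apply/existsP; apply: contraT; rewrite negb_exists => /forallP no.
    have : #|onto (val i) Q s| + #|onto (val i') Q s| <= #|Q|.
      rewrite -cardsUI (_ : _ :&: _ = set0) ?cards0 ?addn0.
        by apply: card_le_sub => x; rewrite !inE => /orP[]/andP[].
      by apply/setP => x; rewrite !inE; have := no x; rewrite !inE => /negbTE.
    lia.
  by rewrite !in_set => /andP[/andP[_ xi] /andP[_ xi']]; exact: (obj_disjoint G_triv xi xi').
pose e (i j : gobj Gam) := [exists g : garr Gam, (gsrc g == i) && (gtgt g == j)].
have eP i j : reflect (exists2 g : garr Gam, gsrc g = i & gtgt g = j) (e i j).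
  apply: (iffP existsP) => [[g /andP[/eqP gi /eqP gj]]|[g gi gj]]; exists g => //.
  by rewrite gi gj !eqxx.
have e_eq : equivalence_rel e.
  apply/equivalence_relP; split=> [i|i j /eP[g gi gj] l].
    by apply/eP; exists (gone i); rewrite ?gsrc1 ?gtgt1.
  apply/eP/eP => -[h hi hl].
    exists (gmul (ginv g) h); first by rewrite gsrcM ?gsrcV // gtgtV gi hi.
    by rewrite gtgtM // gtgtV gi hi.
  by exists (gmul g h); rewrite ?gsrcM ?gtgtM // gj hi.
have near_arr i : i \in N -> exists g : garr Gam,
    [/\ gsrc g = i, gtgt g = to i & germ_ev g = germ_rep f n (val i) (val (to i)) s].
  move=> /toP ns.
  by exists (exist (is_germ f n (G := G)) _
    (is_germ_rep t0_large n_large K_large G_triv G_exp G_imp ns)).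
have eN i : i \in N -> e i (to i).
  by move=> /near_arr[g [gi gj _]]; apply/eP; exists g.
(* The map on these parts extends to all parts inside the components of the
   groupoid, so that every part has an arrow to its image. *)
have [p [pN pe]] := extend_to_perm e_eq to_inj eN.
have /choice[c hc] : forall i : obj, exists g : garr Gam, [/\ gsrc g = i, gtgt g = p i &
    i \in N -> germ_ev g = germ_rep f n (val i) (val (to i)) s].
  move=> i; have [iN|iN] := boolP (i \in N).
    by have [g [gi gj ge]] := near_arr i iN; exists g; rewrite pN.
  by have /eP[g gi gj] := pe i; exists g.
have cs i : gsrc (c i) = i by have [] := hc i.
have [||a ag ca] := @bisection_exists _ _ _ _ act D_ge9 c.
- exact: cs.
- by move=> i j; have [_ -> _] := hc i; have [_ -> _] := hc j; exact: perm_inj.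
exists a => //.
(* The points where [a] and [s] may fail to correspond: [a] does not act like the
   representative, [s] differs from the representative, [s] does not match the
   part, or [s] has a large defect there. *)
pose F1 i := mismatch y0 a i (c i).
pose F2 i := if i \in N then [set x in val i | s x != germ_ev (c i) x] else set0.
pose F3 i := if val i \in unmatched G s then val i else set0.
pose F4 i := if #|val i| < t0 * defect f (val i) s then val i else set0.
have cF1 : D * \sum_i #|F1 i| <= 2 * #|X|.
  apply: sum_objects_le => i; have := card_mismatch D_ge9 E_large y0 (ca i).
  by rewrite cs.
have hsum : #|missing dom (emb y0) a s| <= #|rest| +
    (\sum_i #|F1 i| + (\sum_i #|F2 i| + (\sum_i #|F3 i| + \sum_i #|F4 i|))).
  rewrite -!big_split /=.
  apply: leq_trans (_ : _ <= #|rest| + \sum_i #|F1 i :|: (F2 i :|: (F3 i :|: F4 i))|) _; last first.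
    rewrite leq_add2l; apply: leq_sum => i _.
    apply: leq_trans (leq_card_setU _ _) _; rewrite leq_add2l.
    apply: leq_trans (leq_card_setU _ _) _; rewrite leq_add2l.
    exact: leq_card_setU.
  apply: card_by_objects => i x xi; rewrite in_set => xm.
  apply/setUP; have [iN|iN] := boolP (i \in N).
    have [ee|ne] := eqVneq (s x) (germ_ev (c i) x); last first.
      by right; apply/setUP; left; rewrite /F2 iN in_set xi.
    left; rewrite in_set xi /=; apply: contra xm => /and4P[h1 _ h2 h3].
    by rewrite ee h1 h2 h3.
  right; apply/setUP; right; apply/setUP; rewrite /F3 /F4.
  have [iu|iu] := boolP (val i \in unmatched G s); first by left.
  right; case: ltnP => // le; move: iN; rewrite in_set => /negP[].
  move: iu; rewrite in_set (valP i) /= negbK => /existsP[Q /andP[QG hQ]].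
  by apply/existsP; exists (exist _ Q QG); rewrite /near hQ.
have ev_small : n * \sum_(i : obj) defect f (val i) (germ_ev (c i)) <= 1 * #|X|.
  apply: sum_objects_le => i; have /andP[_] := germ_near (c i).
  by rewrite (cs i : germ_src (c i) = i) mul1n.
have s_small : \sum_(i : obj) defect f (val i) s <= defect f [set: X] s.
  rewrite (sum_obj (fun P => defect f P s)) /defect exchange_big; apply: leq_sum => j _ /=.
  apply: leq_trans (sum_card_G G_triv _); apply: leq_sum => P _.
  by apply: card_le_sub => x; rewrite !inE.
have cF2 : K * \sum_i #|F2 i| <= C * K * (\sum_(i : obj) defect f (val i) s +
    \sum_(i : obj) defect f (val i) (germ_ev (c i))) + (2 * C + 1) * #|X|.
  apply: leq_trans (_ : _ <= C * K * (\sum_(i : obj) defect f (val i) s +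
    \sum_(i : obj) defect f (val i) (germ_ev (c i))) + (2 * C + 1) * \sum_(i : obj) #|val i|) _.
    rewrite -big_split !big_distrr -big_split /=; apply: leq_sum => i _.
    rewrite /F2; case: ifP => iN; last by rewrite cards0 muln0.
    apply: (diff_linear (G_exp (valP i))).
    have [_ _ ->] := hc i => //.
    have [_ h] := germ_repP t0_large n_large K_large G_triv G_exp G_imp (valP i) (valP (to i)) (toP i iN).
    have p0 : 0 < #|val i| by rewrite card_gt0; exact: (pts_neq0 act i).
    have aux v w : 16 * v <= w -> 0 < w -> 2 * v < w by lia.
    rewrite same_germE; exact: aux h p0.
  by rewrite leq_add2l leq_mul2l (sum_obj (fun P => #|P|)) (sum_card_G_le G_triv) orbT.
have cF3 : K * \sum_i #|F3 i| <= 6 * (8 * C * K * defect f [set: X] s + (16 * C + 12) * #|X|).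
  have -> : \sum_i #|F3 i| = \sum_(P in unmatched G s) #|P|.
    under eq_bigr do rewrite /F3 (fun_if (fun B : {set X} => #|B|)) cards0.
    rewrite (sum_obj (fun P => if P \in unmatched G s then #|P| else 0)) -big_mkcondr.
    by apply: eq_bigl => P; rewrite in_set andbA andbb.
  have h := card_unmatched G_triv s.
  have h1 := sum_excess G_triv G_exp rest_small s.
  have h2 := sum_excess G_triv G_exp rest_small s^-1%g; rewrite defect_invT in h2.
  have := leq_mul (leqnn K) h; lia.
have cF4 : \sum_i #|F4 i| <= t0 * \sum_(i : obj) defect f (val i) s.
  rewrite big_distrr; apply: leq_sum => i _ /=; rewrite /F4; case: ifP => [/ltnW//|_].
  by rewrite cards0.
have arith m r f1 f2 f3 f4 w v dl N' : m <= r + (f1 + (f2 + (f3 + f4))) ->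
    K * r <= N' -> D * f1 <= 2 * N' -> K * f2 <= C * K * (w + v) + (2 * C + 1) * N' ->
    n * v <= 1 * N' -> w <= dl -> K * f3 <= 6 * (8 * C * K * dl + (16 * C + 12) * N') ->
    f4 <= t0 * w -> k * m <= (49 * C + t0) * k * dl + N'.
  move=> h0 h1 h2 h3 h4 h5 h6 h7.
  have [->|k0] := posnP k; first by rewrite mul0n.
  have K0 : 0 < K by apply: leq_trans K_k; rewrite !muln_gt0 k0 /=; lia.
  have g1 : K * (r + f2 + f3) <= 49 * C * K * dl + C * K * v + (98 * C + 74) * N'.
    by have := leq_mul (leqnn (C * K)) h5; lia.
  have g2 : 4 * k * (r + f2 + f3) <= 196 * k * C * dl + 2 * N'.
    rewrite -(leq_pmul2l K0).
    have nk : 4 * (k * C) <= n by lia.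
    have Kk : 4 * (k * (98 * C + 74)) <= K by lia.
    have := leq_mul (leqnn (4 * k)) g1.
    have := leq_mul (leqnn K) (leq_trans (leq_mul nk (leqnn v)) h4).
    have := leq_mul Kk (leqnn N'); lia.
  have Dk : 16 * k <= D by lia.
  have g3 := leq_trans (leq_mul Dk (leqnn f1)) h2.
  have g4 := leq_mul (leqnn k) (leq_trans h7 (leq_mul (leqnn t0) h5)).
  have g0 := leq_mul (leqnn k) h0; lia.
exact: arith hsum rest_small cF1 cF2 ev_small s_small cF3 cF4.
Qed.

Lemma model_of_germs : 0 < k -> 0 < #|X| ->
  exists (Y : finType) (V : {set X}) (phi : X -> Y) (A : {group {perm Y}}),
    centralizer_model f (49 * C + t0) k V phi A.
Proof.
move=> k0 X0; have [y0 _] := exists_ypt k0 X0.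
exists ypt, dom, (emb y0), group; split.
- exact: emb_inj D_ge9 E_large y0.
- by apply: leq_trans dom_large; rewrite -mulnA leq_pmull.
- by apply: leq_trans (img_large y0); rewrite -mulnA leq_pmull.
- exact: model_to_perm.
- exact: perm_to_model.
Qed.

End FiniteModel.

(** The constants are chosen backwards: [D] and [E] control the change of the
    set, [n] the defects of representatives, [K] the expansion of the parts, and
    the length [m] of the words is chosen last. *)
Lemma exists_model (S : finType) (Ker : freegroup S -> Prop) (C0 : nat) :
  rigid Ker C0 -> exists c, forall k, exists m,
  forall (X : finType) (a : {multiplicative freegroup S -> {perm X}}),
  0 < #|X| -> m * #|bad_pts Ker a m| <= #|X| ->
  exists (Y : finType) (V : {set X}) (phi : X -> Y) (A : {group {perm Y}}),
    centralizer_model (gens a) c k V phi A.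
Proof.
move=> rig; pose C := 4 * C0; pose M := 6 * C + 1; pose t0 := 192 * C0 + 16 * M.
exists (49 * C + t0) => k; have [->|k0] := posnP k.
  by exists 0 => X a _ _; exists X, [set: X], id, [group of 1%g]; exact: trivial_model.
pose d := #|S|; pose D := 9 + 16 * (k * (d + 1)); pose E := 8 * (D * D * D).
pose n := (t0 + E * M) * (3 + d * M) + 4 * (k * (C + 1)).
have [m1 [K1 imp]] := germ_improvement n rig.
pose K := n * (C + 3) + K1 + 4 * (k * (98 * C + 74 + 2 * d)).
have [m [_ parts]] := expander_parts K m1 rig.
exists m => X a X0 badX; have [G [G_triv G_parts rest_small]] := parts X a badX.
have t0_large : 16 * (6 * C + 1) <= t0 by exact: leq_addl.
have n_large : (t0 + E * (6 * C + 1)) * (3 + #|S| * (6 * C + 1)) <= n by exact: leq_addr.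
have K_large : n * (C + 3) <= K by rewrite /K -addnA leq_addr.
have G_exp P : P \in G -> expander_part (gens a) C K P by case/G_parts.
have G_imp P Q s : P \in G -> Q \in G -> near (gens a) t0 P Q s ->
    exists s', near (gens a) n P Q s' /\ same_germ P s s'.
  move=> PG QG /andP[hs ds]; have [eP bP] := G_parts P PG; have [eQ bQ] := G_parts Q QG.
  have KK : K1 <= K by rewrite /K addnAC leq_addl.
  have [|s' [h1 h2 h3]] := imp K X a P Q s KK eP eQ bP bQ hs.
    apply: leq_trans ds; rewrite leq_mul2r leq_add2l /M /C; apply/orP; right; lia.
  by exists s'; rewrite /near h1 h3.
have D_ge9 : 9 <= D by exact: leq_addr.
have E_large : 8 * (D * D * D) <= E by [].
have D_k : 16 * (k * (#|S| + 1)) <= D by exact: leq_addl.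
have n_k : 4 * (k * (C + 1)) <= n by exact: leq_addl.
have K_k : 4 * (k * (98 * C + 74 + 2 * #|S|)) <= K by exact: leq_addl.
exact: (@model_of_germs S X (gens a) C K n t0 E D k G).
Qed.

(** * Moving permutations along a partial bijection *)

Section Correspondence.
Variables (X Y : finType) (V : {set X}) (phi : X -> Y).
Hypothesis phi_inj : {in V &, injective phi}.
Implicit Types (s t : {perm X}) (p q : {perm Y}).
Local Notation missing := (missing V phi).
Local Notation rest := (~: V).
Local Notation rest' := (~: phi @: V).

Lemma missing1 : (#|missing 1%g 1%g| <= #|rest|)%N.
Proof.
apply: card_le_sub => x; rewrite !inE !perm1 eqxx andbT andbb.
by apply: contra.
Qed.

Lemma missingM s t p q :
  (#|missing (p * q)%g (s * t)%g| <= #|missing p s| + #|missing q t|)%N.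
Proof.
rewrite -(card_preimset (missing q t) (@perm_inj _ s)).
apply: card_le_U => x; rewrite !inE !permM -negb_and; apply: contra.
case/andP => /and3P[-> _ /eqP ->] /and3P[_ -> /eqP ->].
by rewrite eqxx.
Qed.

Lemma missingV s p : (#|missing p^-1%g s^-1%g| <= #|missing p s|)%N.
Proof.
rewrite -(card_preimset (missing p s) (@perm_inj _ s^-1%g)).
apply: card_le_sub => x; rewrite !inE permKV; apply: contra.
by case/and3P => -> -> /eqP <-; rewrite permK eqxx.
Qed.

Lemma differ_transfer s t p q :
  (#|[set y | p y != q y]| <=
     #|[set x | s x != t x]| + (#|rest'| + (#|missing p s| + #|missing q t|)))%N.
Proof.
apply: leq_trans (_ : #|rest' :|: phi @: ([set x | s x != t x] :|: (missing p s :|: missing q t))| <= _)%N.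
  apply: card_le_sub => y; rewrite in_set => ne; apply/setUP.
  have [/imsetP[x xV e]|yV] := boolP (y \in phi @: V); last by left; rewrite in_setC.
  right; apply/imsetP; exists x => //.
  apply: contraTT ne; rewrite !in_setU !negb_or in_set negbK.
  rewrite [x \in missing p s]in_set [x \in missing q t]in_set !negbK.
  case/and3P => /eqP st /and3P[_ _ /eqP hp] /and3P[_ _ /eqP hq].
  by rewrite e hp hq st.
apply: leq_trans (leq_card_setU _ _) _; rewrite addnCA leq_add2l.
apply: leq_trans (leq_imset_card _ _) _.
apply: leq_trans (leq_card_setU _ _) _; rewrite leq_add2l.
exact: leq_card_setU.
Qed.

Lemma differ_transferV s t p q :
  (#|[set x | s x != t x]| <=
     #|[set y | p y != q y]| + (#|missing p s| + #|missing q t|))%N.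
Proof.
set M := missing p s :|: missing q t.
apply: leq_trans (_ : #|[set x | s x != t x] :\: M| + #|M| <= _)%N.
  apply: leq_trans (leq_card_setU _ _); apply: card_le_sub => x xd.
  by rewrite in_setU in_setD xd andbT; case: (x \in M).
apply: leq_add; last exact: leq_card_setU.
have inM x : x \notin M -> [&& x \in V, s x \in V, t x \in V, p (phi x) == phi (s x) &
    q (phi x) == phi (t x)].
  rewrite in_setU negb_or [x \in missing p s]in_set [x \in missing q t]in_set !negbK.
  by case/andP => /and3P[-> -> ->] /and3P[_ -> ->].
apply: (@card_le_inj _ _ _ _ phi) => [x x' /setDP[_ xM] /setDP[_ xM']|x /setDP[xd xM]].
  by case/and5P: (inM _ xM) => xV _ _ _ _; case/and5P: (inM _ xM') => xV' _ _ _ _; exact: phi_inj.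
case/and5P: (inM _ xM) => xV sV tV /eqP hp /eqP hq.
rewrite in_set hp hq; move: xd; rewrite in_set; apply: contra => /eqP e.
by apply/eqP/phi_inj.
Qed.

Lemma transfer_exists s : exists p,
  forall x, x \in V -> s x \in V -> p (phi x) = phi (s x).
Proof.
pose D := [set x in V | s x \in V].
pose back y := [pick x in D | phi x == y].
pose g y := if back y is Some x then phi (s x) else y.
have gE x : x \in D -> g (phi x) = phi (s x).
  move=> xD; rewrite /g /back; case: pickP => [x' /andP[xD' /eqP e]|/(_ x)]; last by rewrite xD eqxx.
  by move: xD xD'; rewrite !in_set => /andP[xV _] /andP[xV' _]; rewrite (phi_inj xV' xV e).
have g_inj : {in phi @: D &, injective g}.
  move=> _ _ /imsetP[x xD ->] /imsetP[x' xD' ->]; rewrite !gE // => e; congr phi.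
  move: xD xD'; rewrite !in_set => /andP[_ sV] /andP[_ sV'].
  exact/(@perm_inj _ s)/phi_inj.
have [|p [pE _]] := @extend_to_perm Y (fun _ _ => true) (phi @: D) g _ g_inj (fun _ _ => isT).
  exact/equivalence_relP.
exists p => x xV sV; have xD : x \in D by rewrite in_set xV.
by rewrite pE ?gE // imset_f.
Qed.

Lemma transferV_exists p : exists s,
  forall x x', x \in V -> x' \in V -> p (phi x) = phi x' -> s x = x'.
Proof.
pose D := [set x in V | p (phi x) \in phi @: V].
pose g x := odflt x [pick x' in V | p (phi x) == phi x'].
have gE x x' : x' \in V -> p (phi x) = phi x' -> g x = x'.
  move=> xV' e; rewrite /g; case: pickP => [x'' /andP[xV'' /eqP e']|/(_ x')] /=.
    by apply: phi_inj => //; rewrite -e'.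
  by rewrite xV' e eqxx.
have g_inj : {in D &, injective g}.
  move=> x y; rewrite !in_set => /andP[xV /imsetP[x' xV' ex]] /andP[yV /imsetP[y' yV' ey]].
  rewrite (gE x x') // (gE y y') // => e; apply: phi_inj => //.
  by apply: (@perm_inj _ p); rewrite ex ey e.
have [|s [sE _]] := @extend_to_perm X (fun _ _ => true) D g _ g_inj (fun _ _ => isT).
  exact/equivalence_relP.
exists s => x x' xV xV' e; rewrite sE ?(gE x x') //.
by rewrite in_set xV; apply/imsetP; exists x'.
Qed.

Lemma missing_transfer s p :
  (forall x, x \in V -> s x \in V -> p (phi x) = phi (s x)) ->
  (#|missing p s| <= #|rest| + #|rest|)%N.
Proof.
move=> h; rewrite -{2}(card_preimset rest (@perm_inj _ s)).
apply: card_le_U => x; rewrite !inE -negb_and; apply: contra => /andP[xV sV].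
by rewrite xV sV h // eqxx.
Qed.

Lemma missing_transferV s p :
  (forall x x', x \in V -> x' \in V -> p (phi x) = phi x' -> s x = x') ->
  (#|missing p s| <= #|rest| + #|rest'|)%N.
Proof.
move=> h; rewrite -[X in (_ <= _ + X)%N](card_preimset _ (@perm_inj _ p)).
apply: leq_trans (_ : #|rest| + #|phi @^-1: (p @^-1: rest') :&: V| <= _)%N.
  apply: card_le_U => x; rewrite in_set in_setC in_setI.
  case xV: (x \in V) => //= nx; rewrite andbT [x \in _]in_set [phi x \in _]in_set in_setC.
  apply: contra nx => /imsetP[x' xV' e].
  by rewrite (h x x') // xV' e eqxx.
rewrite leq_add2l; apply: (@card_le_inj _ _ _ _ phi) => [x x'|x].
  by move=> /setIP[_ xV] /setIP[_ xV']; exact: phi_inj.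
by move=> /setIP[]; rewrite [x \in _]in_set.
Qed.

Lemma card_model : (#|Y| <= #|X| + #|rest'|)%N /\ (#|X| <= #|Y| + #|rest|)%N.
Proof.
have c1 := cardsC (phi @: V); have c2 := cardsC V.
rewrite (card_in_imset phi_inj) in c1; split; rewrite -?c1 -?c2.
  by rewrite -addnA leq_add2l; exact: leq_addl.
by rewrite leq_add2r leq_addr.
Qed.

End Correspondence.

From mathcomp Require Import finmap complex ring lra.
From mathcomp Require Import all_classical all_reals.
From mathcomp Require Import topology normedtype.

Import Order.TTheory GRing.Theory Num.Theory.
Import numFieldNormedType.Exports.

Local Open Scope classical_set_scope.
Local Open Scope ring_scope.
Local Open Scope complex_scope.

(** * Hilbert spaces as quotients by null vectors *)

(** Hilbert spaces before null vectors are divided out. Completeness is asked for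
    rapidly converging sequences only, with an explicit rate: this is what a
    diagonal argument gives for ultraproducts. *)
Record prehil (R : realType) := Prehil {
  pcar :> lmodType R[i];
  pip : pcar -> pcar -> R[i];
  pip_lin : forall a u v w, pip (a *: u + v) w = a * pip u w + pip v w;
  pip_conj : forall u v, pip v u = conjc (pip u v);
  pip_ge0 : forall u, 0 <= pip u u;
  pip_complete : forall x : nat -> pcar,
    (forall k, complex.Re (pip (x k.+1 - x k) (x k.+1 - x k)) <= 4^-1 ^+ k) ->
    exists y, forall k, complex.Re (pip (y - x k) (y - x k)) <= 16 * 4^-1 ^+ k }.

Section SemiInner.
Variables (R : realType) (D : prehil R).
Implicit Types (u v w : D) (a : R[i]).
Local Notation ip := (@pip R D).

(** The squared seminorm. *)
Definition qn u : R := complex.Re (ip u u).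

Lemma pip_qn u : ip u u = (qn u)%:C.
Proof. by rewrite /qn RRe_real // ger0_real // pip_ge0. Qed.

Lemma qn_ge0 u : 0 <= qn u.
Proof. by rewrite -ler0c -pip_qn pip_ge0. Qed.

Lemma pip0l w : ip 0 w = 0.
Proof.
by apply: (addIr (ip 0 w)); rewrite add0r -{1}[ip 0 w]mul1r -pip_lin scaler0 addr0.
Qed.

Lemma pipDl u v w : ip (u + v) w = ip u w + ip v w.
Proof. by rewrite -{1}[u]scale1r pip_lin mul1r. Qed.

Lemma pipZl a u w : ip (a *: u) w = a * ip u w.
Proof. by rewrite -[a *: u]addr0 pip_lin pip0l addr0. Qed.

Lemma pipDr u v w : ip w (u + v) = ip w u + ip w v.
Proof. by rewrite pip_conj pipDl rmorphD /= -!pip_conj. Qed.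

Lemma pipZr a u w : ip w (a *: u) = conjc a * ip w u.
Proof. by rewrite pip_conj pipZl rmorphM /= -pip_conj. Qed.

Lemma pipNl u w : ip (- u) w = - ip u w.
Proof. by rewrite -scaleN1r pipZl mulN1r. Qed.

Lemma pipNr u w : ip w (- u) = - ip w u.
Proof. by rewrite pip_conj pipNl rmorphN /= -pip_conj. Qed.

Lemma qn0 : qn 0 = 0. Proof. by rewrite /qn pip0l. Qed.
Lemma qnN u : qn (- u) = qn u.
Proof. by rewrite /qn pipNl pipNr opprK. Qed.
Lemma qnB u v : qn (u - v) = qn (v - u).
Proof. by rewrite -qnN opprB. Qed.

Lemma qnZ a u : qn (a *: u) = complex.Re (a * conjc a) * qn u.
Proof.
rewrite /qn pipZl pipZr mulrA pip_qn; case: (a * _) => x y /=.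
by rewrite mulr0 subr0.
Qed.

Lemma qnZr (t : R) u : qn (t%:C *: u) = t ^+ 2 * qn u.
Proof. by rewrite qnZ /= oppr0 mulr0 subr0 expr2. Qed.

Lemma Re_conjc (z : R[i]) : complex.Re (conjc z) = complex.Re z.
Proof. by case: z. Qed.
Lemma ReD (x y : R[i]) : complex.Re (x + y) = complex.Re x + complex.Re y.
Proof. by case: x; case: y. Qed.
Lemma ReN (x : R[i]) : complex.Re (- x) = - complex.Re x.
Proof. by case: x. Qed.

Lemma qnD u v : qn (u + v) = qn u + qn v + 2 * complex.Re (ip u v).
Proof.
rewrite /qn pipDl !pipDr !ReD (pip_conj v u) Re_conjc.
ring.
Qed.

Lemma qnBE u v : qn (u - v) = qn u + qn v - 2 * complex.Re (ip u v).
Proof. by rewrite qnD qnN pipNr ReN mulrN. Qed.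

Lemma qnD_le u v : qn (u + v) <= 2 * qn u + 2 * qn v.
Proof. have := qn_ge0 (u - v); rewrite qnBE (qnD u v); lra. Qed.

Lemma qn_parallelogram u v : qn (u + v) + qn (u - v) = 2 * qn u + 2 * qn v.
Proof. rewrite qnBE (qnD u v); ring. Qed.

(** The Cauchy-Schwarz inequality for the real part; multiplying by the imaginary
    unit gives the other part when it is needed. *)
Lemma pip_cs_re u v :
  complex.Re (ip u v) ^+ 2 <= qn u * qn v.
Proof.
have H (s t : R) : 0 <= s ^+ 2 * qn u + t ^+ 2 * qn v - 2 * (s * t * complex.Re (ip u v)).
  have := qn_ge0 (s%:C *: u - t%:C *: v); rewrite qnBE !qnZr pipZl pipZr.
  by case: (ip u v) => x y /=; rewrite oppr0 !mul0r !subr0 /= !mulrA.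
set c := complex.Re _ in H *.
have hu := qn_ge0 u; have hv := qn_ge0 v.
have [v0|v0] := ltrP 0 (qn v).
  have := H (qn v) c; have -> : (qn v) ^+ 2 * qn u + c ^+ 2 * qn v - 2 * (qn v * c * c)
    = qn v * (qn u * qn v - c ^+ 2) by ring.
  by rewrite pmulr_rge0 // subr_ge0.
have {v0 hv} v0 : qn v = 0 by apply/le_anti/andP.
rewrite v0 mulr0.
have := H c (qn u + 1); rewrite v0 mulr0 addr0.
have -> : c ^+ 2 * qn u - 2 * (c * (qn u + 1) * c) = - (c ^+ 2 * (qn u + 2)) by ring.
rewrite oppr_ge0 pmulr_lle0 //; lra.
Qed.

Lemma pip_null u v : qn v = 0 -> ip u v = 0.
Proof.
move=> v0; have H w : complex.Re (ip w v) = 0.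
  by apply/eqP; rewrite -sqrf_eq0 eq_le sqr_ge0 andbT; have := pip_cs_re w v; rewrite v0 mulr0.
have H1 := H u; have := H ('i *: u); rewrite pipZl.
case: (ip u v) H1 => x y /= -> ; rewrite !mul0r mul1r add0r => /eqP.
by rewrite oppr_eq0 => /eqP ->.
Qed.

Lemma sqrt_qnD u v : Num.sqrt (qn (u + v)) <= Num.sqrt (qn u) + Num.sqrt (qn v).
Proof.
have s0 : 0 <= Num.sqrt (qn u) + Num.sqrt (qn v) by rewrite addr_ge0 ?sqrtr_ge0.
rewrite -[leRHS]ger0_norm // -sqrtr_sqr ler_wsqrtr // sqrrD !sqr_sqrtr ?qn_ge0 //.
have : complex.Re (ip u v) <= Num.sqrt (qn u) * Num.sqrt (qn v).
  rewrite -sqrtrM ?qn_ge0 //; apply: le_trans (ler_norm _) _.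
  by rewrite -sqrtr_sqr ler_wsqrtr // pip_cs_re.
rewrite qnD; lra.
Qed.

End SemiInner.

Section Quotient.
Variables (R : realType) (D : prehil R).
Implicit Types (u v w : D) (a : R[i]).

Definition nullb : rel D := fun u v => qn (u - v) == 0.

Lemma nullb_equiv : equiv_class_of nullb.
Proof.
split=> [u|u v|v u w].
- by rewrite /nullb subrr qn0.
- by rewrite /nullb qnB.
- rewrite /nullb => /eqP uv /eqP vw; rewrite eq_le qn_ge0 andbT.
  rewrite -[u - w](subrKA v); apply: le_trans (qnD_le _ _) _.
  by rewrite uv vw !mulr0 addr0.
Qed.

Canonical nullb_equiv_rel := EquivRelPack nullb_equiv.

Definition hil := {eq_quot nullb_equiv_rel}%qT.
HB.instance Definition _ := Choice.on hil.
HB.instance Definition _ := EqQuotient.on hil.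

Definition hcls u : hil := (\pi_hil u)%qT.
Definition hrep (x : hil) : D := generic_quotient.repr x.

Lemma hclsP u v : hcls u = hcls v <-> qn (u - v) = 0.
Proof.
by rewrite /hcls; split=> [/eqmodP/eqP|/eqP uv]; last apply/eqmodP.
Qed.

Lemma hrepK x : hcls (hrep x) = x.
Proof. exact: generic_quotient.reprK. Qed.

Lemma hrepP u : qn (hrep (hcls u) - u) = 0.
Proof. by apply/hclsP; rewrite hrepK. Qed.

Definition hadd (x y : hil) := hcls (hrep x + hrep y).
Definition hopp (x : hil) := hcls (- hrep x).
Definition hscale a (x : hil) := hcls (a *: hrep x).

Lemma haddE u v : hadd (hcls u) (hcls v) = hcls (u + v).
Proof.
apply/hclsP/eqP; rewrite eq_le qn_ge0 andbT opprD addrACA.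
by apply: le_trans (qnD_le _ _) _; rewrite !hrepP !mulr0 addr0.
Qed.
Lemma hoppE u : hopp (hcls u) = hcls (- u).
Proof. by apply/hclsP; rewrite -opprD qnN hrepP. Qed.
Lemma hscaleE a u : hscale a (hcls u) = hcls (a *: u).
Proof. by apply/hclsP; rewrite -scalerBr qnZ hrepP mulr0. Qed.

Lemma haddA : associative hadd.
Proof. by move=> x y z; rewrite -(hrepK x) -(hrepK y) -(hrepK z) !haddE addrA. Qed.
Lemma haddC : commutative hadd.
Proof. by move=> x y; rewrite -(hrepK x) -(hrepK y) !haddE addrC. Qed.
Lemma hadd0 : left_id (hcls 0) hadd.
Proof. by move=> x; rewrite -(hrepK x) !haddE add0r. Qed.
Lemma haddN : left_inverse (hcls 0) hopp hadd.
Proof. by move=> x; rewrite -(hrepK x) hoppE haddE addNr. Qed.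

HB.instance Definition _ := GRing.isZmodule.Build hil haddA haddC hadd0 haddN.

Lemma hclsD u v : hcls (u + v) = hcls u + hcls v. Proof. by rewrite -haddE. Qed.
Lemma hclsN u : hcls (- u) = - hcls u. Proof. by rewrite -hoppE. Qed.
Lemma hclsB u v : hcls (u - v) = hcls u - hcls v.
Proof. by rewrite hclsD hclsN. Qed.

Lemma hscaleA a b x : hscale a (hscale b x) = hscale (a * b) x.
Proof. by rewrite -(hrepK x) !hscaleE scalerA. Qed.
Lemma hscale1 : left_id 1 hscale.
Proof. by move=> x; rewrite -(hrepK x) !hscaleE scale1r. Qed.
Lemma hscaleDr : right_distributive hscale +%R.
Proof.
by move=> a x y; rewrite -(hrepK x) -(hrepK y) -hclsD !hscaleE scalerDr hclsD.
Qed.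
Lemma hscaleDl x : {morph hscale^~ x : a b / a + b}.
Proof. by move=> a b; rewrite -(hrepK x) !hscaleE scalerDl hclsD. Qed.

HB.instance Definition _ :=
  GRing.Zmodule_isLmodule.Build R[i] hil hscaleA hscale1 hscaleDr hscaleDl.

Lemma hclsZ a u : hcls (a *: u) = a *: hcls u. Proof. by rewrite -hscaleE. Qed.

Definition hip (x y : hil) : R[i] := pip (hrep x) (hrep y).

Lemma hipE u v : hip (hcls u) (hcls v) = pip u v.
Proof.
have nl w w' : pip (hrep (hcls w)) w' = pip w w'.
  rewrite -[hrep _](subrK w) pipDl pip_conj pip_null ?hrepP //.
  by rewrite conjc0 add0r.
by rewrite /hip nl pip_conj nl -pip_conj.
Qed.

Lemma hip_conj x y : hip y x = conjc (hip x y).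
Proof. exact: pip_conj. Qed.

Lemma hip_lin a x y z : hip (a *: x + y) z = a * hip x z + hip y z.
Proof.
by rewrite -(hrepK x) -(hrepK y) -(hrepK z) -hclsZ -hclsD !hipE pip_lin.
Qed.

Definition hnorm (x : hil) : R[i] := (Num.sqrt (qn (hrep x)))%:C.

Lemma qn_cls u : qn (hrep (hcls u)) = qn u.
Proof. by have := hipE u u; rewrite /hip !pip_qn => -[]. Qed.

Lemma hnormE u : hnorm (hcls u) = (Num.sqrt (qn u))%:C.
Proof. by rewrite /hnorm qn_cls. Qed.

Lemma hnormD x y : hnorm (x + y) <= hnorm x + hnorm y.
Proof.
rewrite -(hrepK x) -(hrepK y) -hclsD !hnormE -rmorphD /= lecR.
exact: sqrt_qnD.
Qed.

Lemma hnormZ (a : R[i]) (x : hil) : hnorm (a *: x) = `|a| * hnorm x.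
Proof.
rewrite -(hrepK x) -hclsZ !hnormE qnZ sqrtrM.
  rewrite rmorphM /=; congr (_ * _).
  case: a => p q; rewrite normc_def /=; congr (Num.sqrt _)%:C; ring.
by case: a => p q /=; rewrite mulrN opprK addr_ge0 // -expr2 sqr_ge0.
Qed.

Lemma hnorm0_eq0 x : hnorm x = 0 -> x = 0.
Proof.
move=> [/eqP]; rewrite sqrtr_eq0 => x0; rewrite -(hrepK x); apply/hclsP.
by rewrite subr0; apply/eqP; rewrite eq_le x0 qn_ge0.
Qed.

HB.instance Definition _ :=
  Lmodule_isNormed.Build R[i] hil hnormD hnormZ hnorm0_eq0.

End Quotient.

Section Complete.
Variables (R : realType) (D : prehil R).

Lemma hnormB_sqrt (u v : D) : `|hcls u - hcls v| = (Num.sqrt (qn (u - v)))%:C :> R[i].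
Proof. by rewrite -hclsB -hnormE. Qed.

Lemma exprV2_small (r : R) : 0 < r -> exists k, 2^-1 ^+ k < r.
Proof.
move=> r0; exists (Num.bound r^-1).
rewrite exprVn -[ltRHS]invrK ltf_pV2 ?posrE ?invr_gt0 ?exprn_gt0 //.
exact: upper_nthrootP.
Qed.

(** Centres of balls of radius [2 ^- k.+2] that belong to a Cauchy filter form a
    rapidly converging sequence. *)
Lemma hil_complete (F : set_system (hil D)) :
  ProperFilter F -> cauchy F -> cvg F.
Proof.
move=> FF Fc.
have H k : exists x : D, F (ball (hcls x) ((2^-1 ^+ k.+2 : R)%:C)).
  have /cauchyP/(_ ((2^-1 ^+ k.+2 : R)%:C)) := Fc.
  case=> [|x Fx]; first by rewrite ltcR exprn_gt0 ?invr_gt0 ?ltr0n.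
  by exists (hrep x); rewrite hrepK.
have [x Fx] := choice H.
have dx k : qn (x k.+1 - x k) <= 4^-1 ^+ k.
  have [z [/= z1 z2]] := filter_ex (filterI (Fx k) (Fx k.+1)).
  move: z1 z2; rewrite -ball_normE /= -(hrepK z) !hnormB_sqrt !ltcR.
  set a := Num.sqrt _; set b := Num.sqrt _ => ha hb.
  have : Num.sqrt (qn (x k.+1 - x k)) <= b + a.
    rewrite -[x k.+1 - x k](subrKA (hrep z)); apply: le_trans (sqrt_qnD _ _) _.
    by rewrite lerD2l qnB.
  move=> hle.
  have hk : 0 < 2^-1 ^+ k :> R by rewrite exprn_gt0 ?invr_gt0 ?ltr0n.
  have : Num.sqrt (qn (x k.+1 - x k)) <= 2^-1 ^+ k.
    apply: le_trans hle _; move: ha hb; rewrite !exprS; lra.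
  have -> : 4^-1 ^+ k = (2^-1 ^+ k) ^+ 2 :> R.
    by rewrite -exprM mulnC exprM; congr (_ ^+ _); rewrite expr2; field.
  move=> hle2; rewrite -[leLHS]sqr_sqrtr ?qn_ge0 //.
  by rewrite lerXn2r ?nnegrE ?sqrtr_ge0 // ltW.
have [y hy] := pip_complete dx.
apply/cvg_ex; exists (hcls y).
apply/cvgrPdist_lt => e e0.
have /complex_realP[r er] : e \is Num.real by rewrite gtr0_real.
have r0 : 0 < r by move: e0; rewrite er ltcR.
have [k hk] := @exprV2_small (r / 5) (divr_gt0 r0 (ltr0Sn _ _)).
apply: filterS (Fx k) => z; rewrite -ball_normE /= -(hrepK z) !hnormB_sqrt er !ltcR.
set a := Num.sqrt _ => ha.
have hy2 : Num.sqrt (qn (y - x k)) <= 4 * 2^-1 ^+ k.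
  have p0 : 0 <= 4 * 2^-1 ^+ k :> R by rewrite mulr_ge0 ?exprn_ge0 ?invr_ge0 ?ler0n.
  rewrite -[leRHS]ger0_norm // -sqrtr_sqr ler_wsqrtr //.
  apply: le_trans (hy k) _; rewrite exprMn -exprM [(k * 2)%N]mulnC exprM.
  have -> : 4 ^+ 2 = 16 :> R by ring.
  by have -> : 2^-1 ^+ 2 = 4^-1 :> R by field.
apply: le_lt_trans (_ : 4 * 2^-1 ^+ k + a < _).
  rewrite -[y - _](subrKA (x k)); apply: le_trans (sqrt_qnD _ _) _.
  by rewrite lerD2r.
have : 0 < 2^-1 ^+ k :> R by rewrite exprn_gt0 ?invr_gt0 ?ltr0n.
move: ha hk; rewrite !exprS; lra.
Qed.

HB.instance Definition _ := Uniform_isComplete.Build (hil D) hil_complete.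

Lemma hip_bilinear :
  bilinear_for (GRing.Scale.Law.clone _ _ *%R _)
    (GRing.Scale.Law.clone _ _ (Num.conj \; *%R) _) (@hip R D).
Proof.
split=> [u' a x y|u a x y] /=; first by rewrite hip_lin.
by rewrite hip_conj hip_lin rmorphD rmorphM /= -!hip_conj.
Qed.

HB.instance Definition _ :=
  bilinear_isBilinear.Build _ _ _ _ _ _ (@hip R D) hip_bilinear.

Lemma hip_herm (x y : hil D) : hip x y = (-1) ^+ false * Num.conj (hip y x).
Proof. by rewrite mul1r hip_conj. Qed.

HB.instance Definition _ :=
  isHermitianSesquilinear.Build _ _ _ _ (@hip R D) hip_herm.

Lemma hip_norm (x : hil D) : hip x x = `|x| ^+ 2.
Proof.
rewrite /hip pip_qn -[ `|x| ]/(hnorm x) /hnorm -rmorphXn /= sqr_sqrtr //.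
exact: qn_ge0.
Qed.

Lemma hip_dot (x : hil D) : x != 0 -> 0 < hip x x.
Proof. by move=> x0; rewrite hip_norm exprn_gt0 // normr_gt0. Qed.

HB.instance Definition _ := isDotProduct.Build _ _ (@hip R D) hip_dot.

Definition hdot : {dot hil D for Num.conj} := @hip R D.
Definition hspace : completeNormedModType R[i] := hil D.

End Complete.

(** * Unitary representations up to null vectors *)

(** The group law is required up to null vectors only, since representations of
    a quotient group will be obtained through a section of the quotient map. *)
Record urep_mod_null (R : realType) (G : groupType) (D : prehil R) := URep {
  uact :> G -> D -> D;
  uact_lin : forall g a u v, uact g (a *: u + v) = a *: uact g u + uact g v;
  uact_ip : forall g u v, pip (uact g u) (uact g v) = pip u v;
  uactM : forall g h v, qn (uact (g * h)%g v - uact g (uact h v)) = 0;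
  uact1 : forall v, qn (uact 1%g v - v) = 0 }.

Section Representation.
Variables (R : realType) (G : groupType) (D : prehil R).
Variable (act : urep_mod_null G D).

Lemma uactB g u v : act g (u - v) = act g u - act g v.
Proof. by rewrite addrC -scaleN1r uact_lin scaleN1r addrC. Qed.

Lemma qn_uact g u : qn (act g u) = qn u.
Proof. by rewrite /qn uact_ip. Qed.

Definition hact g (x : hspace D) : hspace D := hcls (act g (hrep x)).

Lemma hactE g u : hact g (hcls u) = hcls (act g u).
Proof. by apply/hclsP; rewrite -uactB qn_uact hrepP. Qed.

Lemma hact_linear g : linear (hact g).
Proof.
move=> a x y; rewrite -(hrepK x) -(hrepK y) -hclsZ -hclsD !hactE.
by rewrite uact_lin hclsD hclsZ.
Qed.

HB.instance Definition _ g := GRing.isLinear.Build _ _ _ _ (hact g) (hact_linear g).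

Definition hrho g : {linear hspace D -> hspace D} := hact g.

Lemma hrho_unitary : unitary_representation (hdot D) hrho.
Proof.
split=> [v|g h v|g u v].
- by rewrite -(hrepK v) /= hactE; apply/hclsP; exact: uact1.
- by rewrite -(hrepK v) /= !hactE; apply/hclsP; exact: uactM.
- by rewrite -(hrepK v) -(hrepK u) /= !hactE /= !hipE uact_ip.
Qed.

End Representation.

(** Dividing out the null vectors gives a unitary representation without nonzero
    invariant vectors, so no nonzero vector is almost invariant. *)
Lemma property_T_gap (R : realType) (G : groupType) :
  property_T R G -> exists (K : {fset G}) (eps : R), 0 < eps /\
  forall (D : prehil R) (act : urep_mod_null G D),
    (forall v, (forall g, qn (act g v - v) = 0) -> qn v = 0) ->
    forall v, qn v = 0 \/
      exists2 g, g \in K & eps ^+ 2 * qn v <= qn (act g v - v).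
Proof.
move=> [K [eps [eps0 HT]]]; exists K, eps; split=> // D act noinv v.
have [|nex] := pselect (exists2 g, g \in K & eps ^+ 2 * qn v <= qn (act g v - v)).
  by right.
left; apply: contrapT => v0.
have {}v0 : qn v != 0 by apply/eqP.
have qv0 : 0 < qn v by rewrite lt_neqAle eq_sym v0 qn_ge0.
have [|w [w0 winv]] := HT (hspace D) (hdot D) (hrho act) (@hip_norm R D) (hrho_unitary act).
- exists (hcls v); split.
    by apply: contra v0 => /eqP /hclsP; rewrite subr0 => ->.
  move=> g gK; rewrite /= hactE hnormB_sqrt.
  rewrite -[ `|hcls v| ]/(hnorm (hcls v)) hnormE -rmorphM /= ltcR.
  have : qn (act g v - v) < eps ^+ 2 * qn v.
    by rewrite ltNge; apply/negP => h; apply: nex; exists g.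
  have -> : eps * Num.sqrt (qn v) = Num.sqrt (eps ^+ 2 * qn v).
    by rewrite sqrtrM ?sqr_ge0 // sqrtr_sqr ger0_norm // ltW.
  by move=> h; rewrite ltr_sqrt // mulr_gt0 ?exprn_gt0.
- move/eqP: w0; apply; rewrite -(hrepK w); apply/hclsP; rewrite subr0.
  apply: noinv => g; apply/hclsP.
  by rewrite -hactE hrepK; exact: winv.
Qed.

(** * Orthogonal projections *)

(** Closed for the seminorm; in particular a union of classes modulo null
    vectors. *)
Record closed_sub (R : realType) (D : prehil R) := ClosedSub {
  csub :> D -> Prop;
  csub0 : csub 0;
  csub_lin : forall a u v, csub u -> csub v -> csub (a *: u + v);
  csub_closed : forall v,
    (forall e, 0 < e -> exists2 w, csub w & qn (v - w) <= e) -> csub v }.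

Section Projection.
Variables (R : realType) (D : prehil R).
Implicit Types (u v w : D).

(** First variation along the multiples of [u], real and imaginary. *)
Lemma pip_min_eq0 u v :
  (forall a, qn v <= qn (v - a *: u)) -> pip v u = 0.
Proof.
have H w : (forall a, qn v <= qn (v - a *: w)) -> complex.Re (pip v w) = 0.
  set r := complex.Re _; set q := qn w => hw.
  have q0 : 0 <= q by exact: qn_ge0.
  have q1 : 0 < q + 1 by lra.
  have := hw ((r / (q + 1))%:C); rewrite qnBE qnZr pipZr.
  have -> : complex.Re (conjc (r / (q + 1))%:C * pip v w) = r / (q + 1) * r.
    by rewrite /r; case: (pip v w) => x y /=; rewrite oppr0 mul0r subr0.
  rewrite -/q => h.
  have h2 : 0 <= - ((r / (q + 1)) ^+ 2 * (q + 2)).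
    have -> : - ((r / (q + 1)) ^+ 2 * (q + 2)) =
      (r / (q + 1)) ^+ 2 * q - 2 * (r / (q + 1) * r).
      by field; rewrite gt_eqF.
    by move: h; lra.
  have {h2} : (r / (q + 1)) ^+ 2 <= 0.
    by move: h2; rewrite oppr_ge0 pmulr_lle0 //; lra.
  move=> h2; have : (r / (q + 1)) ^+ 2 == 0 by rewrite eq_le h2 sqr_ge0.
  rewrite sqrf_eq0 mulf_eq0 invr_eq0 (gt_eqF q1) orbF => /eqP //.
move=> hu; have H1 := H u hu.
have H2 : complex.Re (pip v ('i *: u)) = 0 by apply: H => a; rewrite scalerA; exact: hu.
move: H1 H2; rewrite pipZr; case: (pip v u) => x y /= ->.
rewrite !mul0r sub0r mulN1r opprK => ->. done.
Qed.

Lemma pow16_small (e : R) : 0 < e -> exists k, 16 * 4^-1 ^+ k <= e.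
Proof.
move=> e_gt0.
have m0 : 0 < Num.min e 1 / 16 by rewrite divr_gt0 // lt_min e_gt0 ltr01.
have [k hk] := exprV2_small m0; exists k.
have -> : 4^-1 ^+ k = (2^-1 ^+ k) ^+ 2 :> R.
  by rewrite -exprM mulnC exprM; congr (_ ^+ _); rewrite expr2; field.
have p0 : 0 < 2^-1 ^+ k :> R by rewrite exprn_gt0 ?invr_gt0.
have h1 : 16 * 2^-1 ^+ k < e.
  rewrite mulrC -ltr_pdivlMr //; apply: lt_le_trans hk _.
  by rewrite ler_pM2r ?invr_gt0 // ge_min lexx.
have h2 : 2^-1 ^+ k <= 1 :> R.
  by rewrite exprn_ile1 // ?invr_ge0 // invf_le1 // ler1n.
rewrite expr2; nra.
Qed.

Lemma csub_lim (W : closed_sub D) (x : nat -> D) y :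
  (forall k, W (x k)) -> (forall k, qn (y - x k) <= 16 * 4^-1 ^+ k) -> W y.
Proof.
move=> Wx hy; apply: csub_closed => e /pow16_small[k hk]; exists (x k) => //.
exact: le_trans (hy k) hk.
Qed.

(** By the parallelogram law, a sequence that minimizes the distance to [v]
    converges rapidly; its limit is the nearest point. *)
Lemma projection_exists (W : closed_sub D) v :
  exists2 w, W w & forall u, W u -> pip (v - w) u = 0.
Proof.
pose A := [set qn (v - w) | w in [set w | W w]].
have A0 : has_inf A.
  split; first by exists (qn (v - 0)), 0 => //; exact: csub0.
  by exists 0 => _ [w _ <-]; exact: qn_ge0.
pose d := inf A.
have dle w : W w -> d <= qn (v - w).
  by move=> Ww; apply: ge_inf; [exact: A0.2 | exists w].
have e0 k : 0 < 4^-1 ^+ k / 4 :> R by rewrite divr_gt0 ?exprn_gt0 ?invr_gt0.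
have H k : exists w, W w /\ qn (v - w) <= d + 4^-1 ^+ k / 4.
  have [_ [w Ww <-] h] := inf_adherent (e0 k) A0.
  by exists w; split=> //; exact: ltW.
have [x Hx] := choice H.
have W2 (a b : D) : W a -> W b -> W (2^-1%:C *: (a + b)).
  move=> Wa Wb; rewrite -[_ *: _]addr0; apply: csub_lin; last exact: csub0.
  by rewrite -[a]scale1r; apply: csub_lin.
have dx k : qn (x k.+1 - x k) <= 4^-1 ^+ k.
  have [Wk hk] := Hx k; have [Wk1 hk1] := Hx k.+1.
  have := qn_parallelogram (v - x k) (v - x k.+1).
  have -> : v - x k - (v - x k.+1) = x k.+1 - x k.
    by rewrite opprB addrC subrKA.
  have -> : v - x k + (v - x k.+1) = 2%:C *: (v - 2^-1%:C *: (x k + x k.+1)).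
    have h : (2 : R)%:C * (2^-1 : R)%:C = 1.
      by rewrite -rmorphM /= mulfV ?pnatr_eq0.
    rewrite scalerBr scalerA h scale1r.
    have -> : (2 : R)%:C = 1 + 1 by rewrite -rmorphD.
    by rewrite scalerDl scale1r addrACA opprD.
  rewrite qnZr; have := dle _ (W2 _ _ Wk Wk1); move: hk hk1 (e0 k).
  rewrite exprS; lra.
have [y hy] := pip_complete dx.
have Wy : W y by apply: csub_lim hy => k; case: (Hx k).
exists y => // u Wu; apply: pip_min_eq0 => a.
have dy : qn (v - y) <= d.
  have d0 : 0 <= d by apply: lb_le_inf => [|_ [w _ <-]]; [exact: A0.1|exact: qn_ge0].
  have hs k : Num.sqrt (qn (v - y)) <= Num.sqrt d + 5 * 2^-1 ^+ k.
    have p0 : 0 < 2^-1 ^+ k :> R by rewrite exprn_gt0 ?invr_gt0.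
    have E : 4^-1 ^+ k = (2^-1 ^+ k) ^+ 2 :> R.
      by rewrite -exprM mulnC exprM; congr (_ ^+ _); rewrite expr2; field.
    have s1 : Num.sqrt (qn (x k - y)) <= 4 * 2^-1 ^+ k.
      rewrite -[leRHS]ger0_norm ?mulr_ge0 ?(ltW p0) // -sqrtr_sqr ler_wsqrtr //.
      rewrite qnB; apply: le_trans (hy k) _; rewrite E exprMn ler_wpM2r ?sqr_ge0 //.
      by rewrite expr2 -natrM.
    have sd0 : 0 <= Num.sqrt d by exact: sqrtr_ge0.
    have s2 : Num.sqrt (qn (v - x k)) <= Num.sqrt d + 2^-1 ^+ k.
      have sp : 0 <= Num.sqrt d + 2^-1 ^+ k by rewrite addr_ge0 // ltW.
      rewrite -[leRHS]ger0_norm // -sqrtr_sqr ler_wsqrtr //.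
      have [_ h] := Hx k; apply: le_trans h _; rewrite E sqrrD sqr_sqrtr //.
      have : 0 <= Num.sqrt d * 2^-1 ^+ k by rewrite mulr_ge0 // ltW.
      have : 0 <= (2^-1 ^+ k : R) ^+ 2 by rewrite sqr_ge0.
      lra.
    rewrite -[v - y](subrKA (x k)); apply: le_trans (sqrt_qnD _ _) _; lra.
  have sle : Num.sqrt (qn (v - y)) <= Num.sqrt d.
    rewrite leNgt; apply/negP => hlt.
    have m0 : 0 < (Num.sqrt (qn (v - y)) - Num.sqrt d) / 5.
      by rewrite divr_gt0 // subr_gt0.
    have [k hk] := exprV2_small m0.
    have := hs k; move: hk; rewrite ltr_pdivlMr //; lra.
  by rewrite -(ler_sqrt _ _) // qn_ge0.
apply: le_trans dy _; have -> : v - y - a *: u = v - (a *: u + y).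
  by rewrite opprD addrAC addrA.
by apply: dle; apply: csub_lin.
Qed.

End Projection.

Section SubPrehilbert.
Variables (R : realType) (D : prehil R) (W : closed_sub D).

Definition csubb : pred D := fun v => `[< W v >].

Lemma csubb_closed : submod_closed csubb.
Proof.
split; first by apply/asboolP; exact: csub0.
by move=> a u v /asboolP Wu /asboolP Wv; apply/asboolP; exact: csub_lin.
Qed.

HB.instance Definition _ := GRing.isSubmodClosed.Build R[i] D csubb
  (GRing.submod_closed_semi csubb_closed).

Definition csub_car := {v : D | csubb v}.
HB.instance Definition _ := SubType.on csub_car.
HB.instance Definition _ := Choice.on csub_car.
HB.instance Definition _ := [SubChoice_isSubLmodule of csub_car by <:].

Definition csub_ip (u v : csub_car) := pip (val u) (val v).

Lemma csub_ip_complete (x : nat -> csub_car) :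
  (forall k, complex.Re (csub_ip (x k.+1 - x k) (x k.+1 - x k)) <= 4^-1 ^+ k) ->
  exists y, forall k, complex.Re (csub_ip (y - x k) (y - x k)) <= 16 * 4^-1 ^+ k.
Proof.
move=> hx.
have [y hy] := @pip_complete R D (fun k => val (x k)) hx.
have Wy : csubb y.
  apply/asboolP; apply: csub_lim hy => k; apply/asboolP; exact: (valP (x k)).
by exists (exist _ y Wy).
Qed.

Definition csub_prehil : prehil R := @Prehil R csub_car csub_ip
  (fun a u v w => pip_lin a (val u) (val v) (val w))
  (fun u v => pip_conj (val u) (val v))
  (fun u => pip_ge0 (val u)) csub_ip_complete.

End SubPrehilbert.

(** * Distance to the invariant vectors *)

Section Invariants.
Variables (R : realType) (G : groupType) (D : prehil R).
Variable (act : urep_mod_null G D) (P : G -> Prop).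
Implicit Types (u v w : D).

Lemma qn_le0 u : qn u <= 0 -> qn u = 0.
Proof. by move=> h; apply/eqP; rewrite eq_le h qn_ge0. Qed.

Lemma qnD_null u v : qn u = 0 -> qn v = 0 -> qn (u + v) = 0.
Proof.
by move=> u0 v0; apply/qn_le0/(le_trans (qnD_le _ _)); rewrite u0 v0 !mulr0 addr0.
Qed.

Definition invariant v := forall g, P g -> qn (act g v - v) = 0.

Lemma invariant_lin a u v : invariant u -> invariant v -> invariant (a *: u + v).
Proof.
move=> iu iv g Pg; rewrite uact_lin opprD addrACA -scalerBr.
by apply: qnD_null; rewrite ?qnZ ?iu ?iv ?mulr0.
Qed.

Lemma invariant0 : invariant 0.
Proof.
by move=> g _; rewrite -[in act g 0](subrr (0 : D)) uactB !subrr qn0.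
Qed.

Lemma invariant_closed v :
  (forall e, 0 < e -> exists2 w, invariant w & qn (v - w) <= e) -> invariant v.
Proof.
move=> h g Pg; apply/qn_le0; rewrite leNgt; apply/negP => q0.
have e0 : 0 < qn (act g v - v) / 5 by rewrite divr_gt0.
have [w iw hw] := h _ e0.
have : qn (act g v - v) <= 4 * qn (v - w).
  have -> : act g v - v = act g (v - w) + (w - v) + (act g w - w).
    by rewrite uactB addrAC !subrKA.
  rewrite qnD (pip_null _ (iw g Pg)) iw // mulr0 !addr0.
  by apply: le_trans (qnD_le _ _) _; rewrite qn_uact (qnB w); lra.
lra.
Qed.

Definition invariant_sub : closed_sub D :=
  ClosedSub invariant0 invariant_lin invariant_closed.

Definition coinvariant v := forall w, invariant w -> pip v w = 0.

Lemma coinvariant_lin a u v :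
  coinvariant u -> coinvariant v -> coinvariant (a *: u + v).
Proof. by move=> cu cv w iw; rewrite pip_lin cu // cv // mulr0 addr0. Qed.

Lemma coinvariant0 : coinvariant 0.
Proof. by move=> w _; rewrite pip0l. Qed.

Lemma coinvariant_closed v :
  (forall e, 0 < e -> exists2 w, coinvariant w & qn (v - w) <= e) -> coinvariant v.
Proof.
move=> h.
have H w : invariant w -> complex.Re (pip v w) = 0.
  move=> iw; apply/eqP; rewrite -sqrf_eq0 eq_le sqr_ge0 andbT leNgt; apply/negP => r0.
  have q1 : 0 < qn w + 1 by rewrite ltr_wpDl // qn_ge0.
  have e0 := divr_gt0 r0 q1.
  have [z cz hz] := h _ e0.
  have := pip_cs_re (v - z) w; rewrite pipDl pipNl cz // subr0.
  set r := complex.Re _ ^+ 2 in r0 e0 hz * => hr.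
  have : r <= r / (qn w + 1) * qn w.
    by apply: le_trans hr _; rewrite ler_wpM2r // qn_ge0.
  rewrite mulrAC ler_pdivlMr //; have := qn_ge0 w; nra.
move=> w iw; have H1 := H w iw.
have iiw : invariant ('i *: w).
  by rewrite -['i *: w]addr0; apply: invariant_lin => //; exact: invariant0.
move: H1 (H _ iiw); rewrite pipZr; case: (pip v w) => x y /= ->.
by rewrite !mul0r sub0r mulN1r opprK => ->.
Qed.

Definition coinvariant_sub : closed_sub D :=
  ClosedSub coinvariant0 coinvariant_lin coinvariant_closed.

End Invariants.

Section CoinvariantRep.
Variables (R : realType) (G : groupType) (D : prehil R).
Variable (act : urep_mod_null G D).
Local Notation coinv := (coinvariant act setT).

Lemma coinvariant_act g v : coinv v -> coinv (act g v).
Proof.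
move=> cv w iw.
have -> : pip (act g v) w = pip (act g v) (act g w).
  by rewrite -[in RHS](subrK w (act g w)) pipDr (pip_null _ (iw g I)) add0r.
by rewrite uact_ip cv.
Qed.

Local Notation D1 := (csub_prehil (coinvariant_sub act setT)).

Lemma coact_subproof g (v : D1) : csubb (coinvariant_sub act setT) (act g (val v)).
Proof.
by apply/asboolP/coinvariant_act; have /asboolP := valP v.
Qed.

Definition coact g (v : D1) : D1 :=
  exist (csubb (coinvariant_sub act setT)) _ (coact_subproof g v).

Lemma coact_lin g a (u v : D1) : coact g (a *: u + v) = a *: coact g u + coact g v.
Proof. by apply/val_inj => /=; rewrite uact_lin. Qed.

Definition coinvariant_rep : urep_mod_null G D1 :=
  @URep R G D1 coact coact_lin
   (fun g (u v : D1) => uact_ip act g (val u) (val v))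
   (fun g h (v : D1) => uactM act g h (val v))
   (fun v : D1 => uact1 act (val v)).

End CoinvariantRep.

Lemma qn_csub (R : realType) (D : prehil R) (W : closed_sub D) (u : csub_prehil W) :
  qn u = qn (val u).
Proof. by []. Qed.

(** The orthogonal complement of the invariant vectors has no invariant
    vectors, so the gap applies to the component of [v] in it; that component
    is displaced by the group exactly as much as [v]. *)
Lemma property_T_projection (R : realType) (G : groupType) :
  property_T R G -> exists (K : {fset G}) (eps : R), 0 < eps /\
  forall (D : prehil R) (act : urep_mod_null G D) v,
    exists2 w, invariant act setT w &
      eps ^+ 2 * qn (v - w) <= \sum_(g <- K) qn (act g v - v).
Proof.
move=> /property_T_gap[K [eps [eps0 H]]]; exists K, eps; split=> // D act v.
have [w iw hw] := projection_exists (invariant_sub act setT) v.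
exists w => //.
have sum0 (r : seq G) : 0 <= \sum_(g <- r) qn (act g v - v).
  by elim/big_rec: _ => // g x _ x0; rewrite addr_ge0 // qn_ge0.
have cvw : csubb (coinvariant_sub act setT) (v - w) by apply/asboolP => u /hw.
have [||] := H _ (coinvariant_rep act) _ (exist (csubb (coinvariant_sub act setT)) _ cvw).
- move=> [u cu] iu; have /asboolP cu' := cu.
  by rewrite qn_csub /qn /= (cu' u (fun g _ => iu g)).
- by rewrite qn_csub /= => ->; rewrite mulr0.
move=> [g gK]; rewrite !qn_csub /= => h.
apply: le_trans h _.
have -> : act g (v - w) - (v - w) = (act g v - v) - (act g w - w).
  by rewrite uactB !opprD !opprK addrACA.
rewrite qnBE (pip_null _ (iw g I)) iw // mulr0 subr0 addr0.
by rewrite (big_rem g) //= lerDl.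
Qed.

(** * Ultraproducts of weighted sequence spaces *)

Section UltraLimit.
Variables (R : realType) (U : set_system nat) (FU : UltraFilter U).
Implicit Types (f g : nat -> R).

Definition bounded_seq f := exists M, forall n, `|f n| <= M.
Definition ulim f : R := lim (f @ U).

Lemma ulim_cvg f : bounded_seq f -> f @ U --> ulim f.
Proof.
move=> [M hM]; apply: (@cvg_bounded_ultra R U FU f (- M) M) => n.
by rewrite -ler_norml.
Qed.

Lemma bounded_seqD f g :
  bounded_seq f -> bounded_seq g -> bounded_seq (fun n => f n + g n).
Proof.
move=> [M hM] [N hN]; exists (M + N) => n.
by apply: le_trans (ler_normD _ _) _; exact: lerD.
Qed.

Lemma bounded_seqZ a f : bounded_seq f -> bounded_seq (fun n => a * f n).
Proof.
by move=> [M hM]; exists (`|a| * M) => n; rewrite normrM ler_wpM2l.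
Qed.

Lemma ulimD f g : bounded_seq f -> bounded_seq g ->
  ulim (fun n => f n + g n) = ulim f + ulim g.
Proof. by move=> bf bg; apply/cvg_lim => //; apply: cvgD; exact: ulim_cvg. Qed.

Lemma ulimZ a f : bounded_seq f -> ulim (fun n => a * f n) = a * ulim f.
Proof. by move=> bf; apply/cvg_lim => //; apply: cvgMr; exact: ulim_cvg. Qed.

Lemma ulim_le f c : bounded_seq f -> U [set n | f n <= c] -> ulim f <= c.
Proof. by move=> /ulim_cvg bf h; apply: (cvgr_to_le bf). Qed.

Lemma ulim_ge f c : bounded_seq f -> U [set n | c <= f n] -> c <= ulim f.
Proof. by move=> /ulim_cvg bf h; apply: (cvgr_to_ge bf). Qed.

Lemma ulim_lt f c : bounded_seq f -> ulim f < c -> U [set n | f n < c].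
Proof. by move=> /ulim_cvg bf h; apply: (cvgr_lt _ bf). Qed.

End UltraLimit.

Section Sequences.
Variables (R : realType) (U : set_system nat) (FU : UltraFilter U).
Variable (Unp : forall n, ~ U [set n]).
Variables (Om : nat -> finType) (N : nat -> R).
Hypothesis N_gt0 : forall n, 0 < N n.

Local Notation T := {n : nat & Om n}.
Local Notation C := (R[i]^o).
Implicit Types (u v w : T -> C).
Local Notation re := complex.Re.
Local Notation im := complex.Im.
Local Notation pt n p := (existT (fun i => Om i : Type) n p).

(** The inner product is split into real and imaginary parts, because limits
    along the ultrafilter are taken of real sequences. *)
Definition seq_re u v n : R :=
  (\sum_(p : Om n) (re (u (pt n p)) * re (v (pt n p)) +
                    im (u (pt n p)) * im (v (pt n p)))) / N n.
Definition seq_im u v n : R :=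
  (\sum_(p : Om n) (im (u (pt n p)) * re (v (pt n p)) -
                    re (u (pt n p)) * im (v (pt n p)))) / N n.

Local Notation qs v n := (seq_re v v n).

Lemma seq_re_ge0 v n : 0 <= qs v n.
Proof.
apply: divr_ge0; last exact: ltW.
apply: sumr_ge0 => p _.
by rewrite addr_ge0 // -expr2 sqr_ge0.
Qed.

Lemma seq_re_lin (a : C) u v w n : seq_re (a *: u + v) w n =
  re a * seq_re u w n - im a * seq_im u w n + seq_re v w n.
Proof.
rewrite /seq_re /seq_im !mulrA -mulrBl -mulrDl; congr (_ / _).
rewrite !mulr_sumr -sumrB -big_split; apply: eq_bigr => p _ /=.
rewrite -[(a *: u + v) _]/(a * u (pt n p) + v (pt n p)).
case: a (u _) (v _) (w _) => [a b] [c d] [e f] [g h] /=; ring.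
Qed.

Lemma seq_im_lin (a : C) u v w n : seq_im (a *: u + v) w n =
  re a * seq_im u w n + im a * seq_re u w n + seq_im v w n.
Proof.
rewrite /seq_re /seq_im !mulrA -!mulrDl; congr (_ / _).
rewrite !mulr_sumr -!big_split; apply: eq_bigr => p _ /=.
rewrite -[(a *: u + v) _]/(a * u (pt n p) + v (pt n p)).
case: a (u _) (v _) (w _) => [a b] [c d] [e f] [g h] /=; ring.
Qed.

Lemma seq_reC u v n : seq_re v u n = seq_re u v n.
Proof. by congr (_ / _); apply: eq_bigr => p _; ring. Qed.

Lemma seq_imC u v n : seq_im v u n = - seq_im u v n.
Proof.
by rewrite /seq_im -mulNr -sumrN; congr (_ / _); apply: eq_bigr => p _; ring.
Qed.

Lemma seq_re_bound u v n : `|seq_re u v n| <= qs u n + qs v n.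
Proof.
rewrite /seq_re normrM (ger0_norm (_ : 0 <= (N n)^-1)); last by rewrite invr_ge0 ltW.
rewrite -mulrDl ler_wpM2r ?invr_ge0 ?(ltW (N_gt0 _)) //.
rewrite -big_split /=; apply: le_trans (ler_norm_sum _ _ _) _; apply: ler_sum => p _.
case: (u _) (v _) => [a b] [c d] /=; rewrite ler_norml.
have := sqr_ge0 (a + c); have := sqr_ge0 (a - c); have := sqr_ge0 (b + d).
have := sqr_ge0 (b - d); have := sqr_ge0 a; have := sqr_ge0 b.
have := sqr_ge0 c; have := sqr_ge0 d; rewrite !expr2 => *.
by apply/andP; split; lra.
Qed.

Lemma seq_im_bound u v n : `|seq_im u v n| <= qs u n + qs v n.
Proof.
rewrite /seq_re /seq_im normrM (ger0_norm (_ : 0 <= (N n)^-1)); last by rewrite invr_ge0 ltW.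
rewrite -mulrDl ler_wpM2r ?invr_ge0 ?(ltW (N_gt0 _)) //.
rewrite -big_split /=; apply: le_trans (ler_norm_sum _ _ _) _; apply: ler_sum => p _.
case: (u _) (v _) => [a b] [c d] /=; rewrite ler_norml.
have := sqr_ge0 (a + d); have := sqr_ge0 (a - d); have := sqr_ge0 (b + c).
have := sqr_ge0 (b - c); have := sqr_ge0 a; have := sqr_ge0 b.
have := sqr_ge0 c; have := sqr_ge0 d; rewrite !expr2 => *.
by apply/andP; split; lra.
Qed.

Lemma seq_reD_le u v n : qs (u + v) n <= 2 * qs u n + 2 * qs v n.
Proof.
rewrite /seq_re !mulrA -mulrDl ler_wpM2r ?invr_ge0 ?(ltW (N_gt0 _)) //.
rewrite !mulr_sumr -big_split /=; apply: ler_sum => p _.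
rewrite -[(u + v) _]/(u (pt n p) + v (pt n p)).
case: (u _) (v _) => [a b] [c d] /=.
have := sqr_ge0 (a - c); have := sqr_ge0 (b - d); rewrite !expr2; lra.
Qed.

Lemma seq_reZ (a : C) u n : qs (a *: u) n = (re a ^+ 2 + im a ^+ 2) * qs u n.
Proof.
rewrite /seq_re !mulrA; congr (_ / _).
rewrite !mulr_sumr; apply: eq_bigr => p _ /=.
rewrite -[(a *: u) _]/(a * u (pt n p)).
case: a (u _) => [a b] [c d] /=; ring.
Qed.

Definition bounded_vec : pred (T -> C) := fun v => `[< bounded_seq (fun n => qs v n) >].

Lemma bounded_vec_closed : submod_closed bounded_vec.
Proof.
split.
  apply/asboolP; exists 0 => n; rewrite /seq_re big1 ?mul0r ?normr0 // => p _ /=.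
  by rewrite !mulr0 addr0.
move=> a u v /asboolP[M hM] /asboolP[M' hM']; apply/asboolP.
exists (2 * ((re a ^+ 2 + im a ^+ 2) * M) + 2 * M') => n.
rewrite ger0_norm ?seq_re_ge0 //; apply: le_trans (seq_reD_le _ _ _) _.
rewrite seq_reZ.
have := hM n; have := hM' n; rewrite !ger0_norm ?seq_re_ge0 // => h1 h2.
apply: lerD; rewrite ler_wpM2l // ler_wpM2l // addr_ge0 // sqr_ge0 //.
Qed.

HB.instance Definition _ := GRing.isSubmodClosed.Build R[i] (T -> C) bounded_vec
  (GRing.submod_closed_semi bounded_vec_closed).

Definition bvec := {v : T -> C | bounded_vec v}.
HB.instance Definition _ := SubType.on bvec.
HB.instance Definition _ := Choice.on bvec.
HB.instance Definition _ := [SubChoice_isSubLmodule of bvec by <:].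

Lemma bvec_re (u v : bvec) : bounded_seq (fun n => seq_re (val u) (val v) n).
Proof.
have /asboolP[M hM] := valP u; have /asboolP[M' hM'] := valP v.
exists (M + M') => n; apply: le_trans (seq_re_bound _ _ _) _.
by apply: lerD; apply: le_trans (ler_norm _) _.
Qed.

Lemma bvec_im (u v : bvec) : bounded_seq (fun n => seq_im (val u) (val v) n).
Proof.
have /asboolP[M hM] := valP u; have /asboolP[M' hM'] := valP v.
exists (M + M') => n; apply: le_trans (seq_im_bound _ _ _) _.
by apply: lerD; apply: le_trans (ler_norm _) _.
Qed.

Definition bvec_ip (u v : bvec) : R[i] :=
  Complex (ulim U (fun n => seq_re (val u) (val v) n))
          (ulim U (fun n => seq_im (val u) (val v) n)).

Lemma bvec_lin (a : R[i]) (u v w : bvec) :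
  bvec_ip (a *: u + v) w = a * bvec_ip u w + bvec_ip v w.
Proof.
rewrite /bvec_ip; set f1 := seq_re (val u) _; set f2 := seq_im (val u) _.
set f3 := seq_re (val v) _; set f4 := seq_im (val v) _.
have b1 : bounded_seq f1 by exact: bvec_re.
have b2 : bounded_seq f2 by exact: bvec_im.
have b3 : bounded_seq f3 by exact: bvec_re.
have b4 : bounded_seq f4 by exact: bvec_im.
have bZ := bounded_seqZ; have bD := bounded_seqD.
have -> : seq_re (val (a *: u + v)) (val w) =
    (fun n => (re a * f1 n + (- im a) * f2 n) + f3 n).
  by apply/funext => n; rewrite /= seq_re_lin mulNr.
have -> : seq_im (val (a *: u + v)) (val w) =
    (fun n => (re a * f2 n + im a * f1 n) + f4 n).
  by apply/funext => n; rewrite /= seq_im_lin.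
rewrite !ulimD ?ulimZ //; try by [|apply: bZ|apply: bD; apply: bZ].
by case: a => a b /=; rewrite mulNr.
Qed.

Lemma bvec_conj (u v : bvec) : bvec_ip v u = conjc (bvec_ip u v).
Proof.
rewrite /bvec_ip /=; congr Complex.
  by congr ulim; apply/funext => n; exact: seq_reC.
rewrite -mulN1r -ulimZ; last exact: bvec_im.
by congr ulim; apply/funext => n; rewrite seq_imC mulN1r.
Qed.

Lemma bvec_ge0 (u : bvec) : 0 <= bvec_ip u u.
Proof.
rewrite lecE /= eq_sym; apply/andP; split; last first.
  by apply: ulim_ge; [exact: bvec_re|apply: filterS filterT => n _; exact: seq_re_ge0].
have -> : seq_im (val u) (val u) = (fun n => 0 * 0).
  apply/funext => n; rewrite mul0r /seq_im big1 ?mul0r // => p _.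
  by rewrite mulrC subrr.
by rewrite ulimZ ?mul0r //; exists 0 => n; rewrite normr0.
Qed.

Lemma re_bvec_ip (u : bvec) : complex.Re (bvec_ip u u) = ulim U (fun n => qs (val u) n).
Proof. by []. Qed.

Lemma qs_telescope (x : nat -> bvec) n k m :
  (k <= m)%N ->
  (forall j, (k <= j < m)%N -> qs (val (x j.+1 - x j)) n <= 2 * 4^-1 ^+ j) ->
  qs (val (x m - x k)) n <= 8 * 4^-1 ^+ k.
Proof.
move=> /subnK <-; move: (m - k)%N => d; elim: d k => [|d IH] k h.
  rewrite add0n subrr /= /seq_re big1 ?mul0r ?mulr_ge0 ?exprn_ge0 ?invr_ge0 // => p _ /=.
  by rewrite !mulr0 addr0.
have := IH k.+1; rewrite addnS => {}IH.
have -> : x (d.+1 + k)%N - x k = (x (d + k).+1 - x k.+1) + (x k.+1 - x k).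
  by rewrite addSn subrKA.
apply: le_trans (seq_reD_le _ _ _) _.
have h1 := h k; rewrite leqnn /= addSn ltnS leq_addl in h1.
have {}h1 := h1 isT.
have {IH} h2 : qs (val (x (d + k).+1 - x k.+1)) n <= 8 * 4^-1 ^+ k.+1.
  by apply: IH => j /andP[kj jd]; apply: h; rewrite addSn jd andbT ltnW.
move: h2; rewrite exprS; lra.
Qed.

(** At the index [n] the limit takes its values from [x k], for the largest [k]
    up to [n] such that the first [k] differences are small at [n]. This [k]
    tends to infinity along the ultrafilter. *)
Lemma bvec_complete (x : nat -> bvec) :
  (forall k, complex.Re (bvec_ip (x k.+1 - x k) (x k.+1 - x k)) <= 4^-1 ^+ k) ->
  exists y, forall k, complex.Re (bvec_ip (y - x k) (y - x k)) <= 16 * 4^-1 ^+ k.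
Proof.
move=> hx.
pose good k n := (k <= n)%N /\
  forall j, (j < k)%N -> qs (val (x j.+1 - x j)) n <= 2 * 4^-1 ^+ j.
have goodU k : U [set n | good k n].
  elim: k => [|k IH].
    by apply: filterS filterT => n _; split.
  have p0 : 0 < 4^-1 ^+ k :> R by rewrite exprn_gt0 ?invr_gt0.
  have h1 : U [set n | qs (val (x k.+1 - x k)) n < 2 * 4^-1 ^+ k].
    apply: ulim_lt; first exact: bvec_re.
    by apply: le_lt_trans (hx k) _; lra.
  have h2 : U (~` [set k]) by have [/Unp|] := in_ultra_setVsetC [set k] FU.
  apply: filterS (filterI h2 (filterI IH h1)) => n /= [nk [[kn h] hk]]; split.
    by rewrite ltn_neqAle kn andbT; apply/eqP => kn'; apply: nk.
  move=> j; rewrite ltnS leq_eqVlt => /orP[/eqP -> |]; last exact: h.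
  exact: ltW.
have ex0 n : exists k, `[< good k n >] by exists 0%N; apply/asboolP; split.
have exb n : forall k, `[< good k n >] -> (k <= n)%N by move=> k /asboolP[].
pose kk n := ex_maxn (ex0 n) (exb n).
have kkgood n : good (kk n) n.
  by rewrite /kk; case: ex_maxnP => k /asboolP.
have kkmax n k : good k n -> (k <= kk n)%N.
  by rewrite /kk; case: ex_maxnP => m _ hm gk; apply: hm; apply/asboolP.
pose y : T -> C := fun t => val (x (kk (tag t))) t.
have yE n : forall k, seq_re (y - val (x k)) (y - val (x k)) n = qs (val (x (kk n) - x k)) n.
  by move=> k; congr (_ / _); apply: eq_bigr.
have yle n k : (k <= kk n)%N -> seq_re (y - val (x k)) (y - val (x k)) n <= 8 * 4^-1 ^+ k.
  move=> hk; rewrite yE; apply: qs_telescope => // j /andP[_ jk].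
  by have [_] := kkgood n; apply.
have yb : bounded_vec y.
  apply/asboolP; have /asboolP[M hM] := valP (x 0%N).
  exists (2 * 8 + 2 * M) => n; rewrite ger0_norm ?seq_re_ge0 //.
  rewrite -[y](subrK (val (x 0%N))); apply: le_trans (seq_reD_le _ _ _) _.
  have := yle n 0%N (leq0n _); have := hM n; rewrite ger0_norm ?seq_re_ge0 //.
  by rewrite expr0; lra.
exists (exist bounded_vec _ yb) => k; rewrite re_bvec_ip.
have p0 : 0 < 4^-1 ^+ k :> R by rewrite exprn_gt0 ?invr_gt0.
apply: ulim_le; first exact: bvec_re.
apply: filterS (goodU k) => n /= /kkmax gk.
by apply: le_trans (yle n k gk) _; rewrite ler_wpM2r ?ltW // ltr_nat.
Qed.

Definition bvec_prehil : prehil R :=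
  @Prehil R bvec bvec_ip bvec_lin bvec_conj bvec_ge0 bvec_complete.

End Sequences.

(** * Representations of the free group that the relators fix *)

Lemma freegroup_ind (S : choiceType) (Q : freegroup S -> Prop) :
  Q 1%g -> (forall s u, Q u -> Q (freegen s * u)%g) ->
  (forall s u, Q u -> Q ((freegen s)^-1 * u)%g) -> forall u, Q u.
Proof.
move=> Q1 Qs Qi [w wr]; elim: w wr => [|[s b] w IH] wr.
  by have -> : FreeGroup wr = 1%g by apply/val_inj.
have wr' := path_sorted wr.
have -> : FreeGroup wr = ((if b then (freegen s)^-1 else freegen s) * FreeGroup wr')%g.
  apply/val_inj; case: b wr => /= wr; case: w wr {IH wr'} => [|y w] //= /andP[].
    by rewrite /finvw /= => /negbTE; rewrite /flip /= => ->.
  by move=> /negbTE ->.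
by case: b {wr}; [apply: Qi|apply: Qs]; exact: IH.
Qed.

Lemma mult_1g (F G : groupType) (f : {multiplicative F -> G}) : f 1%g = 1%g.
Proof. by apply: (mulgI (f 1%g)); rewrite -gmulfM !mulg1. Qed.

Lemma mult_invg (F G : groupType) (f : {multiplicative F -> G}) x :
  f x^-1%g = (f x)^-1%g.
Proof. by apply: (mulgI (f x)); rewrite -gmulfM !mulgV mult_1g. Qed.

Section Descend.
Variables (R : realType) (F G : groupType) (pi : {multiplicative F -> G}).
Variables (sec : G -> F) (secK : cancel sec pi).
Variables (D : prehil R) (act : urep_mod_null F D).
Local Open Scope group_scope.
Local Open Scope ring_scope.

Definition in_ker (w : F) : Prop := pi w = 1%g.

Local Notation kinv := (invariant act in_ker).
Local Notation E := (csub_prehil (invariant_sub act in_ker)).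

Lemma uact_eq0 u v : qn v = 0 -> qn (act u v) = 0.
Proof. by rewrite qn_uact. Qed.

Lemma uact_ker u k v : kinv v -> in_ker k -> qn (act (u * k)%g v - act u v) = 0.
Proof.
move=> kv kk; rewrite -(subrKA (act u (act k v))); apply: qnD_null.
  exact: uactM.
by rewrite -uactB uact_eq0 // kv.
Qed.

Lemma uact_same u u' v : kinv v -> pi u = pi u' -> qn (act u v - act u' v) = 0.
Proof.
move=> kv e; have -> : u = (u' * (u'^-1 * u))%g by rewrite mulKVg.
by apply: uact_ker => //; rewrite /in_ker gmulfM mult_invg e mulVg.
Qed.

Lemma kinv_act u v : kinv v -> kinv (act u v).
Proof.
move=> kv w kw; rewrite -(subrKA (act (w * u)%g v)); apply: qnD_null.
  by rewrite qnB uactM.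
by apply: uact_same => //; rewrite gmulfM kw mul1g.
Qed.

Lemma kact_subproof u (v : E) : csubb (invariant_sub act in_ker) (act u (val v)).
Proof. by apply/asboolP/kinv_act; have /asboolP := valP v. Qed.

(** The group [G] acts on the vectors fixed by the kernel, through a section;
    different lifts of an element act in the same way up to null vectors. *)
Definition kact (g : G) (v : E) : E :=
  exist (csubb (invariant_sub act in_ker)) _ (kact_subproof (sec g) v).

Lemma kact_lin g a (u v : E) : kact g (a *: u + v) = a *: kact g u + kact g v.
Proof. by apply/val_inj => /=; rewrite uact_lin. Qed.

Lemma kactM g h (v : E) : qn (kact (g * h)%g v - kact g (kact h v)) = 0.
Proof.
have /asboolP kv := valP v; rewrite qn_csub /=.
rewrite -(subrKA (act (sec g * sec h)%g (val v))); apply: qnD_null; last exact: uactM.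
by apply: uact_same => //; rewrite gmulfM !secK.
Qed.

Lemma kact1 (v : E) : qn (kact 1%g v - v) = 0.
Proof.
have /asboolP kv := valP v; rewrite qn_csub /=.
rewrite -(subrKA (act 1%g (val v))); apply: qnD_null; last exact: uact1.
by apply: uact_same => //; rewrite secK mult_1g.
Qed.

Definition krep : urep_mod_null G E :=
  @URep R G E kact kact_lin
   (fun g (u v : E) => uact_ip act (sec g) (val u) (val v)) kactM kact1.

End Descend.

(** The projection theorem for [G], applied to the vectors that the kernel
    fixes. *)
Lemma property_T_cover (R : realType) (F G : groupType)
    (pi : {multiplicative F -> G}) (sec : G -> F) :
  cancel sec pi -> property_T R G ->
  exists (K : seq F) (eps : R), 0 < eps /\
  forall (D : prehil R) (act : urep_mod_null F D) v,
    invariant act (in_ker pi) v ->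
    exists2 w, invariant act setT w &
      eps ^+ 2 * qn (v - w) <= \sum_(u <- K) qn (act u v - v).
Proof.
move=> secK /property_T_projection[K [eps [eps0 H]]].
exists [seq sec g | g <- K], eps; split=> // D act v kv.
have kvb : csubb (invariant_sub act (in_ker pi)) v by apply/asboolP.
have [w iw hw] := H _ (krep secK act) (exist (csubb (invariant_sub act (in_ker pi))) _ kvb).
exists (val w); last by rewrite big_map.
move=> u _; have /asboolP kw := valP w.
rewrite -(subrKA (act (sec (pi u)) (val w))); apply: qnD_null; last exact: iw.
by apply: (@uact_same _ _ _ pi) => //; rewrite secK.
Qed.

Lemma uact_inv_disp (R : realType) (F : groupType) (D : prehil R)
    (act : urep_mod_null F D) x v : qn (act x^-1%g v - v) = qn (act x v - v).
Proof.
have n0 : qn (act x (act x^-1%g v) - v) = 0.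
  rewrite -(subrKA (act 1%g v)); apply: qnD_null; last exact: uact1.
  by rewrite qnB -(mulgV x) uactM.
rewrite -(qn_uact act x) uactB -(subrKA v) [X in qn X]addrC (qnD (v - _)) (pip_null _ n0) n0.
by rewrite mulr0 !addr0 qnB.
Qed.

(** Displacements add up along a word, so the constant depends on the word
    only. *)
Lemma uact_word (R : realType) (S : finType) (u : freegroup S) :
  exists2 c : R, 0 <= c & forall (D : prehil R) (act : urep_mod_null (freegroup S) D) v,
    qn (act u v - v) <= c * \sum_(s : S) qn (act (freegen s) v - v).
Proof.
pose disp D (act : urep_mod_null (freegroup S) D) v : R :=
  \sum_(s : S) qn (act (freegen s) v - v).
have sum_ge D (act : urep_mod_null (freegroup S) D) v s :
    qn (act (freegen s) v - v) <= disp D act v.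
  by rewrite /disp (bigD1 s) //= lerDl sumr_ge0 // => *; exact: qn_ge0.
have step D (act : urep_mod_null (freegroup S) D) (x u' : freegroup S) (c : R) v :
    0 <= c -> qn (act x v - v) <= disp D act v ->
    qn (act u' v - v) <= c * disp D act v ->
    qn (act (x * u')%g v - v) <= (2 * c + 2) * disp D act v.
  move=> c0 hx hu.
  have -> : act (x * u')%g v - v =
     (act x (act u' v - v) + (act x v - v)) + (act (x * u')%g v - act x (act u' v)).
    by rewrite uactB [RHS]addrC subrKA subrKA.
  rewrite qnD (pip_null _ (uactM _ _ _ _)) uactM mulr0 !addr0.
  by apply: le_trans (qnD_le _ _) _; rewrite qn_uact; lra.
elim/freegroup_ind: u => [|s u [c c0 IH]|s u [c c0 IH]].
- by exists 0 => // D act v; rewrite mul0r uact1.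
- by exists (2 * c + 2) => [|D act v]; [lra|exact: step].
- exists (2 * c + 2) => [|D act v]; [lra|apply: step => //].
  by rewrite uact_inv_disp; exact: sum_ge.
Qed.

(** The finite set of property (T) is expressed by words in the generators, at
    the cost of a constant that depends on the group only. *)
Lemma property_T_displacement (R : realType) (G : groupType) (S : finType)
    (pi : {multiplicative freegroup S -> G}) (sec : G -> freegroup S) :
  cancel sec pi -> property_T R G ->
  exists2 c : R, 0 <= c &
  forall (D : prehil R) (act : urep_mod_null (freegroup S) D) v,
    invariant act (in_ker pi) v ->
    exists2 w, invariant act setT w &
      qn (v - w) <= c * \sum_(s : S) qn (act (freegen s) v - v).
Proof.
move=> secK /(property_T_cover secK)[K [eps [eps0 H]]].
have [c c0 hc] : exists2 c : R, 0 <= c &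
    forall (D : prehil R) (act : urep_mod_null (freegroup S) D) v,
    \sum_(u <- K) qn (act u v - v) <= c * \sum_(s : S) qn (act (freegen s) v - v).
  elim: K {H} => [|u K [c c0 IH]].
    by exists 0 => // D act v; rewrite big_nil mul0r.
  have [c' c'0 hc'] := uact_word R u.
  exists (c' + c) => [|D act v]; first exact: addr_ge0.
  by rewrite big_cons mulrDl lerD.
have e2 : 0 < eps ^+ 2 by rewrite exprn_gt0.
exists (c / eps ^+ 2) => [|D act v kv]; first by rewrite divr_ge0 // ltW.
have [w iw hw] := H D act v kv; exists w => //.
by rewrite mulrAC ler_pdivlMr // mulrC (le_trans hw) // hc.
Qed.

Local Close Scope classical_set_scope.

(** * Level sets of almost invariant functions *)

Section Rounding.
Variables (R : realType) (S X : finType) (f : S -> {perm X}).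
Variables (u : X -> R) (A : {set X}) (J : nat).

Let D : R := \sum_x (u x - (x \in A)%:R) ^+ 2.
Let E : R := \sum_(s : S) \sum_x (u (f s x) - u x) ^+ 2.
Let t (j : nat) : R := 1 / 3 + j%:R / (3 * J%:R).
Let level (j : nat) : {set X} := [set x | t j < u x].

Lemma card_sumr (P : pred X) : #|[set x | P x]|%:R = \sum_x (P x)%:R :> R.
Proof.
rewrite -sum1_card natr_sum big_mkcond /=; apply: eq_bigr => x _.
by rewrite inE; case: (P x).
Qed.

(** The thresholds lie in the middle third: where [A] and the level set differ,
    [u] is at distance at least [1 / 3] from the indicator function of [A]. *)
Lemma level_symdiff (j : nat) : (j < J)%N -> #|symdiff A (level j)|%:R <= 9 * D.
Proof.
move=> jJ; rewrite card_sumr mulr_sumr; apply: ler_sum => x _.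
have J0 : 0 < J%:R :> R by rewrite ltr0n (leq_ltn_trans _ jJ).
have tj : 1 / 3 <= t j <= 2 / 3.
  rewrite /t lerDl divr_ge0 ?mulr_ge0 ?ler0n //=.
  have : j%:R / (3 * J%:R) <= 1 / 3 :> R.
    rewrite ler_pdivrMr ?mulr_gt0 //.
    have -> : 1 / 3 * (3 * J%:R) = J%:R :> R by field.
    by rewrite ler_nat ltnW.
  lra.
rewrite /level !inE; case: (x \in A) => /=.
  case: ltrP => /= h; first by rewrite mulr_ge0 // sqr_ge0.
  have : 0 <= (1 - u x - 1 / 3) * (1 - u x + 1 / 3) by rewrite mulr_ge0 //; lra.
  by rewrite expr2; lra.
rewrite eq_sym; case: ltrP => /= h; last by rewrite mulr_ge0 // sqr_ge0.
have : 0 <= (u x - 1 / 3) * (u x + 1 / 3) by rewrite mulr_ge0 //; lra.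
by rewrite expr2; lra.
Qed.

Let cross (s : S) (x : X) : nat :=
  \sum_(j < J) ((x \in level j) != (f s x \in level j)).

(** An increment shorter than the spacing of the thresholds crosses at most one
    of them, and none if it stays below [1 / 3]. *)
Lemma cross_le1 (a b : R) : a <= b -> b - a < 1 / (3 * J%:R) ->
  (\sum_(j < J) ((t j < a)%R != (t j < b)%R) <= (1 / 3 < b)%R)%N.
Proof.
move=> ab dab.
have crossE (j : 'I_J) : ((t j < a)%R != (t j < b)%R) = (a <= t j < b).
  by case: (ltrP (t j) a) => h1; case: (ltrP (t j) b) => h2 //=; move: h1 h2 ab; lra.
under eq_bigr do rewrite crossE.
have [/existsP[j0 hj0]|/existsPn none] := boolP [exists j : 'I_J, a <= t j < b];
  last by rewrite big1 // => j _; rewrite (negbTE (none j)).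
have J0 : 0 < J%:R :> R by rewrite ltr0n (leq_ltn_trans _ (ltn_ord j0)).
rewrite (bigD1 j0) //= big1 => [|j jj0].
  have -> : (1 / 3 < b)%R; last by rewrite addn0; case: (_ && _).
  move/andP: hj0 => [_]; apply: le_lt_trans.
  by rewrite /t lerDl divr_ge0 // mulr_ge0 // ltW.
apply/eqP; rewrite eqb0; apply/negP => hj.
wlog jlt : j0 j hj0 jj0 hj / (j < j0)%N.
  move=> W; have := jj0; rewrite -val_eqE neq_ltn => /orP[|] h; first exact: (W j0 j).
  by apply: (W j j0) => //; rewrite eq_sym.
have : t j0 - t j < b - a by move: hj0 hj; lra.
have : 1 / (3 * J%:R) <= t j0 - t j.
  have -> : t j0 - t j = (j0%:R - j%:R) / (3 * J%:R) by rewrite /t mulrBl; lra.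
  by rewrite ler_pM2r ?invr_gt0 ?mulr_gt0 // -natrB ?(ltnW jlt) // ler1n subn_gt0.
lra.
Qed.

(** Short increments cross at most one threshold. A long one crosses at most [J],
    but its square is at least [1 / (9 * J ^+ 2)], which accounts for the factor
    [9 * J ^+ 3]. *)
Lemma cross_le s x : (cross s x)%:R <=
  (1 / 3 < u x)%R%:R + (1 / 3 < u (f s x))%R%:R + 9 * J%:R ^+ 3 * (u (f s x) - u x) ^+ 2.
Proof.
rewrite /cross; under eq_bigr do rewrite !inE.
set b := u (f s x); set a := u x.
have n0 (c : bool) : 0 <= c%:R :> R by rewrite ler0n.
have J0 : 0 <= J%:R :> R by [].
have e0 : 0 <= 9 * J%:R ^+ 3 * (b - a) ^+ 2.
  by rewrite mulr_ge0 ?sqr_ge0 // mulr_ge0 // exprn_ge0.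
have [small|big] := ltrP `|b - a| (1 / (3 * J%:R)).
  have [ab|ba] := leP a b.
    have : ((\sum_(j < J) ((t j < a)%R != (t j < b)%R))%:R <= (1 / 3 < b)%R%:R :> R).
      by rewrite ler_nat; apply: cross_le1 => //; apply: le_lt_trans small; exact: ler_norm.
    have := n0 (1 / 3 < a); lra.
  have : ((\sum_(j < J) ((t j < b)%R != (t j < a)%R))%:R <= (1 / 3 < a)%R%:R :> R).
    rewrite ler_nat; apply: cross_le1; first exact: ltW.
    by apply: le_lt_trans small; rewrite -normrN opprB; exact: ler_norm.
  under eq_bigr do rewrite eq_sym.
  have := n0 (1 / 3 < b); lra.
have [J_0|Jpos] := posnP J.
  by rewrite /index_enum /= -/(index_enum _); move: (n0 (1/3 < a)) (n0 (1/3<b)) e0; rewrite big1 => [|[i hi]]; [lra|move: hi; rewrite J_0].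
have Jp : 0 < J%:R :> R by rewrite ltr0n.
have : (\sum_(j < J) ((t j < a)%R != (t j < b)%R))%:R <= J%:R :> R.
  rewrite ler_nat; apply: leq_trans (_ : \sum_(j < J) 1 <= _)%N.
    by apply: leq_sum => j _; exact: leq_b1.
  by rewrite sum_nat_const card_ord muln1.
have : J%:R <= 9 * J%:R ^+ 3 * (b - a) ^+ 2.
  have : (1 / (3 * J%:R)) ^+ 2 <= (b - a) ^+ 2.
    by rewrite -[leRHS]real_normK ?num_real // lerXn2r ?nnegrE ?divr_ge0 ?mulr_ge0.
  move=> h; have e : J%:R = 9 * J%:R ^+ 3 * (1 / (3 * J%:R)) ^+ 2 :> R.
    by field; rewrite gt_eqF.
  by rewrite [leLHS]e ler_wpM2l // mulr_ge0 // exprn_ge0.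
have := n0 (1 / 3 < a); have := n0 (1 / 3 < b); lra.
Qed.

(** A coarea argument: on average over [J] equally spaced thresholds the level
    sets of an almost invariant function have small boundary. *)
Lemma exists_level : (0 < J)%N -> exists A' : {set X},
  #|symdiff A A'|%:R <= 9 * D /\
  J%:R * (bd f A')%:R <= 2 * #|S|%:R * (#|A|%:R + 9 * D) + 9 * J%:R ^+ 3 * E.
Proof.
move=> J0; pose B : R := 2 * #|S|%:R * (#|A|%:R + 9 * D) + 9 * J%:R ^+ 3 * E.
have sumc : (\sum_(j < J) bd f (level j) = \sum_(s : S) \sum_x cross s x)%N.
  rewrite /bd exchange_big; apply: eq_bigr => s _ /=.
  rewrite /cross exchange_big; apply: eq_bigr => j _ /=.
  by rewrite -sum1_card big_mkcond /=; apply: eq_bigr => x _; rewrite inE; case: (_ != _).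
have low : \sum_x (1 / 3 < u x)%R%:R <= #|A|%:R + 9 * D.
  rewrite -card_sumr.
  apply: le_trans (_ : (#|A| + #|symdiff A (level 0)|)%:R <= _).
    rewrite ler_nat; apply: leq_trans (leq_card_setU _ _).
    apply/subset_leq_card/fintype.subsetP => x; rewrite !inE.
    by rewrite /t mul0r addr0; case: (x \in A) => //= ->.
  by rewrite natrD lerD2l level_symdiff.
have sumb : (\sum_(j < J) bd f (level j))%:R <= B.
  rewrite sumc natr_sum.
  apply: le_trans (_ : \sum_(s : S) (2 * (#|A|%:R + 9 * D) +
      9 * J%:R ^+ 3 * \sum_x (u (f s x) - u x) ^+ 2) <= _).
    apply: ler_sum => s _; rewrite natr_sum.
    apply: le_trans (ler_sum _ (fun x _ => cross_le s x)) _.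
    rewrite !big_split /= -mulr_sumr lerD2r.
    have -> (z : R) : 2 * z = z + z by ring.
    rewrite lerD //.
    by have := low; rewrite (reindex_inj (@perm_inj _ (f s))) /=.
  rewrite big_split /= -!mulr_sumr -/E lerD2r sumr_const.
  by rewrite -[(_ + _) *+ _]mulr_natl -[leRHS]mulrA.
apply: contrapT => hno.
have all_big (j : 'I_J) : B < J%:R * (bd f (level j))%:R.
  rewrite ltNge; apply/negP => h; apply: hno; exists (level j); split => //.
  exact: level_symdiff.
have : J%:R * B < J%:R * (\sum_(j < J) bd f (level j))%:R.
  rewrite natr_sum mulr_sumr -[J in J%:R * B](card_ord J) mulr_natl -sumr_const.
  apply: ltr_sum => //; apply/hasP; exists (Ordinal J0) => //.
by rewrite ltr_pM2l ?ltr0n // ltNge sumb.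
Qed.

End Rounding.

(** * Rigidity of almost invariant sets *)

Section PermutationRep.
Variables (R : realType) (U : set_system nat) (FU : UltraFilter U).
Variable (Unp : forall n, ~ U [set n]%classic).
Variables (Om : nat -> finType) (N : nat -> R).
Hypothesis N_gt0 : forall n, 0 < N n.
Variables (F : groupType) (b : forall n, {multiplicative F -> {perm Om n}}).

Local Notation T := {n : nat & Om n}.
Local Notation pt n p := (existT (fun i => Om i : Type) n p).
Local Notation B := (@bvec_prehil R U FU Unp Om N N_gt0).

Definition pact_fun (g : F) (v : T -> R[i]^o) : T -> R[i]^o :=
  fun t => v (pt (tag t) (b (tag t) g (tagged t))).

Lemma pact_re g u v n :
  seq_re N (pact_fun g u) (pact_fun g v) n = seq_re N u v n.
Proof. by rewrite /seq_re [in RHS](reindex_inj (@perm_inj _ (b n g))). Qed.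

Lemma pact_im g u v n :
  seq_im N (pact_fun g u) (pact_fun g v) n = seq_im N u v n.
Proof. by rewrite /seq_im [in RHS](reindex_inj (@perm_inj _ (b n g))). Qed.

Lemma pact_subproof g (v : B) : bounded_vec N (pact_fun g (val v)).
Proof.
apply/asboolP; have /asboolP[M hM] := valP v; exists M => n.
by rewrite pact_re.
Qed.

Definition pact g (v : B) : B := exist (bounded_vec N) _ (pact_subproof g v).

Lemma pact_lin g a (u v : B) : pact g (a *: u + v) = a *: pact g u + pact g v.
Proof. exact/val_inj. Qed.

Lemma pact_ip g (u v : B) : pip (pact g u) (pact g v) = pip u v.
Proof.
rewrite /= /bvec_ip /=; congr Complex; congr ulim; apply/funext => n.
  by rewrite pact_re.
by rewrite pact_im.
Qed.

Lemma pactM g h (v : B) : qn (pact (g * h)%g v - pact g (pact h v)) = 0.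
Proof.
suff -> : pact (g * h)%g v = pact g (pact h v) by rewrite subrr qn0.
by apply/val_inj/funext => t /=; rewrite /pact_fun /= gmulfM permM.
Qed.

Lemma pact1 (v : B) : qn (pact 1%g v - v) = 0.
Proof.
suff -> : pact 1%g v = v by rewrite subrr qn0.
by apply/val_inj/funext => -[n p] /=; rewrite /pact_fun /= mult_1g perm1.
Qed.

Definition perm_rep : urep_mod_null F B :=
  @URep R F B pact pact_lin pact_ip pactM pact1.

End PermutationRep.

Lemma ulim_sum (R : realType) (U : set_system nat) (FU : UltraFilter U)
    (I : Type) (r : seq I) (f : I -> nat -> R) :
  (forall i, bounded_seq (f i)) ->
  bounded_seq (fun n => \sum_(i <- r) f i n) /\
  ulim U (fun n => \sum_(i <- r) f i n) = \sum_(i <- r) ulim U (f i).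
Proof.
move=> bf; elim: r => [|i r [IHb IH]].
  have -> : (fun n => \sum_(i <- [::]) f i n) = (fun n => 0 * 0).
    by apply/funext => n; rewrite big_nil mul0r.
  have b0 : bounded_seq (fun _ : nat => 0 : R) by exists 0 => n; rewrite normr0.
  by split; [exists 0 => n; rewrite mul0r normr0 | rewrite ulimZ // big_nil mul0r].
have -> : (fun n => \sum_(j <- i :: r) f j n) =
          (fun n => f i n + \sum_(j <- r) f j n).
  by apply/funext => n; rewrite big_cons.
by split; [exact: bounded_seqD | rewrite ulimD // IH big_cons].
Qed.

Lemma ultra_ge (U : set_system nat) (FU : UltraFilter U) :
  (forall n, ~ U [set n]%classic) -> forall m, U [set n | (m <= n)%N]%classic.
Proof.
move=> Unp; elim=> [|m IH]; first exact: filterS filterT.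
have h : U (~` [set m])%classic by have [/Unp|] := in_ultra_setVsetC [set m]%classic FU.
apply: filterS (filterI IH h) => n /= [mn nm].
by rewrite ltn_neqAle mn andbT; apply/eqP => mn'; apply: nm.
Qed.

Lemma generates_section (G : groupType) (S : {fset G}) : generates S ->
  exists sec : G -> freegroup S, cancel sec (freegroup_eval val).
Proof.
move=> gen; have surj g : exists w : freegroup S, freegroup_eval val w = g.
  have : smallest (@subgroup_closed G) [set` S]%classic g by rewrite gen.
  apply: (@smallest_sub _ _ _ [set g | exists w : freegroup S, freegroup_eval val w = g]%classic).
    split=> [|_ _ [u <-] [v <-]|_ [u <-]].
    - by exists 1%g; rewrite mult_1g.
    - by exists (u * v)%g; rewrite gmulfM.
    - by exists u^-1%g; rewrite mult_invg.
  by move=> s /= sS; exists (freegen [` sS]%fset); rewrite freegroup_eval_gen.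
by have [sec h] := choice surj; exists sec.
Qed.

Lemma card_moved (X : finType) (p : {perm X}) (A : {set X}) :
  (#|[set x | (x \in A) != (p x \in A)]| <= 2 * #|[set x in A | p x != x]|)%N.
Proof.
set M := [set x in A | p x != x].
have -> : (2 * #|M| = #|M| + #|p @^-1: M|)%N.
  by rewrite (card_preimset _ (@perm_inj _ p)) mul2n addnn.
apply: leq_trans (leq_card_setU _ _).
apply/subset_leq_card/fintype.subsetP => x; rewrite !inE (inj_eq perm_inj).
case xA: (x \in A); case pA: (p x \in A) => //= _.
  by rewrite orbF; apply/eqP => px; rewrite px xA in pA.
by apply/eqP => px; rewrite px xA in pA.
Qed.

(** If this failed for some [k], then counterexamples for all [m] would form an
    ultraproduct of spaces l2(X), normalized by the size of [A], in which the
    relators fix the indicator vector exactly. That vector is close to an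
    invariant one, whose level sets are close to [A] and have small boundary. *)
Lemma set_rigidity (R : realType) (U : set_system nat) (G : groupType)
    (S : {fset G}) :
  UltraFilter U -> (forall n, ~ U [set n]%classic) ->
  property_T R G -> generates S ->
  exists C : nat, forall k : nat, exists m : nat,
  forall (X : finType) (a : {multiplicative freegroup S -> {perm X}}) (A : {set X}),
    (forall w : freegroup S, freegroup_eval val w = 1%g :> G ->
       (size (word w) <= m)%N ->
       (m * #|[set x in A | a w x != x]| <= #|A|)%N) ->
    exists A' : {set X},
      (k * #|symdiff A A'| <= k * C * bd (fun s => a (freegen s)) A + #|A|)%N /\
      (k * bd (fun s => a (freegen s)) A' <= #|A|)%N.
Proof.
move=> FU Unp HT /generates_section[sec secK].
have [c c0 Hc] := property_T_displacement secK HT.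
have [C hC] : exists C : nat, 9 * c <= C%:R.
  by exists (Num.bound (9 * c)); apply/ltW/archi_boundP; rewrite mulr_ge0.
exists C => k; apply: contrapT => hno.
pose act_on := {X : finType & ({multiplicative freegroup S -> {perm X}} * {set X})%type}.
have bad m : exists d : act_on,
    let a := (projT2 d).1 in let A := (projT2 d).2 in
    (forall w : freegroup S, freegroup_eval val w = 1%g :> G ->
       (size (word w) <= m)%N -> (m * #|[set x in A | a w x != x]| <= #|A|)%N) /\
    ~ exists A' : {set projT1 d},
      (k * #|symdiff A A'| <= k * C * bd (fun s => a (freegen s)) A + #|A|)%N /\
      (k * bd (fun s => a (freegen s)) A' <= #|A|)%N.
  apply: contrapT => h; apply: hno; exists m => X a A hA.
  by apply: contrapT => hA'; apply: h; exists (existT _ X (a, A)).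
have [d Hd] := choice bad.
pose Om n := projT1 (d n); pose a n := (projT2 (d n)).1; pose A n := (projT2 (d n)).2.
have A0 n : (0 < #|A n|)%N.
  rewrite lt0n; apply/eqP => /eqP; rewrite cards_eq0 => /eqP e.
  have [_ h] := Hd n; apply: h; exists (A n); rewrite -/(A n) e /symdiff /bd.
  rewrite eq_card0 => [|x]; last by rewrite !inE.
  by rewrite muln0 big1 ?muln0 // => s _; apply: eq_card0 => x; rewrite !inE.
pose N n : R := #|A n|%:R.
have N0 n : 0 < N n by rewrite ltr0n.
pose B := @bvec_prehil R U FU Unp Om N N0.
pose rep : urep_mod_null (freegroup S) B := perm_rep FU Unp N0 a.
pose vf : {n : nat & Om n} -> R[i]^o := fun t => ((tagged t \in A (tag t))%:R : R)%:C.
have vb : bounded_vec N vf.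
  apply/asboolP; exists 1 => n; rewrite ger0_norm ?seq_re_ge0 // /seq_re.
  have NE : N n = \sum_x (x \in A n)%:R.
    by rewrite -card_sumr; congr _%:R; apply: eq_card => x; rewrite inE.
  rewrite ler_pdivrMr // mul1r NE; apply: ler_sum => x _.
  by rewrite /vf /=; case: (x \in A n); rewrite !mulr0 addr0 ?mulr1.
pose v : B := exist (bounded_vec N) vf vb.
have actv u n : seq_re N (val (rep u v - v)) (val (rep u v - v)) n =
    #|[set x | (x \in A n) != (a n u x \in A n)]|%:R / N n.
  congr (_ / _); rewrite card_sumr; apply: eq_bigr => x _ /=.
  by case: (x \in _); case: (a n u x \in _) => /=; ring.
have kv : invariant rep (in_ker (freegroup_eval val)) v.
  move=> w kw; apply/qn_le0; rewrite leNgt; apply/negP => q0.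
  have [m0 hm0] : exists m : nat, 2 / qn (rep w v - v) < m%:R.
    by exists (Num.bound (2 / qn (rep w v - v))); apply: archi_boundP; rewrite divr_ge0 // ltW.
  have m00 : (0 < m0)%N by rewrite -(ltr0n R); apply: lt_trans hm0; rewrite divr_gt0.
  suff : qn (rep w v - v) <= 2 / m0%:R.
    by rewrite leNgt ltr_pdivrMr ?ltr0n // mulrC -ltr_pdivrMr // hm0.
  apply: ulim_le; first exact: bvec_re.
  apply: filterS (ultra_ge FU Unp (maxn m0 (size (word w)))) => n /=.
  rewrite geq_max => /andP[m0n wn]; rewrite actv.
  have [h _] := Hd n; have := h w kw wn; rewrite -/(a n) -/(A n) => hw.
  rewrite ler_pdivrMr // mulrAC ler_pdivlMr ?ltr0n // /N -!natrM ler_nat.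
  have := card_moved (a n w) (A n); nia.
have [w iw hw] := Hc B rep v kv.
pose e n := seq_re N (val (v - w)) (val (v - w)) n.
pose b n := \sum_(s : S) seq_re N (val (rep (freegen s) v - v)) (val (rep (freegen s) v - v)) n.
pose g n := \sum_(s : S) seq_re N (val (rep (freegen s) w - w)) (val (rep (freegen s) w - w)) n.
have be : bounded_seq e by exact: bvec_re.
have [bb lb] : bounded_seq b /\ ulim U b = \sum_(s : S) qn (rep (freegen s) v - v).
  by apply: ulim_sum => // s; exact: bvec_re.
have [bg lg] : bounded_seq g /\ ulim U g = \sum_(s : S) qn (rep (freegen s) w - w).
  by apply: ulim_sum => // s; exact: bvec_re.
have g0 : ulim U g = 0 by rewrite lg big1 // => s _; exact: iw.
have [M hM] : exists M : nat, forall n, e n <= M%:R.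
  have [M hM] := be; exists (Num.bound M) => n.
  have hn := hM n; apply: le_trans (ler_norm _) (le_trans hn _); apply/ltW/archi_boundP.
  exact: le_trans (normr_ge0 _) hn.
(* [J] thresholds bring the part of the boundary that is of the size of [A] below
   [#|A| / k]; after that, [tau] is the error allowed in the two limits. *)
pose J := (k * (2 * #|{: S}| * (1 + 9 * M) + 1)).+1.
pose tau : R := (9 * k.+1%:R * J%:R ^+ 3)^-1.
have J0 : 0 < J%:R :> R by rewrite ltr0n.
have tau0 : 0 < tau by rewrite invr_gt0 !mulr_gt0 ?exprn_gt0.
have Uf : U [set n | e n + - c * b n < tau]%classic.
  apply: ulim_lt; first by apply: bounded_seqD => //; exact: bounded_seqZ.
  rewrite ulimD ?ulimZ //; last exact: bounded_seqZ.
  by apply: le_lt_trans tau0; rewrite lb mulNr subr_le0.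
have Ug : U [set n | g n < tau]%classic by apply: ulim_lt => //; rewrite g0.
have [n [/= hf hg]] := filter_ex (filterI Uf Ug).
have [_] := Hd n; rewrite -/(a n) -/(A n); apply.
pose u x := complex.Re (val w (existT (fun i => Om i : Type) n x)).
have DE : \sum_x (u x - (x \in A n)%:R) ^+ 2 <= N n * e n.
  rewrite /e /seq_re mulrC divfK ?gt_eqF //; apply: ler_sum => x _.
  set p0 := existT _ n x.
  have -> : val (v - w) p0 = ((x \in A n)%:R : R)%:C - val w p0 by [].
  rewrite /u -/p0; case: (val w p0) => p q /=; rewrite sub0r mulrNN -!expr2.
  by rewrite -[p - _]opprB sqrrN lerDl sqr_ge0.
have GE : \sum_(s : S) \sum_x (u (a n (freegen s) x) - u x) ^+ 2 <= N n * g n.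
  rewrite /g mulr_sumr; apply: ler_sum => s _.
  rewrite /seq_re mulrC divfK ?gt_eqF //; apply: ler_sum => x _.
  set p0 := existT _ n x.
  have -> : val (rep (freegen s) w - w) p0 =
    val w (existT (fun i => Om i : Type) n (a n (freegen s) x)) - val w p0 by [].
  rewrite /u -/p0; case: (val w p0) => p q; case: (val w _) => p' q' /=.
  by rewrite -!expr2 lerDl sqr_ge0.
have [A' [h1 h2]] := @exists_level R _ _ (fun s => a n (freegen s)) u (A n) J (ltn0Sn _).
exists A'.
move: h1 h2 DE GE; set D := \sum_x _; set E := \sum_s _ => h1 h2 DE GE.
have bE : N n * b n = (bd (fun s => a n (freegen s)) (A n))%:R.
  rewrite /b mulr_sumr natr_sum; apply: eq_bigr => s _.
  by rewrite actv mulrC divfK ?gt_eqF.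
have k9 : 9 * k%:R * tau <= 1.
  rewrite /tau ler_pdivrMr ?mul1r ?mulr_gt0 ?exprn_gt0 //.
  rewrite -!mulrA ler_wpM2l // -natrX -!natrM ler_nat /=.
  by rewrite (leq_trans (leqnSn k)) // leq_pmulr // expn_gt0.
have J9 : 9 * J%:R ^+ 3 * tau <= 1.
  rewrite /tau ler_pdivrMr ?mul1r ?mulr_gt0 ?exprn_gt0 //.
  rewrite -!mulrA ler_wpM2l // -natrX -!natrM ler_nat /=.
  by rewrite leq_pmull.
split.
  rewrite -(ler_nat R) natrD !natrM -bE -/(N n).
  have e1 : e n <= c * b n + tau by move: hf; lra.
  have s1 : #|symdiff (A n) A'|%:R <= N n * (C%:R * b n + 9 * tau).
    apply: le_trans h1 _; apply: le_trans (_ : 9 * (N n * e n) <= _).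
      by rewrite ler_pM2l.
    rewrite mulrCA ler_pM2l //.
    have b0 : 0 <= b n by apply: sumr_ge0 => s _; exact: seq_re_ge0.
    have : 9 * c * b n <= C%:R * b n by rewrite ler_wpM2r.
    lra.
  have : k%:R * #|symdiff (A n) A'|%:R <= k%:R * (N n * (C%:R * b n + 9 * tau)).
    by rewrite ler_wpM2l.
  have : N n * (9 * k%:R * tau) <= N n * 1 by rewrite ler_pM2l.
  lra.
rewrite -(ler_nat R) natrM -/(N n).
set bA := (bd _ A')%:R in h2 *.
have {}h2 : J%:R * bA <= N n * (2 * #|{: S}|%:R * (1 + 9 * M%:R) + 1).
  apply: le_trans h2 _; rewrite -/(N n) [leRHS]mulrDr mulr1; apply: lerD.
    rewrite [leRHS]mulrCA. rewrite ler_wpM2l ?mulr_ge0 // [leRHS]mulrDr mulr1 lerD2l.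
    rewrite mulrCA ler_wpM2l //; apply: le_trans DE _; by rewrite ler_pM2l.
  apply: le_trans (_ : 9 * J%:R ^+ 3 * (N n * tau) <= _).
    rewrite ler_wpM2l ?mulr_ge0 ?exprn_ge0 //; apply: le_trans GE _.
    by rewrite ler_pM2l // ltW.
  by rewrite mulrCA -[leRHS]mulr1 ler_pM2l.
rewrite -(ler_pM2l J0) mulrCA.
apply: le_trans (_ : k%:R * (N n * (2 * #|{: S}|%:R * (1 + 9 * M%:R) + 1)) <= _).
  by rewrite ler_wpM2l.
rewrite mulrCA [leRHS]mulrC ler_pM2l //.
have -> : J%:R = k%:R * (2 * #|{: S}|%:R * (1 + 9 * M%:R) + 1) + 1 :> R.
  by rewrite /J -addn1 !(natrD, natrM).
by rewrite lerDl.
Qed.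

(** * Negligible sequences *)

Section Negligible.
Variables (R : realType) (U : set_system nat) (FU : UltraFilter U).
Variables (X : nat -> finType).
Implicit Types (e : nat -> nat).

Definition negligible e : Prop :=
  ((fun n => (e n)%:R / #|X n|%:R : R) @ U --> (0 : R))%classic.

Lemma ratio_ge0 (a b : nat) : 0 <= a%:R / b%:R :> R.
Proof. by rewrite divr_ge0. Qed.

Lemma squeeze0 (f g : nat -> R) : (forall n, `|f n| <= g n) ->
  (g @ U --> (0 : R) -> f @ U --> (0 : R))%classic.
Proof.
move=> fg g0; apply: norm_cvg0; apply: (@null_squeeze _ _ FU _ g) => // n.
by rewrite normr_ge0 fg.
Qed.

Lemma negligible_le e e' : (forall n, e n <= e' n)%N -> negligible e' -> negligible e.
Proof.
move=> le; apply: squeeze0 => n.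
by rewrite ger0_norm ?ratio_ge0 // ler_wpM2r ?invr_ge0 // ler_nat.
Qed.

Lemma negligibleD e e' : negligible e -> negligible e' ->
  negligible (fun n => e n + e' n)%N.
Proof.
move=> he he'; rewrite /negligible -[0 : R]addr0.
under eq_fun do rewrite natrD mulrDl.
exact: cvgD.
Qed.

Lemma negligible_sum (I : finType) (F : I -> nat -> nat) :
  (forall i, negligible (F i)) -> negligible (fun n => \sum_i F i n)%N.
Proof.
move=> hF; pose Q (e : nat -> nat) := negligible e.
suff h (r : seq I) : negligible (fun n => \sum_(i <- r) F i n)%N by exact: h.
elim: r => [|i r IH].
  by rewrite /negligible; under eq_fun do rewrite big_nil mul0r; exact: cvg_cst.
by apply: negligible_le (negligibleD (hF i) IH) => n; rewrite big_cons.
Qed.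

Lemma negligible_near e : (forall c : nat, U [set n | (c * e n <= #|X n|)%N]%classic) ->
  negligible e.
Proof.
move=> h; apply/cvgrPdist_lt => eps eps0.
have [c hc] : exists c : nat, eps^-1 < c%:R.
  by exists (Num.bound eps^-1); apply: archi_boundP; rewrite invr_ge0 ltW.
apply: filterS (h c.+1) => n /= hn; rewrite sub0r normrN ger0_norm ?ratio_ge0 //.
have [->|X0] := posnP #|X n|; first by rewrite invr0 mulr0.
rewrite ltr_pdivrMr ?ltr0n //.
have c0 : 0 < c.+1%:R :> R by rewrite ltr0n.
rewrite -(ltr_pM2l c0); apply: le_lt_trans (_ : #|X n|%:R < _).
  by rewrite -natrM ler_nat.
rewrite mulrA -[ltLHS]mul1r ltr_pM2r ?ltr0n // -ltr_pdivrMr // mul1r.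
by apply: lt_trans hc _; rewrite ltr_nat.
Qed.

Lemma near_negligible e : (forall n, 0 < #|X n|)%N -> negligible e ->
  forall c : nat, U [set n | (c * e n <= #|X n|)%N]%classic.
Proof.
move=> X0 /cvgrPdist_lt h c; have c0 : 0 < c.+1%:R^-1 :> R by rewrite invr_gt0 ltr0n.
apply: filterS (h _ c0) => n /=; rewrite sub0r normrN ger0_norm ?ratio_ge0 //.
rewrite ltr_pdivrMr ?ltr0n // mulrC ltr_pdivlMr ?ltr0n // -natrM ltr_nat => /ltnW.
by rewrite mulnC => /(leq_trans _); apply; rewrite leq_mul2r leqnSn orbT.
Qed.

Lemma uclass_negligible (s t : symprod X) :
  uclass R FU s = uclass R FU t <-> negligible (fun n => #|[set x | s n x != t n x]|).
Proof. exact: uclassP. Qed.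

End Negligible.

(** * Corresponding elements of two ultraproducts *)

Section Transfer.
Variables (R : realType) (U : set_system nat) (FU : UltraFilter U).
Variables (X Y : nat -> finType) (V : forall n, {set X n}) (phi : forall n, X n -> Y n).
Hypothesis phi_inj : forall n, {in V n &, injective (@phi n)}.
Hypothesis X_gt0 : forall n, (0 < #|X n|)%N.
Local Notation negl := (negligible R U X).
Hypothesis rest_negl : negl (fun n => #|~: V n|).
Hypothesis rest'_negl : negl (fun n => #|~: @phi n @: V n|).
Implicit Types (s t : symprod X) (p q : symprod Y).

(** The sequences represent the same element, under the identification of the
    two ultraproducts along the maps [phi n]. *)
Definition corresponds s p : Prop :=
  negl (fun n => #|missing (V n) (@phi n) (p n) (s n)|).

Lemma udist_eq0 (Z : nat -> finType) (x y : uprod R FU Z) : udist x y = 0 <-> x = y.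
Proof.
rewrite -(uclassK x) -(uclassK y); set s := rep x; set t := rep y.
have h := @cvg_udist R U FU _ s t; split=> [e|e].
  by apply/uclassP; rewrite e in h.
have h0 : ((fun n => hamming R (s n) (t n)) @ U --> (0 : R))%classic by apply/uclassP.
exact: (cvg_unique (@norm_hausdorff R R) h h0).
Qed.

Lemma ratio_transfer (a b m n e1 e2 r1 r2 : nat) : (0 < n)%N -> (0 < m)%N ->
  (b <= a + e1)%N -> (a <= b + e2)%N -> (n <= m + r1)%N -> (m <= n + r2)%N -> (b <= m)%N ->
  `|b%:R / m%:R - a%:R / n%:R| <= ((e1 + e2) + (r1 + r2))%:R / n%:R :> R.
Proof.
move=> n0 m0; rewrite -!(ler_nat R) !natrD => h1 h2 h3 h4 h5.
have n0' : 0 < n%:R :> R by rewrite ltr0n.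
have m0' : 0 < m%:R :> R by rewrite ltr0n.
have b0 : 0 <= b%:R :> R by [].
have e10 : 0 <= e1%:R :> R by [].
have e20 : 0 <= e2%:R :> R by [].
have r10 : 0 <= r1%:R :> R by [].
have r20 : 0 <= r2%:R :> R by [].
rewrite ler_pdivlMr // -{2}(gtr0_norm n0') -normrM mulrBl divfK ?gt_eqF //.
have -> : b%:R / m%:R * n%:R - a%:R = b%:R / m%:R * (n%:R - m%:R) + (b%:R - a%:R) :> R.
  by rewrite mulrBr divfK ?gt_eqF //; ring.
have c0 : 0 <= b%:R / m%:R :> R by rewrite divr_ge0.
have c1 : b%:R / m%:R <= 1 :> R by rewrite ler_pdivrMr // mul1r.
set c := b%:R / m%:R in c0 c1 *.
apply: le_trans (ler_normD _ _) _; rewrite addrC lerD //; last first.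
  rewrite normrM (ger0_norm c0).
  apply: le_trans (_ : 1 * `|n%:R - m%:R| <= _); first by rewrite ler_wpM2r.
  by rewrite mul1r ler_norml; apply/andP; split; lra.
by rewrite ler_norml; apply/andP; split; lra.
Qed.

(** The points at which [s] and [t] differ are carried to those at which [p] and
    [q] differ, and the sizes of [X n] and [Y n] are nearly equal. *)
Lemma hamming_transfer s t p q : corresponds s p -> corresponds t q ->
  ((fun n => hamming R (p n) (q n) - hamming R (s n) (t n)) @ U --> (0 : R))%classic.
Proof.
move=> cs ct; pose mm n := (#|missing (V n) (@phi n) (p n) (s n)| + #|missing (V n) (@phi n) (q n) (t n)|)%N.
pose e n := ((#|~: @phi n @: V n| + mm n) + mm n + (#|~: V n| + #|~: @phi n @: V n|))%N.
have hm : negl mm by exact: negligibleD.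
have he : negl e.
  apply: (negligibleD FU); last exact: negligibleD.
  by do 2!apply: (negligibleD FU) => //.
apply: (squeeze0 FU _ he) => n; have [c1 c2] := card_model (@phi_inj n).
apply: ratio_transfer => //.
- by have /card_gt0P[x _] := X_gt0 n; apply/card_gt0P; exists (@phi n x).
- exact: differ_transfer.
- exact: (differ_transferV (@phi_inj n)).
- exact: max_card.
Qed.

Lemma corresponds_udist s t p q : corresponds s p -> corresponds t q ->
  udist (uclass R FU p) (uclass R FU q) = udist (uclass R FU s) (uclass R FU t).
Proof.
move=> cs ct; have h := hamming_transfer cs ct.
have h2 := cvgD h (@cvg_udist R U FU _ s t); rewrite add0r in h2.
have e : (fun n => hamming R (p n) (q n) - hamming R (s n) (t n)) +
    (fun n => hamming R (s n) (t n)) = (fun n => hamming R (p n) (q n)).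
  by apply/funext => n /=; rewrite fctE subrK.
rewrite e in h2.
exact: (cvg_unique (@norm_hausdorff R R) (@cvg_udist R U FU _ p q) (h2 _)).
Qed.

Lemma corresponds_eq s t p q : corresponds s p -> corresponds t q ->
  uclass R FU p = uclass R FU q <-> uclass R FU s = uclass R FU t.
Proof.
by move=> cs ct; rewrite -!udist_eq0 (corresponds_udist cs ct).
Qed.

Lemma corresponds1 : corresponds 1%g 1%g.
Proof. by apply: (negligible_le FU _ rest_negl) => n; exact: missing1. Qed.

Lemma correspondsM s t p q : corresponds s p -> corresponds t q ->
  corresponds (s * t)%g (p * q)%g.
Proof.
move=> cs ct; apply: (negligible_le FU _ (negligibleD FU cs ct)) => n.
exact: missingM.
Qed.

Lemma correspondsV s p : corresponds s p -> corresponds s^-1%g p^-1%g.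
Proof.
by move=> cs; apply: (negligible_le FU _ cs) => n; exact: missingV.
Qed.

Definition transfer (n : nat) (s : {perm X n}) : {perm Y n} :=
  projT1 (cid (transfer_exists (@phi_inj n) s)).

Lemma transferE n (s : {perm X n}) x : x \in V n -> s x \in V n ->
  transfer s (@phi n x) = @phi n (s x).
Proof. by rewrite /transfer; case: cid => p /= h; exact: h. Qed.

Definition seq_transfer s : symprod Y := fun n => transfer (s n).

Lemma corresponds_transfer s : corresponds s (seq_transfer s).
Proof.
apply: (negligible_le FU _ (negligibleD FU rest_negl rest_negl)) => n.
by apply: missing_transfer => x; exact: transferE.
Qed.

Lemma corresponds_exists p : exists s, corresponds s p.
Proof.
exists (fun n => projT1 (cid (transferV_exists (@phi_inj n) (p n)))).
apply: (negligible_le FU _ (negligibleD FU rest_negl rest'_negl)) => n.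
by apply: (missing_transferV (@phi_inj n)); case: cid.
Qed.

(** Defined through representatives; by [uprod_transfer_class] every
    corresponding sequence gives the same value. *)
Definition uprod_transfer (x : uprod R FU X) : uprod R FU Y :=
  uclass R FU (seq_transfer (rep x)).

Lemma uprod_transfer_class s p : corresponds s p ->
  uprod_transfer (uclass R FU s) = uclass R FU p.
Proof.
move=> cs; apply/(corresponds_eq (corresponds_transfer _) cs).
exact: uclassK.
Qed.

Lemma uprod_transferM (x y : uprod R FU X) :
  uprod_transfer (x * y)%g = (uprod_transfer x * uprod_transfer y)%g.
Proof.
rewrite -{1}(uclassK x) -{1}(uclassK y) -uclassM -[RHS]uclassM.
by apply: uprod_transfer_class; apply: correspondsM; exact: corresponds_transfer.
Qed.

End Transfer.

(** * Almost commuting sequences and sequences of models *)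

Section Relators.
Variables (R : realType) (G : groupType) (S : {fset G}).
Variables (U : set_system nat) (FU : UltraFilter U) (X : nat -> finType).
Variables (rho : {multiplicative G -> uprod R FU X})
  (alpha : forall n, {multiplicative freegroup S -> {perm X n}}).
Hypothesis rho_alpha : represented_by rho alpha.

Definition relator (w : freegroup S) : Prop := freegroup_eval val w = 1%g :> G.

Lemma negligible_relator w : relator w ->
  negligible R U X (fun n => #|[set x | alpha n w x != x]%SET|).
Proof.
move=> kw; have := rho_alpha w; rewrite kw mult_1g => /esym h.
have {}h : uclass R FU (fun n => alpha n w) = uclass R FU (1%g : symprod X) by rewrite h.
move/uclass_negligible: h; apply: negligible_le => n.
by apply: card_le_sub => x; rewrite !finset.inE perm1.
Qed.

(** There are finitely many words of length at most [m], and each relator among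
    them moves a negligible set of points. *)
Lemma negligible_bad_pts m :
  negligible R U X (fun n => #|bad_pts relator (alpha n) m|).
Proof.
pose B (t : m.-bseq (S * bool)) n : {set X n} := [set x | `[< exists w : freegroup S,
  [/\ relator w, word w = t & alpha n w x != x] >]]%SET.
have hB t : negligible R U X (fun n => #|B t n|).
  have [[w [kw wt]]|no] := pselect (exists w : freegroup S, relator w /\ word w = t).
    apply: (negligible_le FU _ (negligible_relator kw)) => n.
    apply: card_le_sub => x; rewrite !finset.inE => /asboolP[w' [_ wt' h]].
    by have -> : w = w' by apply/val_inj; rewrite /= wt wt'.
  apply: (negligible_le FU (e' := fun _ => 0%N)) => [n|].
    rewrite leqn0 cards_eq0; apply/eqP/setP => x; rewrite !finset.inE; apply/asboolP.
    by case=> w [kw wt _]; apply: no; exists w.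
  by rewrite /negligible; under eq_fun do rewrite mul0r; exact: cvg_cst.
apply: (negligible_le FU _ (negligible_sum FU hB)) => n.
apply: leq_trans (_ : #|\bigcup_t B t n|%SET <= _)%N.
  apply: card_le_sub => x; rewrite finset.inE => /asboolP[w [kw wm h]].
  apply/finset.bigcupP; exists (Bseq wm) => //; rewrite finset.inE; apply/asboolP.
  by exists w.
elim/big_rec2: _ => [|t i A _ IH]; first by rewrite cards0.
by apply: leq_trans (leq_card_setU _ _) _; rewrite leq_add2l.
Qed.

Definition seq_alpha (w : freegroup S) : symprod X := fun n => alpha n w.

Lemma seq_alpha1 : seq_alpha 1%g = 1%g.
Proof. by apply: functional_extensionality_dep => n; exact: mult_1g. Qed.

Lemma seq_alphaM u v : seq_alpha (u * v)%g = (seq_alpha u * seq_alpha v)%g.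
Proof. by apply: functional_extensionality_dep => n; exact: gmulfM. Qed.

Lemma seq_alphaV u : seq_alpha u^-1%g = (seq_alpha u)^-1%g.
Proof. by apply: functional_extensionality_dep => n; exact: mult_invg. Qed.

(** The defect counts the points at which [s n] fails to commute with a
    generator, and commuting with the generators is enough. *)
Lemma negligible_defect (s : symprod X) :
  negligible R U X (fun n => defect (gens (alpha n)) [set: X n]%SET (s n)) <->
  forall w : freegroup S, commute (uclass R FU s) (uclass R FU (seq_alpha w)).
Proof.
have comm i : commute (uclass R FU s) (uclass R FU (seq_alpha (freegen i))) <->
    negligible R U X (fun n => #|[set x in [set: X n] | s n (gens (alpha n) i x) !=
                                                   gens (alpha n) i (s n x)]%SET|).
  rewrite /commute -!uclassM uclass_negligible; split; apply: negligible_le => n;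
    by apply: card_le_sub => x; rewrite !finset.inE !permM eq_sym.
split=> [h|h]; last first.
  by apply: negligible_sum => i; apply/comm/h.
have hg i : commute (uclass R FU s) (uclass R FU (seq_alpha (freegen i))).
  apply/comm/(negligible_le FU _ h) => n; rewrite /defect (bigD1 i) //=.
  exact: leq_addr.
elim/freegroup_ind => [|i w IH|i w IH].
- by rewrite seq_alpha1 mult_1g; exact: commute1.
- by rewrite seq_alphaM uclassM; exact: commuteM.
- rewrite seq_alphaM seq_alphaV uclassM mult_invg; apply: commuteM IH.
  by apply: commuteV; exact: hg.
Qed.

End Relators.

Lemma rigid_relators (R : realType) (U : set_system nat) (G : groupType) (S : {fset G}) :
  UltraFilter U -> (forall n, ~ U [set n]%classic) ->
  property_T R G -> generates S -> exists C, rigid (@relator G S) C.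
Proof.
move=> FU Unp HT gen; have [C hC] := set_rigidity FU Unp HT gen.
exists C => k; have [m hm] := hC k; exists m => X a A bad.
apply: hm => w kw wm; apply: leq_trans bad; rewrite leq_mul2l; apply/orP; right.
apply: card_le_sub => x; rewrite !finset.inE => /andP[-> h]; apply/asboolP.
by exists w.
Qed.

(** At the index [n] take the best precision up to [n] for which a model exists;
    it tends to infinity along the ultrafilter. *)
Lemma model_sequence (S : finType) (U : set_system nat) (X : nat -> finType)
    (f : forall n, S -> {perm X n}) (c : nat) :
  UltraFilter U -> (forall n, ~ U [set n]%classic) ->
  (forall k, U [set n | exists (Y : finType) (V : {set X n}) (phi : X n -> Y)
     (A : {group {perm Y}}), centralizer_model (f n) c k V phi A]%classic) ->
  exists (k : nat -> nat) (Y : nat -> finType) (V : forall n, {set X n})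
    (phi : forall n, X n -> Y n) (A : forall n, {group {perm Y n}}),
    (forall n, centralizer_model (f n) c (k n) (V n) (phi n) (A n)) /\
    forall j, U [set n | (j <= k n)%N]%classic.
Proof.
move=> FU Unp h; pose q n k := `[< exists (Y : finType) (V : {set X n}) (phi : X n -> Y)
     (A : {group {perm Y}}), centralizer_model (f n) c k V phi A >].
have q0 n : q n 0%N.
  by apply/asboolP; exists (X n), [set: X n]%SET, id, [group of 1%g]; exact: trivial_model.
have /choice[k hk] : forall n, exists k, q n k /\ forall j, (j <= n)%N -> q n j -> (j <= k)%N.
  move=> n; have [i qi max] := @arg_maxnP _ (@ord0 n) (fun i => q n i) val (q0 n).
  exists i; split=> // j jn qj.
  by have := max (Ordinal (jn : (j < n.+1)%N)) qj.
pose mod n := {Y : finType & {V : {set X n} & {phi : X n -> Y & {A : {group {perm Y}} |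
  centralizer_model (f n) c (k n) V phi A}}}}.
have hm n : exists z : mod n, True.
  by have [/asboolP[Y [V [phi [A hA]]]] _] := hk n; exists (existT _ Y (existT _ V (existT _ phi (exist _ A hA)))).
pose m n := projT1 (cid (hm n)).
exists k, (fun n => projT1 (m n)), (fun n => projT1 (projT2 (m n))),
  (fun n => projT1 (projT2 (projT2 (m n)))), (fun n => sval (projT2 (projT2 (projT2 (m n))))).
split=> [n|j]; first exact: svalP (projT2 (projT2 (projT2 (m n)))).
apply: filterS (filterI (h j) (ultra_ge FU Unp j)) => n /= [hj jn].
by have [_ ->//] := hk n; apply/asboolP.
Qed.

(** * Sofic approximations whose centralizer is an ultraproduct of groups *)

Local Open Scope classical_set_scope.
Local Open Scope ring_scope.

Theorem theorem3p1 (R : realType) (G : groupType) (S : {fset G})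
    (U : set_system nat) (FU : UltraFilter U) (X : nat -> finType)
    (rho : {multiplicative G -> uprod R FU X})
    (alpha : forall n, {multiplicative freegroup S -> {perm X n}}) :
  property_T R G ->
  symmetric_fset S ->
  generates S ->
  (forall n, ~ U [set n]) ->
  (forall n, (0 < #|X n|)%N) ->
  sofic_embedding rho ->
  represented_by rho alpha ->
  exists (Y : nat -> finType)
         (rho' : {multiplicative G -> uprod R FU Y})
         (alpha' : forall n, {multiplicative freegroup S -> {perm Y n}})
         (A : forall n, {group {perm Y n}}),
    [/\ forall n, (0 < #|Y n|)%N,
        sofic_embedding rho',
        represented_by rho' alpha',
        essentially_equivalent R U alpha alpha' &
        centralizer (range rho') = usub A].
Proof.
move=> HT _ gen Unp X0 sofic rep_rho.
have [C0 rig] := rigid_relators FU Unp HT gen.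
have [c hc] := exists_model rig.
have near_model k : U [set n | exists (Y : finType) (V : {set X n}) (phi : X n -> Y)
     (A : {group {perm Y}}), centralizer_model (gens (alpha n)) c k V phi A].
  have [m hm] := hc k.
  by apply: filterS (near_negligible FU X0 (negligible_bad_pts rep_rho m) m) => n; exact: hm.
have [k [Y [V [phi [A [mod kU]]]]]] := model_sequence FU Unp near_model.
pose negl := negligible R U X.
(* The precision [k n] tends to infinity along the ultrafilter. *)
have small e : (forall n, k n * e n <= #|X n|)%N -> negl e.
  move=> he; apply: (negligible_near FU) => j; apply: filterS (kU j) => n /= jk.
  by apply: leq_trans (he n); rewrite leq_mul2r jk orbT.
have phi_inj n : {in V n &, injective (phi n)} by have [] := mod n.
have rest : negl (fun n => #|~: V n|%SET) by apply: small => n; have [] := mod n.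
have rest' : negl (fun n => #|~: (phi n @: V n)|%SET) by apply: small => n; have [] := mod n.
pose T : uprod R FU X -> uprod R FU Y := uprod_transfer phi_inj.
have TM : {morph T \o rho : g h / (g * h)%g}.
  by move=> g h /=; rewrite gmulfM; exact: uprod_transferM.
pose rho' : {multiplicative G -> uprod R FU Y} :=
  HB.pack (T \o rho) (isMultiplicative.Build G (uprod R FU Y) _ TM).
pose alpha' n : {multiplicative freegroup S -> {perm Y n}} :=
  freegroup_eval (fun s => transfer phi_inj (alpha n (freegen s))).
pose corr := corresponds R U V phi.
have gens_corr i : corr (seq_alpha alpha (freegen i)) (seq_alpha alpha' (freegen i)).
  have -> : seq_alpha alpha' (freegen i) = seq_transfer phi_inj (seq_alpha alpha (freegen i)).
    by apply: functional_extensionality_dep => n; exact: freegroup_eval_gen.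
  exact: (corresponds_transfer FU phi_inj rest).
have words_corr w : corr (seq_alpha alpha w) (seq_alpha alpha' w).
  elim/freegroup_ind: w => [|i w IH|i w IH]; rewrite ?seq_alpha1 ?seq_alphaM ?seq_alphaV.
  - exact: (corresponds1 FU phi rest).
  - exact: (correspondsM FU (gens_corr i) IH).
  - exact: (correspondsM FU (correspondsV FU (gens_corr i)) IH).
have rep_rho' : represented_by rho' alpha'.
  move=> w; rewrite /= rep_rho; exact: uprod_transfer_class (words_corr w).
have img g : exists w, rho' g = uclass R FU (seq_alpha alpha' w).
  have [sec secK] := generates_section gen.
  by exists (sec g); rewrite -[g in LHS]secK rep_rho'.
have comm_iff s p w : corr s p ->
    commute (uclass R FU s) (uclass R FU (seq_alpha alpha w)) <->
    commute (uclass R FU p) (uclass R FU (seq_alpha alpha' w)).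
  move=> sp; rewrite /commute -!uclassM; symmetry.
  apply: (corresponds_eq FU phi_inj X0 rest rest').
    exact: (correspondsM FU sp (words_corr w)).
  exact: (correspondsM FU (words_corr w) sp).
exists Y, rho', alpha', A; split.
- by move=> n; have /card_gt0P[x _] := X0 n; apply/card_gt0P; exists (phi n x).
- move=> g g1; rewrite -(sofic g g1) -[X in _ = udist X _](uclassK (rho g)).
  apply: (corresponds_udist FU phi_inj X0 rest rest' (t := 1%g) (q := 1%g)).
    exact: (corresponds_transfer FU phi_inj rest).
  exact: (corresponds1 FU phi rest).
- exact: rep_rho'.
- exists V, (fun n => phi n @: V n)%SET, phi; split=> //.
    apply: (squeeze0 FU _ (negligibleD FU rest' (negligibleD FU rest rest'))) => n.
    have Y0 : (0 < #|Y n|)%N.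
      by have /card_gt0P[x _] := X0 n; apply/card_gt0P; exists (phi n x).
    have [c1 c2] := card_model (phi_inj n).
    have := @ratio_transfer R 0 #|~: (phi n @: V n)|%SET #|Y n| #|X n|
      #|~: (phi n @: V n)|%SET 0 #|~: V n|%SET #|~: (phi n @: V n)|%SET (X0 n) Y0.
    by rewrite mul0r subr0 addn0; apply => //; exact: max_card.
  move=> n i x xV sV; rewrite -(transferE phi_inj xV sV).
  have -> : alpha' n (freegen i) = transfer phi_inj (alpha n (freegen i)) by exact: freegroup_eval_gen.
  by [].
apply/seteqP; split=> [z hz|_ [a aA ->]].
  have [s sz] := corresponds_exists FU phi_inj rest rest' (rep z).
  have hs : negl (fun n => defect (gens (alpha n)) [set: X n]%SET (s n)).
    apply/(negligible_defect R FU alpha s) => w; apply/(comm_iff _ _ _ sz).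
    by rewrite uclassK; apply: hz; exists (freegroup_eval val w) => //; rewrite rep_rho'.
  have ha n : exists a, a \in A n /\ (k n * #|missing (V n) (phi n) a (s n)| <=
      c * k n * defect (gens (alpha n)) [set: X n]%SET (s n) + #|X n|)%N.
    by have [_ _ _ _ h] := mod n; have [a aA ha] := h (s n); exists a.
  pose a : symprod Y := fun n => projT1 (cid (ha n)).
  have aA n : a n \in A n by rewrite /a; case: cid => ? [].
  exists a => //; rewrite -(uclassK z).
  apply/(corresponds_eq FU phi_inj X0 rest rest' sz (q := a) (t := s)) => //.
  apply: (negligible_near FU) => j.
  have h1 := near_negligible FU X0 hs (2 * j * c)%N.
  apply: filterS (filterI h1 (kU (2 * j)%N)) => n /= [dn jk].
  have an : (k n * #|missing (V n) (phi n) (a n) (s n)| <=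
      c * k n * defect (gens (alpha n)) [set: X n]%SET (s n) + #|X n|)%N.
    by rewrite /a; case: cid => ? [].
  have [->|j0] := posnP j; first by rewrite mul0n.
  have k0 : (0 < k n)%N by apply: leq_trans jk; rewrite muln_gt0.
  have arith K m d N : (0 < K)%N -> (K * m <= c * K * d + N)%N ->
      (2 * j * c * d <= N)%N -> (2 * j <= K)%N -> (j * m <= N)%N.
    move=> K0 h2 h3 h4; rewrite -(leq_pmul2l K0).
    have := leq_mul (leqnn (2 * j)) h2; have := leq_mul (leqnn K) h3.
    have := leq_mul h4 (leqnn N); lia.
  exact: arith k0 an dn jk.
move=> _ [g _ <-]; have [w ->] := img g.
have hx : forall n, exists s : {perm X n},
    (k n * defect (gens (alpha n)) [set: X n]%SET s <= #|X n|)%N /\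
    (k n * #|missing (V n) (phi n) (a n) s| <= #|X n|)%N.
  by move=> n; have [_ _ _ h _] := mod n; exact: h (aA n).
pose s : symprod X := fun n => projT1 (cid (hx n)).
have hs n : (k n * defect (gens (alpha n)) [set: X n]%SET (s n) <= #|X n|)%N /\
    (k n * #|missing (V n) (phi n) (a n) (s n)| <= #|X n|)%N by rewrite /s; case: cid.
have sa : corr s a by apply: small => n; have [] := hs n.
have ds : negl (fun n => defect (gens (alpha n)) [set: X n]%SET (s n)).
  by apply: small => n; have [] := hs n.
by apply/(comm_iff _ _ _ sa); exact: (proj1 (negligible_defect R FU alpha s) ds w).
Qed.
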